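(* Let $p$ be a prime and let $G=F\rtimes H$ be a semidirect product of a finite $p$-group $H$ and a free pro-$p$ group $F$. Suppose the abelianization $F^{ab}$ is a permutation $\mathbb{Z}_p[H]$-module. Then $G$ is a pro-$p$ HNN-extension with the base group $H$.
   Context: Subgroups are closed, homomorphisms are continuous. $F^{ab}=F/[F,F]$ (closure of the commutator subgroup), with $H$ acting by conjugation. A pointed profinite space $(X,* )$ is a profinite space with a distinguished point. If $(X,* )=\varprojlim (X_i,* )$ with $(X_i,* )$ finite, then $\mathbb{Z}_p[[X,*]]=\varprojlim \mathbb{Z}_p[X_i,*]$, where $\mathbb{Z}_p[X_i,*]$ is the free $\mathbb{Z}_p$-module on $X_i$ modulo $*=0$. If $H$ acts continuously on $(X,* )$ (fixing $*$), then $\mathbb{Z}_p[[X,*]]$ is naturally a pro-$p$ $\mathbb{Z}_p[H]$-module; a permutation $\mathbb{Z}_p[H]$-module is a module of this form. The free pro-$p$ group $F(X,* )$ on a pointed profinite space $(X,* )$ is a pro-$p$ group with a continuous map of pointed spaces $(X,* )\to (F(X,* ),1)$ that is universal among continuous maps of pointed spaces from $(X,* )$ to pro-$p$ groups pointed at $1$. HNN-extension: let $K$ be a pro-$p$ group, $\{A_i\mid i\in I\}$ a finite set of (pairwise non-conjugate) subgroups of $K$, $\{(X_i,* )\mid i\in I\}$ a family of pointed profinite spaces, and $\phi_i:A_i\times X_i\to K$ continuous maps such that for each $x\in X_i$ the restriction of $\phi_i$ to $A_i\times\{x\}$ is an injective homomorphism, and its restriction to $A_i\times\{*\}$ is the identity.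 The pro-$p$ HNN-extension $\mathrm{HNN}(K,A_i,\phi_i,X_i)$, $i\in I$, with base group $K$, is the quotient of the free pro-$p$ product $\coprod_{i\in I}F(X_i,* )\amalg K$ modulo the relations $\phi_i(a_i,x_i)=x_ia_ix_i^{-1}$ for all $a_i\in A_i$, $x_i\in X_i$, $i\in I$. ''$G$ is an HNN-extension with the base group $H$'' means that $G$ is such an HNN-extension for suitable data, with the given subgroup $H\le G$ in the role of the base group $K$. *)

(* Defs.v *)
From HB Require Import structures.
From mathcomp Require Import all_boot all_algebra all_classical topology.
From mathcomp Require Import generic_quotient.

Set Implicit Arguments.
Unset Strict Implicit.
Unset Printing Implicit Defensive.

Local Open Scope classical_set_scope.
Local Open Scope group_scope.
Local Open Scope quotient_scope.

HB.mixin Record Group_isTopGroup G of Group G & Topological G := {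
  mulg_continuous : continuous (fun xy : G * G => xy.1 * xy.2);
  invg_continuous : continuous (fun x : G => x^-1)
}.

#[short(type="topGroupType")]
HB.structure Definition TopGroup :=
  {G of Group G & Topological G & Group_isTopGroup G}.

Section TopGroupDefs.
Variable G : topGroupType.
Implicit Types (A N S : set G).

Definition is_subgroup A :=
  [/\ A 1, (forall x y, A x -> A y -> A (x * y)) & (forall x, A x -> A x^-1)].

Definition is_normal_subgroup A :=
  is_subgroup A /\ (forall g x, A x -> A (g * x * g^-1)).

Definition generated_subgroup S : set G :=
  \bigcap_(A in [set A | is_subgroup A /\ S `<=` A]) A.

Definition closed_normal_closure S : set G :=
  \bigcap_(N in [set N | [/\ is_normal_subgroup N, closed N & S `<=` N]]) N.

Definition commutator_subgroup : set G :=
  generated_subgroup [set [~ x.1, x.2] | x in [set: G * G]].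

Definition left_cosets A : set (set G) :=
  [set [set x * a | a in A] | x in [set: G]].

Lemma closed_normal_closure_normal S :
  is_normal_subgroup (closed_normal_closure S).
Proof.
split; first split.
- by move=> N [[[]]].
- by move=> x y hx hy N hN; have [[[_ NM _] _] _ _] := hN; exact: NM (hx N hN) (hy N hN).
- by move=> x hx N hN; have [[[_ _ NV] _] _ _] := hN; exact: NV (hx N hN).
by move=> g x hx N hN; have [[_ NJ] _ _] := hN; exact: NJ (hx N hN).
Qed.

Lemma conj_continuous (g : G) : continuous (fun x : G => g * x * g^-1).
Proof.
have mulc (f f' : G -> G) : continuous f -> continuous f' ->
    continuous (fun x => f x * f' x).
  move=> cf cf' x; apply: (@continuous_comp _ _ _ (fun x => (f x, f' x))
    (fun xy => xy.1 * xy.2)); last exact: mulg_continuous.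
  by exact: (cvg_pair (cf x) (cf' x)).
apply: (mulc (fun x => g * x)) => [|x]; last exact: cvg_cst.
by apply: (mulc (fun=> g) id) => x; [exact: cvg_cst|exact: cvg_id].
Qed.

Lemma closure_normal N : is_normal_subgroup N -> is_normal_subgroup (closure N).
Proof.
move=> [[N1 NM NV] NJ]; split; first split.
- exact: subset_closure.
- move=> x y cx cy B /(@mulg_continuous G (x, y)) [[U V] [/= nU nV] UVB].
  have [a [Na Ua]] := cx _ nU; have [b [Nb Vb]] := cy _ nV.
  by exists (a * b); split; [exact: NM|exact: (UVB (a, b))].
- move=> x cx B /(@invg_continuous G x) nB.
  by have [a [Na Ba]] := cx _ nB; exists a^-1; split=> //; exact: NV.
- move=> g x cx B /(@conj_continuous g x) nB.
  by have [a [Na Ba]] := cx _ nB; eexists; split; last exact: Ba; exact: NJ.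
Qed.

Lemma commutator_subgroup_normal : is_normal_subgroup commutator_subgroup.
Proof.
split; first split.
- by move=> A [[]].
- by move=> x y hx hy A hA; have [[_ AM _] _] := hA; exact: AM (hx A hA) (hy A hA).
- by move=> x hx A hA; have [[_ _ AV] _] := hA; exact: AV (hx A hA).
move=> g x hx A hA; have [[A1 AM AV] SA] := hA.
have -> : g * x * g^-1 = x * [~ x, g^-1].
  by rewrite /commg /conjg invgK mulVKg mulgA.
apply: AM; first exact: hx.
by apply: SA; exists (x, g^-1).
Qed.

End TopGroupDefs.

Definition is_top_hom (G L : topGroupType) (f : G -> L) :=
  {morph f : x y / x * y} /\ continuous f.

Definition is_top_iso (G L : topGroupType) (f : G -> L) :=
  is_top_hom f /\ exists g : L -> G, [/\ continuous g, cancel f g & cancel g f].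

Record normalSubgroup (G : topGroupType) := NormalSubgroup {
  ns_set :> set G;
  ns_normal : is_normal_subgroup ns_set
}.

Section Quotient.
Variables (G : topGroupType) (N : normalSubgroup G).
Local Notation inN := (ns_set N).

Let N1 : inN 1. Proof. by case: (ns_normal N) => -[]. Qed.
Let NM x y : inN x -> inN y -> inN (x * y).
Proof. by case: (ns_normal N) => -[_ + _] _; exact. Qed.
Let NV x : inN x -> inN x^-1.
Proof. by case: (ns_normal N) => -[_ _ +] _; exact. Qed.
Let NJ g x : inN x -> inN (g * x * g^-1).
Proof. by case: (ns_normal N) => _; exact. Qed.

Definition coset_rel (x y : G) : bool := `[< inN (x^-1 * y) >].

Lemma coset_rel_refl : reflexive coset_rel.
Proof. by move=> x; apply/asboolP; rewrite mulVg. Qed.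

Lemma coset_rel_sym : symmetric coset_rel.
Proof.
suff H x y : coset_rel x y -> coset_rel y x by move=> x y; apply/idP/idP; apply: H.
by move=> /asboolP/NV; rewrite invgM invgK => ?; apply/asboolP.
Qed.

Lemma coset_rel_trans : transitive coset_rel.
Proof.
move=> y x z /asboolP h1 /asboolP h2; apply/asboolP.
by move: (NM h1 h2); rewrite -mulgA mulVKg.
Qed.

Definition coset_equiv := EquivRel coset_rel
  coset_rel_refl coset_rel_sym coset_rel_trans.

Definition quotg : Type := quotient_topology {eq_quot coset_equiv}.
HB.instance Definition _ := Topological.on quotg.
HB.instance Definition _ := Quotient.on quotg.

Definition piq : G -> quotg := \pi_quotg.

Lemma piqP x y : piq x = piq y <-> inN (x^-1 * y).
Proof.
split=> [h|h].
- have : x == y %[mod {eq_quot coset_equiv}] by apply/eqP; exact: h.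
  by rewrite eqmodE => /asboolP.
- have : x == y %[mod {eq_quot coset_equiv}] by rewrite eqmodE; apply/asboolP.
  by move/eqP.
Qed.

Lemma reprqK (u : quotg) : piq (repr u) = u. Proof. exact: reprK. Qed.

Definition mulq (u v : quotg) : quotg := piq (repr u * repr v).
Definition invq (u : quotg) : quotg := piq (repr u)^-1.

Lemma piqM x y : mulq (piq x) (piq y) = piq (x * y).
Proof.
have /piqP hx := reprqK (piq x); have /piqP hy := reprqK (piq y).
set x' := repr _ in hx *; set y' := repr _ in hy *.
apply/piqP; rewrite invgM.
have -> : y'^-1 * x'^-1 * (x * y) = (y'^-1 * (x'^-1 * x) * y'^-1^-1) * (y'^-1 * y).
  by rewrite invgK -!mulgA mulVKg.
exact: NM (NJ _ hx) hy.
Qed.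

Lemma piqV x : invq (piq x) = piq x^-1.
Proof.
have /piqP hx := reprqK (piq x); set x' := repr _ in hx *.
apply/piqP; rewrite invgK; move: (NJ x' (NV hx)); rewrite invgM invgK.
by rewrite !mulgA mulgK.
Qed.

Lemma piq_ind (P : quotg -> Prop) : (forall x, P (piq x)) -> forall u, P u.
Proof. by move=> h u; rewrite -(reprqK u). Qed.

Lemma mulqA : associative mulq.
Proof.
by elim/piq_ind=> x; elim/piq_ind=> y; elim/piq_ind=> z; rewrite !piqM mulgA.
Qed.
Lemma mul1q : left_id (piq 1) mulq.
Proof. by elim/piq_ind=> x; rewrite piqM mul1g. Qed.
Lemma mulq1 : right_id (piq 1) mulq.
Proof. by elim/piq_ind=> x; rewrite piqM mulg1. Qed.
Lemma mulVq : left_inverse (piq 1) invq mulq.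
Proof. by elim/piq_ind=> x; rewrite piqV piqM mulVg. Qed.
Lemma mulqV : right_inverse (piq 1) invq mulq.
Proof. by elim/piq_ind=> x; rewrite piqV piqM mulgV. Qed.

HB.instance Definition _ := isGroup.Build quotg mulqA mul1q mulq1 mulVq mulqV.

Lemma piq_continuous : continuous piq. Proof. exact: pi_continuous. Qed.

Lemma piq_open (U : set G) : open U -> open (piq @` U).
Proof.
move=> oU; suff : open (piq @^-1` (piq @` U)) by [].
have -> : piq @^-1` (piq @` U) = \bigcup_(n in N) ((fun x => x * n) @^-1` U).
  apply/seteqP; split=> x /=.
  - by move=> [u Uu /esym/piqP Nxu]; exists (x^-1 * u) => //=; rewrite mulVKg.
  - by move=> [n Nn Uxn]; exists (x * n) => //; apply/esym/piqP; rewrite mulKg.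
apply: bigcup_open => n _; apply: open_comp => // x _.
apply: (@continuous_comp _ _ _ (fun x => (x, n)) (fun xy => xy.1 * xy.2)).
  by exact: (cvg_pair (@cvg_id _ _) (cvg_cst _)).
exact: mulg_continuous.
Qed.

Lemma piq_nbhs x (U : set G) : nbhs x U -> nbhs (piq x) (piq @` U).
Proof.
rewrite nbhsE => -[V [oV Vx] VU]; rewrite nbhsE; exists (piq @` V).
  by split; [exact: piq_open|exists x].
exact: image_subset.
Qed.

Lemma mulq_continuous : continuous (fun uv : quotg * quotg => uv.1 * uv.2).
Proof.
move=> [u v]; elim/piq_ind: u => x; elim/piq_ind: v => y B /=.
rewrite -[piq x * piq y]/(mulq _ _) piqM => /piq_continuous.
move=> /(@mulg_continuous G (x, y)) [[U V] [/= nU nV] UVB].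
exists (piq @` U, piq @` V); first by split; exact: piq_nbhs.
move=> [_ _] [/= [a Ua <-] [b Vb <-]] /=.
by rewrite -[_ * _]/(mulq _ _) piqM; exact: (UVB (a, b)).
Qed.

Lemma invq_continuous : continuous (fun u : quotg => u^-1).
Proof.
elim/piq_ind=> x B /=; rewrite -[(piq x)^-1]/(invq _) piqV => /piq_continuous.
move=> /(@invg_continuous G x) /piq_nbhs; apply: filterS => _ [a Ba <-] /=.
by rewrite -[_^-1]/(invq _) piqV.
Qed.

HB.instance Definition _ :=
  Group_isTopGroup.Build quotg mulq_continuous invq_continuous.

End Quotient.

Definition abelianization_kernel (G : topGroupType) : normalSubgroup G :=
  NormalSubgroup (closure_normal (@commutator_subgroup_normal G)).

Definition abelianization (G : topGroupType) : topGroupType :=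
  quotg (abelianization_kernel G).

Definition profinite_space (X : topologicalType) :=
  [/\ compact [set: X], hausdorff_space X & totally_disconnected [set: X]].

Definition pro_p_group (p : nat) (G : topGroupType) :=
  profinite_space G /\
  forall U : set G, is_normal_subgroup U -> open U ->
    exists n, (left_cosets U #= `I_(p ^ n))%card.

Definition finite_p_group (p : nat) (H : topGroupType) :=
  (forall x : H, open [set x]) /\ exists n, ([set: H] #= `I_(p ^ n))%card.

Definition is_free_pro_p_on (p : nat) (X : topologicalType) (pt : X)
    (F : topGroupType) (iota : X -> F) :=
  [/\ pro_p_group p F, continuous iota, iota pt = 1 &
    forall (L : topGroupType) (f : X -> L),
      pro_p_group p L -> continuous f -> f pt = 1 ->
      exists! g : F -> L, is_top_hom g /\ (forall x, g (iota x) = f x)].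

Definition free_pro_p_group (p : nat) (F : topGroupType) :=
  exists (X : topologicalType) (pt : X) (iota : X -> F),
    profinite_space X /\ is_free_pro_p_on p pt iota.

(* The free pro-p product of a finite family [Fs] and of [K] is their coproduct
   in the category of pro-p groups. *)
Definition is_free_pro_p_product (p : nat) (I : finType)
    (Fs : I -> topGroupType) (K P : topGroupType)
    (inF : forall i, Fs i -> P) (inK : K -> P) :=
  [/\ pro_p_group p P, (forall i, is_top_hom (@inF i)), is_top_hom inK &
    forall (L : topGroupType) (f : forall i, Fs i -> L) (k : K -> L),
      pro_p_group p L -> (forall i, is_top_hom (@f i)) -> is_top_hom k ->
      exists! g : P -> L,
        [/\ is_top_hom g, (forall i x, g (inF i x) = f i x) &
            (forall x, g (inK x) = k x)]].

(* An element of Z_p is a coherent sequence of residues modulo p, p^2, ...; the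
   term of index k lives modulo p^(k+1) since ['Z_1] is not the zero ring. *)
Definition padic_seq (p : nat) : Type :=
  prod_topology (fun k : nat => discrete_topology 'Z_(p ^ k.+1)).
HB.instance Definition _ p := Topological.on (padic_seq p).

Definition padic_coherent (p : nat) : set (padic_seq p) :=
  [set a | forall k, inZp (a k.+1 : 'Z_(p ^ k.+2)) = a k :> 'Z_(p ^ k.+1)].

Definition padic (p : nat) : Type := set_type (@padic_coherent p).
HB.instance Definition _ p := Topological.on (padic p).

Section PadicZmodule.
Local Open Scope ring_scope.
Import GRing.Theory.
Variable p : nat.
Implicit Types a b c : padic p.

Definition padic_coef a (k : nat) : 'Z_(p ^ k.+1) := val a k.

Lemma padic_coefP a k : inZp (padic_coef a k.+1) = padic_coef a k.
Proof. exact: (set_mem (valP a)) k. Qed.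

Lemma padic_eq a b : (forall k, padic_coef a k = padic_coef b k) -> a = b.
Proof. by move=> h; apply/val_inj/functional_extensionality_dep. Qed.

Lemma Zp_trunc_dvd k :
  ((Zp_trunc (p ^ k.+1)).+2 %| (Zp_trunc (p ^ k.+2)).+2)%N.
Proof.
case: p => [|[|q]]; rewrite ?exp0n ?exp1n //.
by rewrite !Zp_cast ?dvdn_exp2l // -[1%N](expn0 q.+2) ltn_exp2l.
Qed.

Definition padic_of_seq (f : forall k, 'Z_(p ^ k.+1))
  (h : forall k, inZp (f k.+1) = f k) : padic p :=
  exist _ (f : padic_seq p) (mem_set h).

Lemma inZpD m n (a b : 'I_m.+1) : (n.+1 %| m.+1)%N ->
  inZp (nat_of_ord (a + b)) = inZp a + inZp b :> 'I_n.+1.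
Proof.
by move=> dvd; apply/val_inj; rewrite /= modn_dvdm // modnDm. Qed.

Lemma padic_add_subproof a b k :
  inZp (nat_of_ord (padic_coef a k.+1 + padic_coef b k.+1)) =
  padic_coef a k + padic_coef b k.
Proof.
rewrite -(padic_coefP a k) -(padic_coefP b k); exact: inZpD (Zp_trunc_dvd k).
Qed.

Lemma inZp0 m n : inZp (nat_of_ord (0 : 'I_m.+1)) = 0 :> 'I_n.+1.
Proof. by apply/val_inj; exact: mod0n. Qed.

Lemma inZpN m n (a : 'I_m.+1) : (n.+1 %| m.+1)%N ->
  inZp (nat_of_ord (- a)) = - inZp a :> 'I_n.+1.
Proof. by move=> dvd; apply: (addrI (inZp a)); rewrite -inZpD // !addrN inZp0. Qed.

Lemma padic_opp_subproof a k : inZp (nat_of_ord (- padic_coef a k.+1)) = - padic_coef a k.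
Proof. by rewrite -(padic_coefP a k); exact: inZpN (Zp_trunc_dvd k). Qed.

Lemma padic_zero_subproof k : inZp (nat_of_ord (0 : 'Z_(p ^ k.+2))) = 0 :> 'Z_(p ^ k.+1).
Proof. exact: inZp0. Qed.

Definition padic_add a b := padic_of_seq (padic_add_subproof a b).
Definition padic_opp a := padic_of_seq (padic_opp_subproof a).
Definition padic_zero : padic p := padic_of_seq padic_zero_subproof.

Lemma padic_addA : associative padic_add.
Proof. by move=> a b c; apply: padic_eq => k; exact: addrA. Qed.
Lemma padic_addC : commutative padic_add.
Proof. by move=> a b; apply: padic_eq => k; exact: addrC. Qed.
Lemma padic_add0 : left_id padic_zero padic_add.
Proof. by move=> a; apply: padic_eq => k; exact: add0r. Qed.
Lemma padic_addN : left_inverse padic_zero padic_opp padic_add.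
Proof. by move=> a; apply: padic_eq => k; exact: addNr. Qed.

HB.instance Definition _ := GRing.isZmodule.Build (padic p)
  padic_addA padic_addC padic_add0 padic_addN.

End PadicZmodule.

(* The finite discrete quotients of (X, pt), carried by the pointed sets
   ({0, ..., n}, 0), form an inverse system with limit (X, pt). *)
Record finQuotient (X : topologicalType) (pt : X) := FinQuotient {
  fq_size : nat;
  fq_map :> X -> 'I_fq_size.+1;
  fq_continuous : continuous (fq_map : X -> discrete_topology 'I_fq_size.+1);
  fq_surj : forall y, exists x, fq_map x = y;
  fq_pt : fq_map pt = ord0
}.

Section CompleteModule.
Local Open Scope ring_scope.
Import GRing.Theory.
Variables (p : nat) (X : topologicalType) (pt : X).

Definition zpx_family : Type :=
  prod_topology (fun q : finQuotient pt =>
    prod_topology (fun _ : 'I_(fq_size q).+1 => padic p)).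
HB.instance Definition _ := Topological.on zpx_family.

(* [c q] is the element \sum_(y != 0) c q y * y of Z_p[X_q, 0], the free module
   on X_q = {0, ..., fq_size q} modulo 0; normalizing [c q ord0 = 0] picks
   one representative of each class. The family [c] is compatible with all the
   transition maps [r] between finite quotients. *)
Definition zpx_limit : set zpx_family :=
  [set c | (forall q, c q ord0 = 0) /\
    forall (q q' : finQuotient pt)
        (r : 'I_(fq_size q).+1 -> 'I_(fq_size q').+1),
      (forall x, r (q x) = q' x) ->
      forall y, y != ord0 -> c q' y = \sum_(z | r z == y) c q z].

(* Z_p[[X, pt]] *)
Definition zpx : Type := set_type zpx_limit.
HB.instance Definition _ := Topological.on zpx.

Implicit Types a b c : zpx.

Definition zpx_coef c (q : finQuotient pt) : 'I_(fq_size q).+1 -> padic p :=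
  val c q.
Arguments zpx_coef c q y : clear implicits.

Lemma zpx_coef0 c q : zpx_coef c q ord0 = 0.
Proof. exact: (proj1 (set_mem (valP c))) q. Qed.

Lemma zpx_coef_compat c (q q' : finQuotient pt)
    (r : 'I_(fq_size q).+1 -> 'I_(fq_size q').+1) :
  (forall x, r (q x) = q' x) -> forall y, y != ord0 ->
  zpx_coef c q' y = \sum_(z | r z == y) zpx_coef c q z.
Proof. exact: (proj2 (set_mem (valP c))) q q' r. Qed.

Lemma zpx_eq a b : (forall q y, zpx_coef a q y = zpx_coef b q y) -> a = b.
Proof.
by move=> h; apply/val_inj/functional_extensionality_dep => q; apply/funext/h.
Qed.

Lemma zpx_add_subproof a b :
  zpx_limit (fun q y => zpx_coef a q y + zpx_coef b q y).
Proof.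
split=> [q|q q' r h y y0]; first by rewrite !zpx_coef0 addr0.
by rewrite !(zpx_coef_compat _ h y0) big_split.
Qed.

Lemma zpx_opp_subproof a : zpx_limit (fun q y => - zpx_coef a q y).
Proof.
split=> [q|q q' r h y y0]; first by rewrite zpx_coef0 oppr0.
by rewrite (zpx_coef_compat _ h y0) sumrN.
Qed.

Lemma zpx_zero_subproof : zpx_limit (fun q y => 0).
Proof. by split=> // q q' r h y y0; rewrite big1. Qed.

Definition zpx_of_family (c : zpx_family) (h : zpx_limit c) : zpx :=
  exist _ c (mem_set h).

Definition zpx_add a b : zpx := zpx_of_family (zpx_add_subproof a b).
Definition zpx_opp a : zpx := zpx_of_family (zpx_opp_subproof a).
Definition zpx_zero : zpx := zpx_of_family zpx_zero_subproof.

Lemma zpx_addA : associative zpx_add.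
Proof. by move=> a b c; apply: zpx_eq => q y; exact: addrA. Qed.
Lemma zpx_addC : commutative zpx_add.
Proof. by move=> a b; apply: zpx_eq => q y; exact: addrC. Qed.
Lemma zpx_add0 : left_id zpx_zero zpx_add.
Proof. by move=> a; apply: zpx_eq => q y; exact: add0r. Qed.
Lemma zpx_addN : left_inverse zpx_zero zpx_opp zpx_add.
Proof. by move=> a; apply: zpx_eq => q y; exact: addNr. Qed.

HB.instance Definition _ := GRing.isZmodule.Build zpx
  zpx_addA zpx_addC zpx_add0 zpx_addN.

End CompleteModule.

Arguments zpx_coef {p X pt} c q y.

Record pointedAction (H : topGroupType) (X : topologicalType) (pt : X) :=
  PointedAction {
    pa_act :> H -> X -> X;
    pa_continuous : continuous (fun hx : H * X => pa_act hx.1 hx.2);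
    pa_1 : forall x, pa_act 1 x = x;
    pa_M : forall g h x, pa_act (g * h) x = pa_act g (pa_act h x);
    pa_pt : forall h, pa_act h pt = pt
  }.

Section PermutationModule.
Variables (p : nat) (H : topGroupType) (X : topologicalType) (pt : X).
Variable act : pointedAction H pt.

Program Definition fq_act (h : H) (q : finQuotient pt) : finQuotient pt :=
  @FinQuotient X pt (fq_size q) (q \o act h) _ _ _.
Next Obligation.
move=> h q x; apply: (@continuous_comp _ _ _ (act h)).
  apply: (@continuous_comp _ _ _ (fun x => (h, x)) (fun hx => act hx.1 hx.2)).
    by exact: (cvg_pair (cvg_cst _) (@cvg_id _ _)).
  exact: pa_continuous.
exact: fq_continuous.
Qed.
Next Obligation.
move=> h q y; have [x <-] := fq_surj y.
by exists (act h^-1 x); rewrite /= -pa_M mulgV pa_1.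
Qed.
Next Obligation. by move=> h q /=; rewrite pa_pt fq_pt. Qed.

Lemma zpx_act_subproof (h : H) (c : zpx p pt) :
  zpx_limit (fun q => zpx_coef c (fq_act h q)).
Proof.
split=> [q|q q' r hr y y0]; first exact: zpx_coef0.
by apply: (@zpx_coef_compat _ _ _ c (fq_act h q) (fq_act h q') r _ y y0) => x;
  exact: hr.
Qed.

(* The action on Z_p[[X, pt]] induced by functoriality: it sends x to hx, hence
   the image of hc in the quotient q is the image of c in the quotient q o h. *)
Definition zpx_act (h : H) (c : zpx p pt) : zpx p pt :=
  zpx_of_family (zpx_act_subproof h c).

End PermutationModule.

(* [M] is a pro-p Z_p[H]-module written multiplicatively. Its Z_p-structure is
   determined by its topological group structure (continuous extension of
   integer powers), so an isomorphism of pro-p Z_p[H]-modules is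
   the same thing as an H-equivariant isomorphism of topological groups. *)
Definition permutation_module (p : nat) (H M : topGroupType)
    (actM : H -> M -> M) :=
  exists (X : topologicalType) (pt : X) (act : pointedAction H pt)
      (theta : M -> zpx p pt) (theta' : zpx p pt -> M),
    [/\ profinite_space X,
        cancel theta theta' /\ cancel theta' theta,
        continuous theta /\ continuous theta',
        (forall m m', theta (m * m') = (theta m + theta m')%R) &
        (forall h m, theta (actM h m) = zpx_act act h (theta m))].

(* [G] is the (internal) semidirect product of the images of [iF] and [iH]; as a
   space it is the product of F and H. *)
Definition is_semidirect (F H G : topGroupType) (iF : F -> G) (iH : H -> G) :=
  [/\ is_top_hom iF, is_top_hom iH, is_normal_subgroup (range iF) &
    exists s : G -> F * H,
      [/\ continuous s, cancel (fun fh => iF fh.1 * iH fh.2) s &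
          cancel s (fun fh => iF fh.1 * iH fh.2)]].

(* For [iF] injective with normal image: the [f'] such that
   [iF f' = g * iF f * g^-1]. *)
Definition conj_in (F G : topGroupType) (iF : F -> G) (g : G) (f : F) : F :=
  xget f [set f' | iF f' = g * iF f * g^-1].

Definition ab_conj (F H G : topGroupType) (iF : F -> G) (iH : H -> G)
    (h : H) (u : abelianization F) : abelianization F :=
  piq (abelianization_kernel F) (conj_in iF (iH h) (repr u)).

Record HNN_data (K : topGroupType) := HNNData {
  hnn_I : finType;
  hnn_A : hnn_I -> set K;
  hnn_X : hnn_I -> topologicalType;
  hnn_pt : forall i, hnn_X i;
  hnn_phi : forall i, K -> hnn_X i -> K; (* only its values on [hnn_A i] matter *)
  hnn_A_closed : forall i, is_subgroup (hnn_A i) /\ closed (hnn_A i);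
  hnn_A_nonconj : forall i j (k : K), i <> j ->
    hnn_A j <> [set k * a * k^-1 | a in hnn_A i];
  hnn_X_profinite : forall i, profinite_space (hnn_X i);
  hnn_phi_continuous : forall i,
    {within hnn_A i `*` [set: hnn_X i],
      continuous (fun ax => @hnn_phi i ax.1 ax.2)};
  hnn_phi_morph : forall i (x : hnn_X i) a b, hnn_A i a -> hnn_A i b ->
    hnn_phi (a * b) x = hnn_phi a x * hnn_phi b x;
  hnn_phi_inj : forall i (x : hnn_X i), set_inj (hnn_A i) ((@hnn_phi i)^~ x);
  hnn_phi_pt : forall i a, hnn_A i a -> hnn_phi a (hnn_pt i) = a
}.

Section HNN.
Variables (K : topGroupType) (D : HNN_data K).
Variables (Fs : hnn_I D -> topGroupType) (iota : forall i, hnn_X i -> Fs i).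
Variables (P : topGroupType) (inF : forall i, Fs i -> P) (inK : K -> P).

Definition hnn_relators : set P :=
  [set w | exists i (a : K) (x : hnn_X i), hnn_A i a /\
    w = (inK (hnn_phi a x))^-1 *
        (inF (iota x) * inK a * (inF (iota x))^-1)].

Definition hnn_kernel : normalSubgroup P :=
  NormalSubgroup (closed_normal_closure_normal hnn_relators).

End HNN.

(* [G], together with [j : K -> G], is the HNN-extension with base [K] given by
   [D]; the groups F(X_i, pt_i) and the free pro-p product, being defined by
   universal properties, are given by any of their models. *)
Definition is_HNN (p : nat) (K : topGroupType) (D : HNN_data K)
    (G : topGroupType) (j : K -> G) :=
  exists (Fs : hnn_I D -> topGroupType) (iota : forall i, hnn_X i -> Fs i)
      (P : topGroupType) (inF : forall i, Fs i -> P) (inK : K -> P)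
      (theta : quotg (hnn_kernel iota inF inK) -> G),
    [/\ forall i, is_free_pro_p_on p (hnn_pt i) (@iota i),
        is_free_pro_p_product p inF inK,
        is_top_iso theta &
        forall k, theta (piq _ (inK k)) = j k].

Definition HNN_extension_with_base (p : nat) (K G : topGroupType)
    (j : K -> G) :=
  pro_p_group p K /\ exists D : HNN_data K, is_HNN p D j.

(* Main.v *)
From HB Require Import structures.
Require Import Defs.
From mathcomp Require Import all_boot all_algebra all_fingroup all_solvable all_classical topology.
From mathcomp Require Import zify ring.

(* Homomorphisms F -> Z/p^N factor through F^ab, so the hypothesis yields an
   H-stable family chi_y (y in Y) of compatible systems of homomorphisms to Z/p^N
   that reduce to a basis of Hom(F, F_p).

   The main point: if y0 is fixed by A <= H, some f in F centralized by A satisfies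
   chi_y(f) = [y = y0] mod p for all y fixed by A. By freeness the chi_y extend to
   Magnus coefficients mu_w, w a word in Y, and these span the polynomial functions
   F -> Z/p^N. The functional sending mu_(y0) to 1 and the other mu_w to 0 becomes
   A-invariant after averaging over A and dividing by |A|, one length of words at a
   time, and each step loses only a bounded power of p. The functions on a given
   finite quotient Q of F are polynomial of bounded degree, as a p-group acts
   nilpotently on them; so for N large the functional is A-invariant mod p on
   functions on Q. Let c(q) be its value on the indicator function of q in Q.
   As the orbits of A on Q have p-power size, the product over the q in Q fixed by A
   of the powers q^(c(q)) has the required values; compactness yields f.

   Choosing these elements convergently and equivariantly gives x : Y -> F, tending
   to 1, permuted by H, such that restriction to x is bijective from Hom(F, F_p) to
   the finitely supported functions Y -> F_p (it is unipotent for the socle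
   filtration). By induction on central series, x is a free pro-p basis of F. Take
   representatives y of the H-orbits on Y, with stabilizers A_y chosen among fixed
   representatives of the conjugacy classes of subgroups. The stable letter x_y
   commutes with A_y, and F >< H is the HNN-extension of H with phi_i (a, x) = a. *)

Set Implicit Arguments.
Unset Strict Implicit.
Unset Printing Implicit Defensive.

Import GRing.Theory.
Local Open Scope classical_set_scope.
Local Open Scope group_scope.

(** * Profinite and pro-p groups *)

(** The obstacle is that A is a p-group, so that an average over A cannot be divided by |A| modulo
    p. The permutation structure over Z_p is what removes it: it gives characters that H permutes
    modulo every power of p, and modulo p^(N+1) the division by |A| makes sense at the cost of log_p
    |A| powers of p. The order of the choices matters. The degree bound K comes from functions Q ->
    F_p alone; then N is K times log_p |A|, which leaves exactly one power of p. Magnus coefficients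
    are not equivariant, since each comes from an arbitrary splitting of an extension. But the
    leading part of the coefficient at w depends only on the chi, so translation by A changes it by
    terms of lower degree; this is what lets the averaging proceed by length. The dual element of y
    is controlled only against the y' fixed by the stabilizer of y. This suffices because the
    remaining terms cancel in orbits modulo p. *)

Lemma compact_directed (X : topologicalType) (I : Type) (C : I -> set X) (i0 : I) :
  compact [set: X] -> (forall i, closed (C i)) -> (forall i, C i !=set0) ->
  (forall i j, exists k, C k `<=` C i `&` C j) ->
  exists x, forall i, C i x.
Proof.
move=> cX cC C0 dC.
have FF : Filter (filter_from [set: I] C).
  apply: filter_from_filter; first by exists i0.
  by move=> i j _ _; have [k hk] := dC i j; exists k.
have PF : ProperFilter (filter_from [set: I] C).
  by apply: filter_from_proper => // i _; exact: C0.
have [//|x [_ hx]] := cX _ PF; first exact: filterT.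
exists x => i; apply: cC => B /hx h.
by have [y [Cy By]] := h (C i) (ex_intro2 _ _ i Logic.I (@subset_refl _ _)); exists y.
Qed.

(* Quasi-components of a compact Hausdorff space are connected. *)
Lemma profinite_zero_dimensional (X : topologicalType) :
  profinite_space X -> zero_dimensional X.
Proof.
move=> [cX hX tX] x y /eqP xy.
apply: contrapT => /forallNP noU; apply: xy.
pose Q := \bigcap_(D in [set D : set X | clopen D /\ D x]) D.
have Qx : Q x by move=> D [].
have Qy : Q y.
  by move=> D [cD Dx]; apply: contrapT => Dy; apply: (noU D); split.
have cQ : closed Q by apply: closed_bigI => D [[]].
(* Disjoint closed pieces A and B of Q have disjoint open neighbourhoods U and W. By compactness
   some clopen D containing x lies in their union; then D meets U in a clopen set, which therefore
   contains Q and misses B. *)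
have sep (A B : set X) : closed A -> closed B -> A `&` B = set0 ->
    Q = A `|` B -> A x -> B = set0.
  move=> cA cB AB0 QAB Ax.
  have nX : normal_space X := compact_normal hX cX.
  have nAB : set_nbhs A (~` B).
    apply/set_nbhsP; exists (~` B); split=> //; first exact: closed_openC.
    by move=> a Aa Ba; have : (A `&` B) a by []; rewrite AB0.
  have [V nV cVB] := nX A cA _ nAB.
  have [U [oU AU UV]] := iffLR (set_nbhsP _ _) nV.
  pose W := ~` closure V.
  have oW : open W by rewrite /W openC; exact: closed_closure.
  have BW : B `<=` W by move=> b Bb /cVB.
  have UW0 z : U z -> ~ W z by move=> /UV Vz; apply; exact: subset_closure.
  have [D [cD Dx DUW]] : exists D, [/\ clopen D, D x & D `<=` U `|` W].
    apply: contrapT => noD.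
    pose C (D : {D : set X | clopen D /\ D x}) := sval D `\` (U `|` W).
    have [|||z hz] := @compact_directed X _ C (exist _ setT (conj clopenT Logic.I)) cX.
    - move=> [D [[oD cD] Dx]]; apply: closedI => //=.
      by apply: open_closedC; exact: openU.
    - move=> [D [cD Dx]]; apply/set0P/negP => /eqP D0; apply: noD; exists D; split=> //.
      by apply/subsets_disjoint; rewrite -setDE.
    - move=> [D [cD Dx]] [E [cE Ex]].
      have hDE : clopen (D `&` E) /\ (D `&` E) x by split; [exact: clopenI|].
      by exists (exist _ (D `&` E) hDE) => z /= [[Dz Ez] nz].
    have [_ nUW] : C (exist _ setT (conj clopenT Logic.I)) z by exact: hz.
    apply: nUW; suff : Q z by rewrite QAB => -[/AU|/BW]; [left|right].
    by move=> D hD; have [] := hz (exist _ D hD).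
  have QD : Q `<=` D `&` U.
    move=> z; apply; split; last by split=> //; exact: AU.
    split; first by case: cD => oD _; exact: openI.
    have -> : D `&` U = D `\` W.
      apply/seteqP; split=> t [Dt]; first by move=> /UW0.
      by move=> nW; split=> //; have [|/nW] := DUW t Dt.
    by case: cD => _ cD; rewrite setDE; apply: closedI => //; exact: open_closedC.
  apply/seteqP; split=> // b Bb.
  have /QD [_ Ub] : Q b by rewrite QAB; right.
  by apply: (UW0 b Ub); exact: BW.
have QC : connected Q.
  move=> B [b Bb] [O oO BO] [C cC BC].
  have cB : closed B by rewrite BC; exact: closedI.
  have cB' : closed (Q `\` B).
    have -> : Q `\` B = Q `&` ~` O.
      apply/seteqP; split=> t [Qt nt]; split=> //; first by move=> Ot; apply: nt; rewrite BO.
      by rewrite BO => -[_ /nt].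
    by apply: closedI => //; exact: open_closedC.
  have BQ : B `<=` Q by rewrite BO => t [].
  have QU : Q = B `|` (Q `\` B).
    apply/seteqP; split=> [t Qt|t [/BQ//|[]//]].
    by have [Bt|nBt] := pselect (B t); [left|right].
  have [Bx|nBx] := pselect (B x).
    have := sep B (Q `\` B) cB cB' _ QU Bx.
    rewrite setDIK => /(_ erefl) h; by rewrite QU h setU0.
  have : B = set0.
    apply: (sep (Q `\` B)) => //; first by rewrite setIC setDIK.
    by rewrite setUC.
  by move=> B0; rewrite B0 in Bb.
suff : connected_component [set: X] x y by rewrite (tX x) // => ->.
by exists Q.
Qed.

Section TopGroupTheory.
Variable G : topGroupType.
Implicit Types (U W : set G).

Lemma mulg_cts (X : topologicalType) (f g : X -> G) :
  continuous f -> continuous g -> continuous (fun x => f x * g x).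
Proof.
move=> cf cg x; apply: (@continuous_comp _ _ _ (fun x => (f x, g x))
  (fun xy => xy.1 * xy.2)); last exact: mulg_continuous.
by exact: (cvg_pair (cf x) (cg x)).
Qed.

Lemma invg_cts (X : topologicalType) (f : X -> G) :
  continuous f -> continuous (fun x => (f x)^-1).
Proof.
move=> cf x; apply: (@continuous_comp _ _ _ f (fun y => y^-1)); first exact: cf.
exact: invg_continuous.
Qed.

Lemma mull_cts (g : G) : continuous (fun x => g * x).
Proof. by apply: mulg_cts => x; [exact: cvg_cst|exact: cvg_id]. Qed.

Lemma mulr_cts (g : G) : continuous (fun x => x * g).
Proof. by apply: mulg_cts => x; [exact: cvg_id|exact: cvg_cst]. Qed.

Definition onormal W := is_normal_subgroup W /\ open W.

Lemma nsub1 W : is_normal_subgroup W -> W 1. Proof. by case=> -[]. Qed.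
Lemma nsubM W x y : is_normal_subgroup W -> W x -> W y -> W (x * y).
Proof. by case=> -[_ h _] _; exact: h. Qed.
Lemma nsubV W x : is_normal_subgroup W -> W x -> W x^-1.
Proof. by case=> -[_ _ h] _; exact: h. Qed.
Lemma nsubJ W g x : is_normal_subgroup W -> W x -> W (g * x * g^-1).
Proof. by case=> _; exact. Qed.

Lemma subgroup_nbhs_open W : is_subgroup W -> nbhs (1 : G) W -> open W.
Proof.
move=> [_ hM _] n1; rewrite openE => x Wx; rewrite /interior.
have : nbhs x [set y | W (x^-1 * y)].
  by apply: (@mull_cts x^-1 x); rewrite mulVg.
by apply: filterS => y /= /(hM _ _ Wx); rewrite mulKVg.
Qed.

Lemma open_subgroup_closed W : is_subgroup W -> open W -> closed W.
Proof.
move=> [W1 hM hV] oW; rewrite -(setCK W); apply: open_closedC.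
rewrite openE => x nWx; rewrite /interior.
have : nbhs x [set y | W (x^-1 * y)].
  by apply: (@mull_cts x^-1 x); rewrite mulVg; exact: open_nbhs_nbhs.
apply: filterS => y /= h Wy; apply: nWx.
by move: (hM _ _ Wy (hV _ h)); rewrite invgM invgK mulKVg.
Qed.

Lemma onormal_closed W : onormal W -> closed W.
Proof. by case=> -[? _] ?; exact: open_subgroup_closed. Qed.

Lemma onormal_nbhs W : onormal W -> nbhs (1 : G) W.
Proof. by move=> [nW oW]; apply: open_nbhs_nbhs; split=> //; exact: nsub1. Qed.

Lemma onormal_nbhsx W x : onormal W -> nbhs x [set y | W (x^-1 * y)].
Proof. by move=> oW; apply: (@mull_cts x^-1 x); rewrite mulVg; exact: onormal_nbhs. Qed.

Lemma onormalI W W' : onormal W -> onormal W' -> onormal (W `&` W').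
Proof.
move=> [nW oW] [nW' oW']; split; last exact: openI.
split; first split.
- by split; exact: nsub1.
- by move=> x y [? ?] [? ?]; split; exact: nsubM.
- by move=> x [? ?]; split; exact: nsubV.
- by move=> g x [? ?]; split; exact: nsubJ.
Qed.

Lemma onormalT : onormal [set: G].
Proof. by split; [|exact: openT]. Qed.

(** The witness consists of the g such that all conjugates of g and of g^-1 translate a clopen
    neighbourhood D of 1 into itself. As a stabilizer it is a subgroup, it is visibly normal, and
    compactness of G times D makes it a neighbourhood of 1. *)
Lemma onormal_exists U : profinite_space G -> nbhs (1 : G) U ->
  exists W, onormal W /\ W `<=` U.
Proof.
move=> pG nU; have zG := profinite_zero_dimensional pG; case: pG => cG hG _.
have [D [D1 [oD cD]] DU] := zero_dimensional_cvg hG zG cG nU.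
pose P (g : G) (z : G * G) :=
  D (z.2 * (z.1 * g * z.1^-1)) /\ D (z.2 * (z.1 * g^-1 * z.1^-1)).
pose N := [set g : G | forall x k, D k -> P g (x, k)].
have nN : is_normal_subgroup N.
  split; first split.
  - by move=> x k Dk; rewrite /P /= invg1 mulg1 mulgV mulg1.
  - move=> g h hg hh x k Dk; split => /=.
      have [/= /(hh x _) [/= + _] _] := hg x k Dk.
      by rewrite !mulgA mulgKV.
    have [/= _ /(hg x _) [/= _ +]] := hh x k Dk.
    by rewrite invgM !mulgA mulgKV.
  - by move=> g hg x k Dk; have [/= a b] := hg x k Dk; split; rewrite /= ?invgK.
  - move=> y g hg x k Dk; have [/= a b] := hg (x * y) k Dk; split => /=.
      by move: a; rewrite !invgM !mulgA.
    by move: b; rewrite !invgM invgK !mulgA.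
exists N; split; last first.
  move=> g /(_ 1 1 D1) [/= + _]; rewrite mul1g invg1 mulg1 mul1g; exact: DU.
split=> //; apply: subgroup_nbhs_open; first by case: nN.
have cK : compact ([set: G] `*` D).
  apply: compact_setX => //; exact: (subclosed_compact cD cG).
have := iffLR (compact_near_coveringP _) cK G (nbhs (1 : G)) P (nbhs_filter _).
have hP (z : G * G) : ([set: G] `*` D) z ->
    \forall x' \near z & i \near (1 : G), P i x'.
  move=> [_ /= Dz].
  have cP (e : G -> G) : continuous e -> e 1 = 1 ->
      \forall x' \near z & i \near (1 : G), D (x'.2 * (x'.1 * e i * x'.1^-1)).
    move=> ce e1.
    pose m (zi : (G * G) * G) := zi.1.2 * (zi.1.1 * e zi.2 * zi.1.1^-1).
    have cm : continuous m.
      have c1 : continuous (fun zi : (G * G) * G => zi.1.1).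
        move=> w; apply: (@continuous_comp _ _ _ fst fst); exact: cvg_fst.
      have c2 : continuous (fun zi : (G * G) * G => zi.1.2).
        by move=> w; apply: (@continuous_comp _ _ _ fst snd); [exact: cvg_fst|exact: cvg_snd].
      have c3 : continuous (fun zi : (G * G) * G => e zi.2).
        by move=> w; apply: (@continuous_comp _ _ _ snd e); [exact: cvg_snd|exact: ce].
      by apply: mulg_cts => //; apply: mulg_cts; [exact: mulg_cts|exact: invg_cts].
    have : nbhs (m (z, 1)) D.
      by rewrite /m /= e1 mulg1 mulgV mulg1; apply: open_nbhs_nbhs.
    by move=> /(cm (z, 1)).
  have h1 := cP id (fun _ => cvg_id) erefl.
  have h2 := cP (fun g => g^-1) (@invg_continuous G) (invg1 G).
  by move: h1 h2; apply: filterS2 => -[x' i].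
move=> /(_ hP); apply: filterS => g hg x k Dk.
by apply: hg.
Qed.

Lemma onormal_separates x : profinite_space G -> (forall W, onormal W -> W x) -> x = 1.
Proof.
move=> pG h; have [_ hG _] := pG; apply: hG => A B nA nB.
have [W [oW WB]] := onormal_exists pG nB.
exists x; split; first exact: nbhs_singleton.
by apply: WB; exact: h.
Qed.

Lemma nsub_sym W x y : is_normal_subgroup W -> W (x^-1 * y) -> W (y^-1 * x).
Proof. by move=> nW /(nsubV nW); rewrite invgM invgK. Qed.

Lemma nsub_trans W x y z : is_normal_subgroup W ->
  W (x^-1 * y) -> W (y^-1 * z) -> W (x^-1 * z).
Proof. by move=> nW h1 /(nsubM nW h1); rewrite -mulgA mulKVg. Qed.

Lemma nsub_mul W x x' y y' : is_normal_subgroup W ->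
  W (x^-1 * x') -> W (y^-1 * y') -> W ((x * y)^-1 * (x' * y')).
Proof.
move=> nW h1 h2; have := nsubM nW (nsubJ y^-1 nW h1) h2.
by rewrite invgM invgK !mulgA mulgK.
Qed.

Lemma nsub_inv W x x' : is_normal_subgroup W ->
  W (x^-1 * x') -> W (x^-1^-1 * x'^-1).
Proof.
by move=> nW /(nsubV nW) /(nsubJ x nW); rewrite invgM invgK -!mulgA mulgV mulg1.
Qed.

Lemma left_cosetE W x y : is_normal_subgroup W ->
  [set x * a | a in W] = [set y * a | a in W] <-> W (x^-1 * y).
Proof.
move=> nW; split=> [h|h].
  have [a Wa ya] : [set x * a | a in W] y.
    by rewrite h; exists 1; rewrite ?mulg1 //; exact: nsub1.
  by rewrite -ya mulKg.
apply/seteqP; split=> _ [a Wa <-].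
  exists (y^-1 * x * a); last by rewrite -mulgA mulKVg.
  by apply: nsubM => //; exact: nsub_sym.
by exists (x^-1 * y * a); [exact: nsubM|rewrite -mulgA mulKVg].
Qed.

Lemma finite_left_cosets W : compact [set: G] -> onormal W -> finite_set (left_cosets W).
Proof.
move=> cG oW; have [nW _] := oW.
have [X Xf] : exists s : seq G, forall x, exists2 y, y \in s & W (y^-1 * x).
  (* The complements of finite unions of cosets. Were they all nonempty, a cluster point of this
     filter would lie outside its own coset. *)
  pose F := filter_from [set: seq G] (fun s => [set x | forall y, y \in s -> ~ W (y^-1 * x)]).
  have FF : Filter F.
    apply: filter_from_filter; first by exists [::].
    move=> s t _ _; exists (s ++ t) => // x h.
    by split=> y ys; apply: h; rewrite mem_cat ys ?orbT.
  apply: contrapT => nos.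
  have PF : ProperFilter F.
    apply: filter_from_proper => // s _; apply: contrapT => h0; apply: nos.
    exists s => x; apply: contrapT => hx; apply: h0; exists x => y ys Wyx; apply: hx.
    by exists y.
  have [//|x [_ hx]] := cG _ PF; first exact: filterT.
  have Fx : F [set z | ~ W (x^-1 * z)].
    by exists [:: x] => // z; apply; rewrite inE.
  by have [z [/= nz Wz]] := hx _ _ Fx (onormal_nbhsx x oW).
apply: (@sub_finite_set _ _ [set [set x * a | a in W] | x in [set` X]]).
  move=> _ [x _ <-]; have [y yX Wyx] := Xf x.
  by exists y => //; exact/(left_cosetE _ _ nW).
exact: finite_image.
Qed.

End TopGroupTheory.

(* Finite groups on ordinals form a small type; this is what allows
   products over all finite quotients. *)
Record ftable := FTable {
  ft_n : nat;
  ft_one : 'I_ft_n.+1;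
  ft_inv : 'I_ft_n.+1 -> 'I_ft_n.+1;
  ft_mul : 'I_ft_n.+1 -> 'I_ft_n.+1 -> 'I_ft_n.+1;
  ft_mulA : associative ft_mul;
  ft_mul1 : left_id ft_one ft_mul;
  ft_1mul : right_id ft_one ft_mul;
  ft_mulV : left_inverse ft_one ft_inv ft_mul;
  ft_Vmul : right_inverse ft_one ft_inv ft_mul
}.

Definition fcar (t : ftable) : Type := 'I_(ft_n t).+1.
HB.instance Definition _ t := Finite.on (fcar t).
HB.instance Definition _ t := isGroup.Build (fcar t)
  (@ft_mulA t) (@ft_mul1 t) (@ft_1mul t) (@ft_mulV t) (@ft_Vmul t).

Section FiniteQuotients.
Variable G : topGroupType.
Implicit Types (U W : set G).

Lemma finite_quotient W : is_normal_subgroup W -> finite_set (left_cosets W) ->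
  exists (t : ftable) (q : G -> fcar t),
    [/\ {morph q : x y / x * y}, forall y, exists x, q x = y,
        (forall x y, q x = q y <-> W (x^-1 * y)) &
        (left_cosets W #= `I_#|{: fcar t}|)%card].
Proof.
move=> nW /finite_setP [n hn].
have /card_set_bijP [f [fI finj fsurj]] := hn.
pose cl x : set G := [set x * a | a in W].
have Wcl x : left_cosets W (cl x) by exists x.
case: n hn fI finj fsurj => [|n] hn fI finj fsurj; first by have := fI _ (Wcl 1).
pose q0 x : 'I_n.+1 := inord (f (cl x)).
have fq x : q0 x = f (cl x) :> nat by rewrite inordK //; exact: fI.
have q0P x y : q0 x = q0 y <-> W (x^-1 * y).
  split=> h; last by apply: ord_inj; rewrite !fq; congr f; exact/left_cosetE.
  apply/left_cosetE => //; apply: finj; first exact/mem_set/Wcl.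
    exact/mem_set/Wcl.
  by have := congr1 (@nat_of_ord _) h; rewrite !fq.
have q0S y : {x | q0 x = y}.
  apply: cid; have [|C [x _ <-] hx] := fsurj (val y); first exact: ltn_ord.
  by exists x; apply: ord_inj; rewrite fq.
pose r y := sval (q0S y).
have rK y : q0 (r y) = y := svalP (q0S y).
have Wr x : W ((r (q0 x))^-1 * x) by apply/q0P.
have mA : associative (fun a b => q0 (r a * r b)).
  move=> a b c; apply/q0P; apply: (@nsub_trans _ _ _ (r a * (r b * r c))) => //.
    by apply: nsub_mul => //; rewrite mulVg; exact: nsub1.
  rewrite [X in X^-1]mulgA; apply: nsub_mul => //; last by rewrite mulVg; exact: nsub1.
  exact: nsub_sym.
have t1 : left_id (q0 1) (fun a b => q0 (r a * r b)).
  move=> a; rewrite -[RHS]rK; apply/q0P; apply: nsub_sym => //.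
  rewrite -[X in X^-1 * _]mul1g; apply: nsub_mul; rewrite ?mulVg //; last exact: nsub1.
  exact: nsub_sym.
have t2 : right_id (q0 1) (fun a b => q0 (r a * r b)).
  move=> a; rewrite -[RHS]rK; apply/q0P; apply: nsub_sym => //.
  rewrite -[X in X^-1 * _]mulg1; apply: nsub_mul; rewrite ?mulVg //; first exact: nsub1.
  exact: nsub_sym.
have t3 : left_inverse (q0 1) (fun a => q0 (r a)^-1) (fun a b => q0 (r a * r b)).
  move=> a; apply/q0P; rewrite -[X in _ * X](mulVg (r a)).
  by apply: nsub_mul; rewrite ?mulVg //; exact: nsub1.
have t4 : right_inverse (q0 1) (fun a => q0 (r a)^-1) (fun a b => q0 (r a * r b)).
  move=> a; apply/q0P; rewrite -[X in _ * X](mulgV (r a)).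
  by apply: nsub_mul; rewrite ?mulVg //; exact: nsub1.
exists (FTable mA t1 t2 t3 t4), q0; split=> //.
- by move=> x y; apply/q0P; apply: nsub_sym => //; exact: nsub_mul.
- by move=> y; exists (r y).
- by rewrite card_ord.
Qed.

(** As U contains the kernel of q, its cosets correspond to those of the image of U in the image of
    G, a subgroup of Q. *)
Lemma index_p_power (p : nat) (Q : finGroupType) (q : G -> Q) U :
  is_subgroup U -> {morph q : x y / x * y} -> p.-group [set: Q]%SET ->
  (forall x, q x = 1 -> U x) ->
  exists n, (left_cosets U #= `I_(p ^ n))%card.
Proof.
move=> [U1 UM UV] qM pQ qU.
have q1 : q 1 = 1 by apply: (mulgI (q 1)); rewrite -qM !mulg1.
have qV x : q x^-1 = (q x)^-1.
  by apply: (mulgI (q x)); rewrite -qM !mulgV q1.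
pose im (A : set G) : {set Q} := [set y | `[< exists2 x, A x & q x = y >]]%SET.
have imP A y : reflect (exists2 x, A x & q x = y) (y \in im A).
  by rewrite inE; exact: asboolP.
have gim A : is_subgroup A -> group_set (im A).
  move=> [A1 AM AV]; apply/group_setP; split; first by apply/imP; exists 1.
  move=> _ _ /imP [x Ax <-] /imP [y Ay <-]; apply/imP; exists (x * y) => //.
  exact: AM.
pose QG : {group Q} := Group (gim [set: G] (And3 Logic.I (fun _ _ _ _ => Logic.I) (fun _ _ => Logic.I))).
pose QU : {group Q} := Group (gim U (And3 U1 UM UV)).
have sUG : QU \subset QG.
  by apply/fintype.subsetP => y /imP [x _ xy]; apply/imP; exists x.
have qUE x : q x \in QU -> U x.
  move=> /imP [u Uu qu]; have : U (u^-1 * x) by apply: qU; rewrite qM qV qu mulVg.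
  by move=> /(UM _ _ Uu); rewrite mulKVg.
have cosE x : im [set x * a | a in U] = (q x *: QU)%g.
  apply/setP => y; rewrite mem_lcoset; apply/imP/idP.
    by move=> [_ [a Ua <-] <-]; rewrite qM mulKg; apply/imP; exists a.
  move=> /imP [u Uu hu]; exists (x * u); first by exists u.
  by rewrite qM hu mulKVg.
pose s := enum (lcosets QU QG).
pose f (C : set G) := index (im C) s.
have fs C : left_cosets U C -> im C \in s.
  move=> [x _ <-]; rewrite mem_enum cosE; apply/lcosetsP; exists (q x) => //.
  by apply/imP; exists x.
have [n hn] : exists n, size s = (p ^ n)%N.
  suff /p_natP [n hn] : p.-nat (size s) by exists n.
  rewrite -cardE card_lcosets; apply: (pnat_dvd (dvdn_indexg _ _)); rewrite /QG /=.
  by rewrite -[p.-nat _]/(p.-group QG); apply: pgroupS pQ; exact: finset.subsetT.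
exists n; apply/card_set_bijP; exists f; split.
- by move=> C hC; rewrite /= /f -hn index_mem; exact: fs.
- move=> C D /set_mem hC /set_mem hD h.
  have : im C = im D.
    by rewrite -(nth_index finset.set0 (fs _ hC)) -(nth_index finset.set0 (fs _ hD)) -/(f C) h.
  case: hC hD {h} => x _ <- [y _ <-]; rewrite !cosE => h.
  have hxy : U (x^-1 * y).
    by apply: qUE; rewrite qM qV -mem_lcoset h lcoset_refl.
  apply/seteqP; split=> _ [a Ua <-].
    exists (y^-1 * x * a); last by rewrite -mulgA mulKVg.
    by apply: (UM) => //; move: (UV _ hxy); rewrite invgM invgK.
  by exists (x^-1 * y * a); [exact: (UM)|rewrite -mulgA mulKVg].
- move=> k /=; rewrite -hn => ks.
  have := mem_nth finset.set0 ks; rewrite mem_enum => /lcosetsP [_ /imP [x _ <-] hx].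
  exists [set x * a | a in U]; first by exists x.
  by rewrite /f cosE -hx index_uniq // enum_uniq.
Qed.

End FiniteQuotients.

Lemma morph1_grp (G Q : groupType) (q : G -> Q) : {morph q : x y / x * y} -> q 1 = 1.
Proof. by move=> qM; apply: (mulgI (q 1)); rewrite -qM !mulg1. Qed.

Lemma morphV_grp (G Q : groupType) (q : G -> Q) : {morph q : x y / x * y} ->
  {morph q : x / x^-1}.
Proof. by move=> qM x; apply: (mulgI (q x)); rewrite -qM !mulgV morph1_grp. Qed.

Definition dgrp (Q : finGroupType) : Type := discrete_topology Q.
HB.instance Definition _ Q := DiscreteTopology.on (dgrp Q).
HB.instance Definition _ (Q : finGroupType) := Group.copy (dgrp Q) Q.

Section DiscreteGroup.
Variable Q : finGroupType.

Lemma discrete_mulg_cts : continuous (fun xy : dgrp Q * dgrp Q => xy.1 * xy.2).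
Proof.
move=> [x y] B nB; exists ([set x], [set y]); first by split; exact: discrete_set1.
by move=> [_ _] [/= -> ->]; exact: nbhs_singleton nB.
Qed.

Lemma discrete_invg_cts : continuous (fun x : dgrp Q => x^-1).
Proof.
move=> x B nB; apply: (@filterS _ (nbhs x) _ [set x] ((fun y => y^-1) @^-1` B)).
  by move=> _ ->; exact: nbhs_singleton nB.
exact: discrete_set1.
Qed.

HB.instance Definition _ :=
  Group_isTopGroup.Build (dgrp Q) discrete_mulg_cts discrete_invg_cts.

Lemma dgrp_profinite : profinite_space (dgrp Q).
Proof.
split; first by apply: finite_compact; exact: finite_finset.
  exact: discrete_hausdorff.
exact/zero_dimension_totally_disconnected/discrete_zero_dimension.
Qed.

Lemma dgrp_pro_p (p : nat) : p.-group [set: Q]%SET -> pro_p_group p (dgrp Q).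
Proof.
move=> pQ; split; first exact: dgrp_profinite.
move=> U [sU _] oU; apply: (@index_p_power (dgrp Q) p Q id) => // x ->.
by case: sU.
Qed.

End DiscreteGroup.

Section LocallyConstant.
Variable G : topGroupType.
Implicit Types (W : set G).

(** A uniform form of local constancy: g factors through a finite quotient. On a profinite group it
    amounts to continuity into a discrete space, by [cts_lc] and [lc_continuous]. *)
Definition lc (T : Type) (g : G -> T) :=
  exists W, onormal W /\ forall x w, W w -> g (x * w) = g x.

Lemma lc_cst T (t : T) : lc (fun=> t).
Proof. by exists setT; split=> //; exact: onormalT. Qed.

Lemma lc_comp T T' (f : T -> T') (g : G -> T) : lc g -> lc (f \o g).
Proof. by move=> [W [oW h]]; exists W; split=> // x w Ww; rewrite /= h. Qed.

Lemma lc_pair T T' (f : G -> T) (g : G -> T') : lc f -> lc g -> lc (fun x => (f x, g x)).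
Proof.
move=> [W [oW h]] [W' [oW' h']]; exists (W `&` W'); split; first exact: onormalI.
by move=> x w [Ww Ww']; rewrite h ?h'.
Qed.

Lemma lc_op T T' T'' (op : T -> T' -> T'') (f : G -> T) (g : G -> T') :
  lc f -> lc g -> lc (fun x => op (f x) (g x)).
Proof. by move=> lf lg; exact: (lc_comp (fun z => op z.1 z.2) (lc_pair lf lg)). Qed.

Lemma lc_family (I : eqType) T (s : seq I) (g : I -> G -> T) :
  (forall i, i \in s -> lc (g i)) ->
  exists W, onormal W /\ forall i, i \in s -> forall x w, W w -> g i (x * w) = g i x.
Proof.
elim: s => [|i s IHs] h; first by exists setT; split=> //; exact: onormalT.
have [|W [oW hW]] := IHs; first by move=> j js; apply: h; rewrite inE js orbT.
have [|W' [oW' hW']] := h i; first by rewrite inE eqxx.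
exists (W `&` W'); split; first exact: onormalI.
move=> j; rewrite inE => /orP [/eqP->|js] x w [Ww Ww']; first exact: hW'.
exact: hW.
Qed.

Lemma lc_sum (I : eqType) (V : nmodType) (s : seq I) (g : I -> G -> V) :
  (forall i, i \in s -> lc (g i)) -> lc (fun x => \sum_(i <- s) g i x)%R.
Proof.
move=> /lc_family [W [oW h]]; exists W; split=> // x w Ww.
by apply: eq_big_seq => i /h; exact.
Qed.

Lemma lc_translate T (g : G -> T) h : lc g -> lc (fun x => g (x * h)).
Proof.
move=> [W [oW gW]]; exists W; split=> // x w Ww.
have -> : x * w * h = x * h * (h^-1 * w * h^-1^-1) by rewrite invgK !mulgA mulgK.
by apply: gW; apply: nsubJ => //; case: oW.
Qed.

Lemma cts_lc (T : choiceType) (g : G -> T) : profinite_space G ->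
  continuous (g : G -> discrete_topology T) -> lc g.
Proof.
move=> pG cg; have [cG _ _] := pG.
pose P (w x : G) := g (x * w) = g x.
have := iffLR (compact_near_coveringP _) cG G (nbhs (1 : G)) P (nbhs_filter _).
have hP (x : G) : [set: G] x -> \forall x' \near x & i \near (1 : G), P i x'.
  move=> _; have n1 : nbhs x [set y | g y = g x].
    by apply: (cg x [set g x]); exact: discrete_set1.
  have h1 : nbhs (x, 1 : G) ((fun z : G * G => z.1 * z.2) @^-1` [set y | g y = g x]).
    have n2 : nbhs (x * 1) [set y | g y = g x] by rewrite mulg1.
    exact: (@mulg_continuous G (x, 1) _ n2).
  move: h1; have : nbhs (x, 1 : G) [set z : G * G | g z.1 = g x].
    exists ([set y | g y = g x], setT); last by move=> [? ?] [].
    by split=> //; exact: filterT.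
  by apply: filterS2 => -[a b] /= h1 h2; rewrite /P h2 h1.
move=> /(_ hP) n1; have [W [oW WN]] := onormal_exists pG n1.
by exists W; split=> // x w /WN; exact.
Qed.

Lemma lc_continuous (T : choiceType) (g : G -> T) :
  lc g -> continuous (g : G -> discrete_topology T).
Proof.
move=> [W [oW h]] x B nB; have := onormal_nbhsx x oW.
apply: filterS => y /= hy; rewrite -(mulKVg x y) h //.
exact: nbhs_singleton nB.
Qed.

Lemma lc_preimage_closed T (g : G -> T) (B : set T) : lc g -> closed (g @^-1` B).
Proof.
move=> [W [oW h]]; rewrite -(setCK (g @^-1` B)); apply: open_closedC.
rewrite openE => x nx; rewrite /interior; have := onormal_nbhsx x oW.
by apply: filterS => y /= hy By; apply: nx; rewrite /= -(h x _ hy) mulKVg.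
Qed.

Lemma lc_preimage_open T (g : G -> T) (B : set T) : lc g -> open (g @^-1` B).
Proof.
move=> lg; rewrite -(setCK (g @^-1` B)); apply: closed_openC.
exact: (@lc_preimage_closed _ _ (~` B) lg).
Qed.

Lemma lc_precomp (G' : topGroupType) T (a : G' -> G) (g : G -> T) :
  {morph a : x y / x * y} -> continuous a -> lc g -> exists W : set G',
  onormal W /\ forall x w, W w -> g (a (x * w)) = g (a x).
Proof.
move=> aM ca [W [oW h]]; exists (a @^-1` W).
have a1 : a 1 = 1 by apply: (mulgI (a 1)); rewrite -aM !mulg1.
have aV x : a x^-1 = (a x)^-1 by apply: (mulgI (a x)); rewrite -aM !mulgV a1.
have nW := oW.1.
split; last by move=> x w Ww; rewrite aM h.
split; last by apply: open_comp => //; case: oW.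
split; first split => /=.
- by rewrite a1; exact: nsub1.
- by move=> x y Wx Wy /=; rewrite aM; exact: nsubM.
- by move=> x Wx /=; rewrite aV; exact: nsubV.
- by move=> x y Wy /=; rewrite !aM aV; exact: nsubJ.
Qed.

Lemma lc_hom_kernel (Q : groupType) (q : G -> Q) :
  {morph q : x y / x * y} -> lc q -> onormal [set x | q x = 1].
Proof.
move=> qM lq; have q1 := morph1_grp qM; split; last exact: (@lc_preimage_open _ _ [set 1] lq).
split; first split => //=.
- by move=> x y /= hx hy; rewrite qM hx hy mulg1.
- by move=> x /= hx; rewrite morphV_grp // hx invg1.
- by move=> x y /= hy; rewrite !qM hy morphV_grp // mulg1 mulgV.
Qed.

Lemma lc_of_quotient (Q : groupType) (q : G -> Q) W :
  onormal W -> (forall x y, q x = q y <-> W (x^-1 * y)) -> lc q.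
Proof. by move=> oW qP; exists W; split=> // x w Ww; apply/esym/qP; rewrite mulKg. Qed.

Lemma pro_p_quotient (p : nat) W : prime p -> pro_p_group p G -> onormal W ->
  exists (t : ftable) (q : G -> fcar t),
    [/\ {morph q : x y / x * y}, (forall y, exists x, q x = y),
        (forall x y, q x = q y <-> W (x^-1 * y)) & p.-group [set: fcar t]%SET].
Proof.
move=> pp [[cG _ _] pG] oW; have [n hn] := pG W oW.1 oW.2.
have [t [q [qM qS qP ht]]] := finite_quotient oW.1 (finite_left_cosets cG oW).
exists t, q; split=> //; rewrite /pgroup cardsT.
have : (`I_(p ^ n) #= `I_#|{: fcar t}|)%card.
  by apply: card_eq_trans ht; rewrite card_eq_sym.
by move=> /card_eq_II <-; rewrite pnatX pnat_id.
Qed.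

End LocallyConstant.

(** The universal property is applied to a set-theoretic section of f that sends 1 to 1; its
    uniqueness part shows that the resulting map lifts q. Freeness of F enters the sequel only in
    this form. *)
Lemma free_lift (p : nat) (F : topGroupType) (E Q : finGroupType) (f : E -> Q) (q : F -> Q) :
  free_pro_p_group p F -> {morph f : x y / x * y} -> (forall y, exists x, f x = y) ->
  p.-group [set: E]%SET -> p.-group [set: Q]%SET ->
  {morph q : x y / x * y} -> lc q ->
  exists e : F -> E, [/\ {morph e : x y / x * y}, lc e & forall x, f (e x) = q x].
Proof.
move=> [X [pt [iota [_ [ppF ci i1 univ]]]]] fM fS pE pQ qM lq.
have [sg [sgK sg1]] : exists sg : Q -> E, (forall y, f (sg y) = y) /\ sg 1 = 1.
  have /choice [s sK] := fS.
  exists (fun y => if y == 1 then 1 else s y); rewrite eqxx; split=> // y.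
  by case: eqP => // ->; exact: morph1_grp fM.
have lsq : lc (sg \o q) by exact: lc_comp.
have [|||e [[[eM ce] he] _]] := univ (dgrp E) (fun x => sg (q (iota x))).
- exact: dgrp_pro_p.
- move=> x; apply: (@continuous_comp _ _ _ iota (sg \o q : F -> dgrp E)); first exact: ci.
  exact: (lc_continuous lsq).
- by rewrite i1 morph1_grp.
have le : lc e by apply: cts_lc => //; case: ppF.
exists e; split=> //.
have [||| g [_ gU]] := univ (dgrp Q) (fun x => q (iota x)).
- exact: dgrp_pro_p.
- move=> x; apply: (@continuous_comp _ _ _ iota (q : F -> dgrp Q)); first exact: ci.
  exact: (lc_continuous lq).
- by rewrite i1 morph1_grp.
have h1 : g = q by apply: gU; split=> //; split=> //; exact: lc_continuous.
have h2 : g = f \o e.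
  apply: gU; split; last by move=> x /=; rewrite he sgK.
  split; first by move=> x y; rewrite /= eM fM.
  exact: (lc_continuous (lc_comp f le)).
by move=> x; rewrite -[f _]/((f \o e) x) -h2 h1.
Qed.

(** * Finite p-groups acting on modules *)

Local Close Scope group_scope.
Local Open Scope ring_scope.

Section Orbits.
Variables (Ga : finGroupType) (T : eqType) (act : Ga -> T -> T).
Hypothesis act1 : forall x, act 1%g x = x.
Hypothesis actM : forall g h x, act (g * h)%g x = act g (act h x).
Implicit Types (A : {group Ga}) (x y : T).

Definition orb (A : {set Ga}) x : seq T := undup [seq act a x | a <- enum A].
Definition stab (A : {set Ga}) x : {set Ga} := [set a in A | act a x == x].

Lemma orbP A x y : reflect (exists2 a, a \in A & y = act a x) (y \in orb A x).
Proof.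
rewrite mem_undup; apply: (iffP mapP) => -[a aA ->]; exists a => //.
  by rewrite mem_enum in aA.
by rewrite mem_enum.
Qed.

Lemma orb_uniq A x : uniq (orb A x). Proof. exact: undup_uniq. Qed.

Lemma orb_refl A x : x \in orb A x.
Proof. by apply/orbP; exists 1%g; rewrite ?group1. Qed.

Lemma gactVK g x : act g^-1%g (act g x) = x.
Proof. by rewrite -actM mulVg act1. Qed.

Lemma gactKV g x : act g (act g^-1%g x) = x.
Proof. by rewrite -actM mulgV act1. Qed.

Lemma gact_inj g : injective (act g).
Proof. by move=> x y h; rewrite -(gactVK g x) h gactVK. Qed.

Lemma orb_sym A x y : y \in orb A x -> x \in orb A y.
Proof.
by move=> /orbP [a aA ->]; apply/orbP; exists a^-1%g; rewrite ?groupV ?gactVK.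
Qed.

Lemma orb_trans A x y z : y \in orb A x -> z \in orb A y -> z \in orb A x.
Proof.
move=> /orbP [a aA ->] /orbP [b bA ->]; apply/orbP; exists (b * a)%g.
  by rewrite groupM.
by rewrite actM.
Qed.

Lemma stab_group_set A x : group_set (stab A x).
Proof.
apply/group_setP; split; first by rewrite inE group1 act1 eqxx.
move=> a b; rewrite !inE => /andP [aA /eqP ha] /andP [bA /eqP hb].
by rewrite groupM // actM hb ha eqxx.
Qed.

Canonical stab_group A x := Group (stab_group_set A x).

Lemma sum_orb (V : nmodType) A x (F : T -> V) :
  \sum_(a in A) F (act a x) = (\sum_(y <- orb A x) F y) *+ #|stab A x|.
Proof.
transitivity (\sum_(a in A) \sum_(y <- orb A x | act a x == y) F y).
  apply: eq_bigr => a aA; rewrite (eq_bigl (fun y => y == act a x)); last first.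
    by move=> y; rewrite eq_sym.
  rewrite -big_filter filter_pred1_uniq ?orb_uniq //; first by rewrite big_seq1.
  by apply/orbP; exists a.
rewrite (exchange_big_dep xpredT) //= -sumrMnl big_seq [RHS]big_seq.
apply: eq_bigr => y /orbP [a aA ->].
rewrite (eq_bigl (fun b => b \in a *: stab A x)%g).
  by rewrite sumr_const card_lcoset.
move=> b; rewrite mem_lcoset inE actM groupMl ?groupV //; congr (_ && _).
by rewrite -[in RHS](inj_eq (@gact_inj a)) gactKV.
Qed.

Lemma card_orb A x : (size (orb A x) * #|stab A x| = #|A|)%N.
Proof.
have := @sum_orb nat A x (fun=> 1%N); rewrite sum1_card => ->.
by rewrite [X in (X *+ _)%R](_ : _ = size (orb A x)) ?sum1_size // -mulr_natr natn.
Qed.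

Lemma orb_p (p : nat) A x : prime p -> (p.-group A)%g ->
  ~~ [forall a in A, act a x == x] -> (p %| size (orb A x))%N.
Proof.
move=> pp pA nf; have /(pnat_dvd) : (size (orb A x) %| #|A|)%N.
  by rewrite -(card_orb A x) dvdn_mulr.
move=> /(_ _ pA) /p_natP [[|k] hk]; last by rewrite hk expnS dvdn_mulr.
case/negP: nf; apply/forall_inP => a aA; apply/eqP.
have : act a x \in orb A x by apply/orbP; exists a.
have : size (orb A x) = 1%N by rewrite hk.
have := orb_refl A x; case: (orb A x) => // b [|//]; rewrite !inE => /eqP -> _ /eqP //.
Qed.

Lemma orb_reps A (L : seq T) : uniq L ->
  (forall a x, a \in A -> x \in L -> act a x \in L) ->
  exists2 s : seq T, {subset s <= L} & perm_eq L (flatten [seq orb A x | x <- s]).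
Proof.
move: {2}(size L) (leqnn (size L)) => n.
elim: n L => [|n IHn] [|x L'] // hn uL sL; try by exists [::].
set L := x :: L' in hn uL sL *; have xL : x \in L by rewrite inE eqxx.
clearbody L.
have sO : {subset orb A x <= L} by move=> y /orbP [a aA ->]; exact: sL.
have pL : perm_eq L (orb A x ++ [seq y <- L | y \notin orb A x]).
  apply: uniq_perm => //.
    rewrite cat_uniq orb_uniq filter_uniq // andbT /=.
    by apply/hasPn => y; rewrite mem_filter => /andP [].
  move=> y; rewrite mem_cat mem_filter /=.
  by case: (boolP (y \in orb A x)) => [/sO|].
have [|||s ss ps] := IHn ([seq y <- L | y \notin orb A x]).
- have := perm_size pL; rewrite size_cat => e.
  have : (0 < size (orb A x))%N.
    by have := orb_refl A x; case: (orb A x).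
  by lia.
- exact: filter_uniq.
- move=> a y aA; rewrite !mem_filter /= => /andP [ny yL]; rewrite sL // andbT.
  apply: contra ny => h; apply: orb_trans h _.
  by apply: orb_sym; apply/orbP; exists a.
exists (x :: s); last by rewrite /=; apply: (perm_trans pL); rewrite perm_cat2l.
by move=> y; rewrite inE => /orP [/eqP->//|/ss]; rewrite mem_filter => /andP [].
Qed.

(** F is constant on orbits, and an orbit with more than one point has size divisible by p, so it
    contributes 0. *)
Lemma sum_fix (p : nat) (V : nmodType) A (L : seq T) (F : T -> V) :
  prime p -> (p.-group A)%g -> (forall v : V, v *+ p = 0) -> uniq L ->
  (forall a x, a \in A -> x \in L -> act a x \in L) ->
  (forall a x, a \in A -> x \in L -> F (act a x) = F x) ->
  \sum_(x <- L) F x = \sum_(x <- L | [forall a in A, act a x == x]) F x.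
Proof.
move=> pp pA pV uL sL FL; have [s ss ps] := orb_reps uL sL.
rewrite (perm_big _ ps) [RHS](perm_big _ ps) /= !big_flatten /= !big_map.
rewrite big_seq [RHS]big_seq; apply: eq_bigr => x xs.
have xL := ss _ xs.
have [fx|nfx] := boolP [forall a in A, act a x == x].
  rewrite [RHS]big_seq_cond big_seq; apply: eq_bigl => y; case: (boolP (y \in _)) => //.
  by move=> /orbP [a aA ->]; rewrite (eqP (forall_inP fx a aA)).
rewrite [RHS]big_seq_cond [RHS]big1 => [|y /andP [yx fy]]; last first.
  case/negP: nfx; have /orbP [b bA ->] := orb_sym yx.
  by rewrite (eqP (forall_inP fy b bA)).
rewrite (eq_big_seq (fun=> F x)) => [|y /orbP [a aA ->]]; last exact: FL.
rewrite big_const_seq count_predT iter_addr_0.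
by have /dvdnP [k ->] := orb_p pp pA nfx; rewrite mulnC mulrnA pV mul0rn.
Qed.

Lemma dvdn_sum_fix (p : nat) A (L : seq T) (F : T -> nat) :
  prime p -> (p.-group A)%g -> uniq L ->
  (forall a x, a \in A -> x \in L -> act a x \in L) ->
  (forall a x, a \in A -> x \in L -> F (act a x) = F x) ->
  (forall x, x \in L -> ~~ [forall a in A, act a x == x]) ->
  (p %| \sum_(x <- L) F x)%N.
Proof.
move=> pp pA uL sL FL nf; have p1 := prime_gt1 pp.
have Zp0 (v : 'Z_p) : v *+ p = 0 by rewrite -mulr_natr char_Zp ?mulr0.
have : \sum_(x <- L) (F x)%:R = 0 :> 'Z_p.
  rewrite (sum_fix pp pA Zp0 uL sL); last by move=> a x aA xL; rewrite FL.
  by rewrite big_seq_cond big1 // => x /andP [/nf /negPf ->].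
by rewrite -natr_sum => /(congr1 val) /=; rewrite Zp_nat /= Zp_cast // => /eqP.
Qed.

Lemma size_orb_act (A : {group Ga}) g x : g \in A -> #|stab A (act g x)| = #|stab A x|.
Proof.
move=> gA; have pO : perm_eq (orb A (act g x)) (orb A x).
  have xg : act g x \in orb A x by apply/orbP; exists g.
  apply: uniq_perm; rewrite ?orb_uniq // => y; apply/idP/idP; first exact: orb_trans xg.
  exact: orb_trans (orb_sym xg).
apply/eqP; rewrite -(@eqn_pmul2l (size (orb A x))).
  by rewrite card_orb -(perm_size pO) card_orb.
by have := orb_refl A x; case: (orb A x).
Qed.

End Orbits.

(** * Socle filtration and nilpotence of the augmentation ideal *)

Section Socle.
Variables (Ga : finGroupType) (V : zmodType) (act : Ga -> V -> V).

(** The elements killed by the k-th power of the augmentation ideal. *)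
Fixpoint soc (k : nat) (v : V) : Prop :=
  if k is k'.+1 then forall g, soc k' (act g v - v) else v = 0.

Hypothesis actD : forall g u v, act g (u + v) = act g u + act g v.

Lemma act0 g : act g 0 = 0.
Proof. by apply: (addrI (act g 0)); rewrite -actD !addr0. Qed.

Lemma actN g v : act g (- v) = - act g v.
Proof. by apply: (addrI (act g v)); rewrite -actD !subrr act0. Qed.

Lemma actB g u v : act g (u - v) = act g u - act g v.
Proof. by rewrite actD actN. Qed.

Lemma actMn g v n : act g (v *+ n) = act g v *+ n.
Proof. by elim: n => [|n IHn]; rewrite ?mulr0n ?act0 // !mulrS actD IHn. Qed.

Lemma act_sum g I (s : seq I) (F : I -> V) :
  act g (\sum_(i <- s) F i) = \sum_(i <- s) act g (F i).
Proof. by elim/big_rec2: _ => [|i u v _ <-]; rewrite ?act0 ?actD. Qed.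

Lemma soc0 k : soc k 0.
Proof. by elim: k => //= k IHk g; rewrite act0 subr0. Qed.

Lemma socD k u v : soc k u -> soc k v -> soc k (u + v).
Proof.
elim: k u v => [|k IHk] u v /=; first by move=> -> ->; rewrite addr0.
by move=> hu hv g; rewrite actD opprD addrACA; exact: IHk.
Qed.

Lemma socN k v : soc k v -> soc k (- v).
Proof.
elim: k v => [|k IHk] v /=; first by move=> ->; rewrite oppr0.
by move=> h g; rewrite actN -opprD; exact: IHk.
Qed.

Lemma socS k v : soc k v -> soc k.+1 v.
Proof. by elim: k v => [|k IHk] v /=; [move=> -> g; rewrite act0 subr0|move=> h g; exact: IHk]. Qed.

(** Applying operators g - 1 as long as some value is nonzero must stop, and it stops at a fixed
    vector. *)
Lemma soc_fixed (K : set V) k v : soc k v -> v <> 0 -> K v ->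
  (forall g u, K u -> K (act g u - u)) ->
  exists w, [/\ K w, w <> 0 & forall g, act g w = w].
Proof.
elim: k v => //= k IHk v h v0 Kv KJ.
have [hf|] := pselect (forall g, act g v = v); first by exists v.
move=> /existsNP [g gv]; apply: (IHk (act g v - v)) => //; last exact: KJ.
by move=> /eqP; rewrite subr_eq0 => /eqP.
Qed.

End Socle.

Section Nilpotence.
Variables (Ga : finGroupType) (p N : nat).
Hypotheses (pp : prime p) (pGa : (p.-group [set: Ga]%SET)%g).
Let m := (p ^ N.+1)%N.
Let m_gt1 : (1 < m)%N.
Proof. by rewrite /m -(exp1n N.+1) ltn_exp2r // prime_gt1. Qed.
Let R := {ffun Ga -> 'Z_m}.

Let ract (g : Ga) (r : R) : R := [ffun x => r (g^-1 * x)%g].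

Let ract1 r : ract 1%g r = r.
Proof. by apply/ffunP => x; rewrite ffunE invg1 mul1g. Qed.
Let ractM g h r : ract (g * h)%g r = ract g (ract h r).
Proof. by apply/ffunP => x; rewrite !ffunE invgM mulgA. Qed.
Let ractD g (r s : R) : ract g (r + s) = ract g r + ract g s.
Proof. by apply/ffunP => x; rewrite !ffunE. Qed.

(* Count the cosets of S that are fixed by Ga. *)
Let fixed_mod (S : {set R}) : 0 \in S ->
  (forall u v, u \in S -> v \in S -> u + v \in S) ->
  (forall g u, u \in S -> ract g u \in S) -> (exists u, u \notin S) ->
  exists2 u, u \notin S & forall g, ract g u - u \in S.
Proof.
move=> S0 SD SJ [u0 nu0].
have Nmul (u : R) : - u = u *+ m.-1.
  apply/eqP; rewrite eq_sym -subr_eq0 opprK -mulrSr prednK; last exact: ltnW.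
  apply/eqP/ffunP => x; rewrite ffunMnE ffunE -mulr_natr.
  by rewrite (_ : m%:R = 0 :> 'Z_m) ?mulr0 // char_Zp.
have SN (u : R) : u \in S -> - u \in S.
  by move=> uS; rewrite Nmul; elim: m.-1 => [|k IHk]; rewrite ?mulr0n ?mulrS ?SD.
pose cos (u : R) : {set R} := [set v : R | (v - u : R) \in S]%SET.
have cosP u v : (cos u == cos v) = ((v - u : R) \in S).
  apply/eqP/idP => [h|h].
    by have : v \in cos v by [rewrite inE subrr]; rewrite -h inE.
  apply/setP => w; rewrite !inE; apply/idP/idP => hw.
    have -> : w - v = (w - u) - (v - u) by rewrite opprB addrA subrK.
    by rewrite SD // SN.
  by rewrite -(subrK v w) -addrA SD.
pose L : seq {set R} := undup [seq cos u | u <- enum {: R}].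
have LP C : reflect (exists u, C = cos u) (C \in L).
  rewrite mem_undup; apply: (iffP mapP) => [[u _ ->]|[u ->]]; exists u => //.
  by rewrite mem_enum.
pose cact (g : Ga) (C : {set R}) : {set R} := [set ract g x | x in C]%SET.
have cactE g u : cact g (cos u) = cos (ract g u).
  apply/setP => w; apply/imsetP/idP => [[v]|].
    by rewrite !inE => hv ->; have := SJ g _ hv; rewrite (actB ractD).
  rewrite inE => hw; exists (ract g^-1%g w); last by rewrite -ractM mulgV ract1.
  by have := SJ g^-1%g _ hw; rewrite (actB ractD) inE -ractM mulVg ract1.
have cact1 C : cact 1%g C = C.
  by rewrite /cact (eq_imset _ ract1) imset_id.
have cactM g h C : cact (g * h)%g C = cact g (cact h C).
  by rewrite /cact -imset_comp; apply: eq_imset => x; rewrite /= ractM.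
have uL : uniq L by exact: undup_uniq.
have sL a C : a \in [set: Ga]%G -> C \in L -> cact a C \in L.
  by move=> _ /LP [u ->]; apply/LP; exists (ract a u); rewrite cactE.
have p_gt1 := prime_gt1 pp.
have Zp0 (v : 'Z_p) : v *+ p = 0 by rewrite -mulr_natr char_Zp ?mulr0.
have := @sum_fix _ _ cact cact1 cactM p 'Z_p [set: Ga]%G L (fun=> 1) pp pGa Zp0 uL sL
  (fun _ _ _ _ => erefl).
rewrite !big_const_seq !iter_addr_0 count_predT.
have card_cos u : #|cos u| = #|S|.
  rewrite -(card_imset (mem S) (addIr u)); apply: eq_card => w.
  apply/idP/imsetP => [|[v vS ->]]; first by rewrite inE => h; exists (w - u); rewrite ?subrK.
  by rewrite inE addrK.
have sizeL : (size L * #|S| = #|{: R}|)%N.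
  rewrite -[RHS]sum1_card.
  transitivity (\sum_(u : R) \sum_(C <- L | cos u == C) 1)%N; last first.
    apply: eq_bigr => u _; rewrite (eq_bigl (fun y => y == cos u)); last first.
      by move=> y; rewrite eq_sym.
    rewrite -big_filter filter_pred1_uniq ?big_seq1 //.
    by apply/LP; exists u.
  rewrite (exchange_big_dep xpredT) //= -sum1_size big_distrl /= big_seq [RHS]big_seq.
  apply: eq_bigr => C /LP [u ->]; rewrite mul1n -(card_cos u) sum1dep_card.
  by apply: eq_card => w; rewrite !inE eq_sym cosP.
have cR : #|{: R}| = (p ^ (N.+1 * #|Ga|))%N.
  by rewrite card_ffun card_ord Zp_cast // -expnM.
have L0 : cos 0 \in L by apply/LP; exists 0.
have Lu : cos u0 \in L by apply/LP; exists u0.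
have ne : cos 0 != cos u0 by rewrite cosP subr0.
have pL : (p %| size L)%N.
  have : (size L %| p ^ (N.+1 * #|Ga|))%N by rewrite -cR -sizeL dvdn_mulr.
  move=> /(dvdn_pfactor _ _ pp) [[|k] _ hk]; last by rewrite hk expnS dvdn_mulr.
  by move: hk L0 Lu ne; case: (L) => // a [|//] _; rewrite !inE => /eqP -> /eqP ->; rewrite eqxx.
have /dvdnP [k ->] := pL; rewrite mulnC mulrnA Zp0 mul0rn => /esym h.
have {h} : (p %| count (fun C => [forall a in [set: Ga]%G, cact a C == C]) L)%N.
  move: h => /(congr1 val) /=; rewrite -[val _]/(nat_of_ord _) Zp_nat /= => h.
  by rewrite /dvdn -{1}(Zp_cast p_gt1) h.
set cnt := count _ L => pc.
have : (0 < cnt)%N.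
  rewrite -has_count; apply/hasP; exists (cos 0) => //; apply/forall_inP => a _.
  by rewrite cactE (act0 ractD) eqxx.
move=> c0; have c1 : (1 < cnt)%N by exact: leq_trans p_gt1 (dvdn_leq c0 pc).
have [C CL /andP [Cf nC]] : exists2 C, C \in L &
    [forall a in [set: Ga]%G, cact a C == C] && (C != cos 0).
  apply/hasP; apply: contraLR c1; rewrite -all_predC => /allP h.
  rewrite -leqNgt; apply: (@leq_trans (count (pred1 (cos 0)) L)).
    rewrite /cnt -!size_filter; apply: uniq_leq_size; first exact: filter_uniq.
    move=> C; rewrite !mem_filter => /andP [fC CL]; rewrite CL andbT.
    by have := h C CL; rewrite /= fC /= negbK.
  by rewrite count_uniq_mem // L0.
move: Cf nC; have /LP [u ->] := CL => /forall_inP fu nu; exists u.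
  by move: nu; rewrite eq_sym cosP subr0.
by move=> g; have := fu g (finset.in_setT _); rewrite cactE eq_sym cosP.
Qed.

Let S k : {set R} := [set r | `[< soc ract k r >]]%SET.

Let SP k r : reflect (soc ract k r) (r \in S k).
Proof. by rewrite inE; exact: asboolP. Qed.

(** By [fixed_mod] the filtration of the finite module [R] grows strictly until it is everything. *)
Let socR : exists k, forall r, soc ract k r.
Proof.
have hS k : (S k == [set: R]%SET) || (k < #|S k|)%N.
  elim: k => [|k IHk].
    apply/orP; right; rewrite card_gt0; apply/set0Pn; exists 0.
    by apply/SP; exact: (soc0 ractD).
  have SS : (S k \subset S k.+1)%g.
    by apply/fintype.subsetP => r /SP h; apply/SP; exact: (socS ractD h).
  have [/eqP e|nS] := boolP (S k == [set: R]%SET).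
    by rewrite -finset.subTset -e SS.
  have := IHk; rewrite (negPf nS) /= => h.
  have [||||u nu hu] := @fixed_mod (S k).
  - by apply/SP; exact: (soc0 ractD).
  - move=> u v /SP h1 /SP h2; apply/SP; exact: (socD ractD).
  - move=> g u /SP h1; apply/SP.
    have h2 : soc ract k (ract g u - u) by exact: (socS ractD h1 g).
    by rewrite -(subrK u (ract g u)); exact: (socD ractD).
  - by move: nS; rewrite -finset.subTset => /subsetPn [u _ ?]; exists u.
  apply/orP; right; apply: (leq_ltn_trans h); apply: proper_card.
  apply/properP; split=> //; exists u => //; apply/SP => g.
  exact/SP.
exists #|{: R}| => r; have : r \in S #|{: R}|.
  have := hS #|{: R}|; rewrite ltnNge max_card orbF => /eqP ->; exact: finset.in_setT.
by move=> /SP.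
Qed.

(** Every v is the image of a generator of the regular module [R] under an equivariant map. The
    exponent found for [R] thus serves all v at once, even when V is infinite. *)
Lemma p_group_nilpotent (V : zmodType) (act : Ga -> V -> V) :
  (forall x, act 1%g x = x) ->
  (forall g h x, act (g * h)%g x = act g (act h x)) ->
  (forall g u v, act g (u + v) = act g u + act g v) ->
  (forall v : V, v *+ (p ^ N.+1) = 0) ->
  exists K, forall v, soc act K v.
Proof.
move=> act1 actM aD pV; have [K hK] := socR; exists K => v.
pose ev (r : R) : V := \sum_x act x v *+ r x.
have modm (w : V) n : w *+ (n %% m) = w *+ n.
  by rewrite [in RHS](divn_eq n m) mulrnDr mulnC mulrnA pV mul0rn add0r.
have evD (r s : R) : ev (r + s) = ev r + ev s.
  rewrite /ev -big_split; apply: eq_bigr => x _ /=; rewrite ffunE /= -mulrnDr.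
  by rewrite [X in (_ %% X)%N](Zp_cast m_gt1) modm.
have ev0 : ev 0 = 0 by apply: (addrI (ev 0)); rewrite -evD !addr0.
have evN r : ev (- r) = - ev r by apply: (addrI (ev r)); rewrite -evD !subrr ev0.
have evA g r : act g (ev r) = ev (ract g r).
  rewrite /ev (act_sum aD) (reindex_inj (mulgI g^-1%g)) /=; apply: eq_bigr => x _.
  by rewrite (actMn aD) -actM mulKVg ffunE.
have evS k r : soc ract k r -> soc act k (ev r).
  elim: k r => [|k IHk] r /=; first by move=> ->.
  by move=> h g; rewrite evA -evN -evD; exact: IHk.
have -> : v = ev [ffun x => (x == 1%g)%:R].
  rewrite /ev (bigD1 1%g) //= big1 ?addr0 => [|x /negPf x1]; last by rewrite ffunE x1.
  have e1 : nat_of_ord (1%:R : 'Z_m) = 1%N by rewrite /= modn_small // Zp_cast.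
  by rewrite act1 ffunE eqxx e1.
exact: evS.
Qed.

End Nilpotence.

Lemma coprime_inv (p c : nat) : prime p -> ~~ (p %| c)%N -> exists m k, (m * c = 1 + k * p)%N.
Proof.
move=> pp npc; have c0 : (0 < c)%N by case: c npc => //; rewrite dvdn0.
have : coprime c p by rewrite coprime_sym prime_coprime.
by move=> /(coprimeP _ c0) [[m k] /= h]; exists m, k; lia.
Qed.

(** * Linear algebra over F_p in groups of exponent p *)

Section Span.
Variables (p : nat) (V : zmodType).
Hypotheses (pp : prime p) (pV : forall v : V, v *+ p = 0).
Implicit Types (E S Z : set V).

Definition addgroup E :=
  [/\ E 0, (forall u v, E u -> E v -> E (u + v)) & (forall u, E u -> E (- u))].

Definition span S : set V := [set v | forall E, addgroup E -> S `<=` E -> E v].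

Lemma span_addgroup S : addgroup (span S).
Proof.
split.
- by move=> E [].
- by move=> u v hu hv E gE SE; have [_ ED _] := gE; apply: ED; [exact: hu|exact: hv].
- by move=> u hu E gE SE; have [_ _ EN] := gE; apply: EN; exact: hu.
Qed.

Lemma sub_span S : S `<=` span S. Proof. by move=> v Sv E _; exact. Qed.

Lemma span_min S E : addgroup E -> S `<=` E -> span S `<=` E.
Proof. by move=> gE SE v; exact. Qed.

Lemma addgroupB E u v : addgroup E -> E u -> E v -> E (u - v).
Proof. by move=> [_ ED EN] Eu Ev; apply: ED => //; exact: EN. Qed.

Lemma addgroupMn E v n : addgroup E -> E v -> E (v *+ n).
Proof. by move=> [E0 ED _] Ev; elim: n => [|n IHn]; rewrite ?mulr0n ?mulrS //; exact: ED. Qed.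

Lemma addgroup_sum E (I : eqType) (s : seq I) (P : pred I) (F : I -> V) :
  addgroup E -> (forall i, i \in s -> P i -> E (F i)) -> E (\sum_(i <- s | P i) F i).
Proof.
move=> [E0 ED _] h; rewrite big_seq_cond; elim/big_ind: _ => //.
by move=> i /andP [/h].
Qed.

Lemma mulrn_mod (v : V) n : v *+ (n %% p) = v *+ n.
Proof. by rewrite [in RHS](divn_eq n p) mulrnDr mulnC mulrnA pV mul0rn add0r. Qed.

Lemma mulrn_dvd (v : V) n : (p %| n)%N -> v *+ n = 0.
Proof. by move=> /dvdnP [k ->]; rewrite mulnC mulrnA pV mul0rn. Qed.

Lemma oppr_mulrn (v : V) : - v = v *+ p.-1.
Proof.
by apply/eqP; rewrite eq_sym -subr_eq0 opprK -mulrSr prednK ?prime_gt0 // pV.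
Qed.

(** Linear independence over F_p modulo E; natural numbers serve as coefficients since p kills V. *)
Definition indep E Z := forall (s : seq V) (c : V -> nat), uniq s ->
  (forall z, z \in s -> Z z) -> E (\sum_(z <- s) z *+ c z) ->
  forall z, z \in s -> (p %| c z)%N.

(** Z is a maximal subset of D that is independent modulo E. By maximality any other d in D occurs
    in a relation with a coefficient prime to p, which can be inverted. *)
Lemma basis_mod E (D : set V) : addgroup E ->
  exists Z, [/\ Z `<=` D, indep E Z & forall d, D d -> exists2 a, span Z a & E (d - a)].
Proof.
move=> gE; have [E0 ED EN] := gE.
have [|Z [[ZD iZ] maxZ]] := @Zorn_bigcup V [set Z | Z `<=` D /\ indep E Z].
  move=> F FP Ftot; split; first by move=> v [Z FZ Zv]; exact: (FP Z FZ).1.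
  move=> s c us sF h z zs.
  have [Z FZ sZ] : exists2 Z, F Z & forall z, z \in s -> Z z.
    have [Z0 FZ0 _] := sF z zs.
    elim: s {us h zs} sF => [|a s IHs] sF; first by exists Z0.
    have [|Z FZ sZ] := IHs; first by move=> y ys; apply: sF; rewrite inE ys orbT.
    have [Z' FZ' Za] := sF a (mem_head _ _).
    have [ZZ'|Z'Z] := Ftot _ _ FZ FZ'; [exists Z'|exists Z] => // y; rewrite inE => /orP [/eqP->|/sZ] //.
      exact: ZZ'.
    exact: Z'Z.
  exact: (FP Z FZ).2 us sZ h z zs.
exists Z; split=> // d Dd.
have [Zd|nZd] := pselect (Z d).
  by exists d; [exact: sub_span|rewrite subrr].
have : ~ indep E (Z `|` [set d]).
  move=> h; apply: (maxZ (Z `|` [set d])); last by split=> // v [/ZD//|->].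
  by split; [left|move=> /(_ d (or_intror erefl))].
move=> /existsNP [s /existsNP [c /not_implyP [us /not_implyP [sZ /not_implyP [hE]]]]].
move=> /existsNP [z /not_implyP [zs /negP npz]].
have sZ' y : y \in s -> y != d -> Z y by move=> /sZ [//|/= ->]; rewrite eqxx.
have ds : d \in s.
  apply: contraPT (npz) => nds; apply/negP; rewrite negbK; apply: (iZ s c us _ hE z zs).
  by move=> y ys; apply: sZ' => //; apply: contraNneq nds => <-.
move: hE; rewrite (bigD1_seq d) //= -big_filter; set s' := [seq i <- s | i != d] => hE.
have us' : uniq s' by exact: filter_uniq.
have s'Z y : y \in s' -> Z y by rewrite mem_filter => /andP [? ?]; exact: sZ'.
have npd : ~~ (p %| c d)%N.
  apply/negP => pd; move: hE; rewrite (mulrn_dvd _ pd) add0r => hE.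
  have [zd|nzd] := eqVneq z d; first by rewrite zd pd in npz.
  by move/negP: npz; apply; apply: (iZ s' c us' s'Z hE); rewrite mem_filter nzd.
have [m [k mk]] := coprime_inv pp npd.
exists (- (\sum_(z <- s') z *+ c z) *+ m).
  have gZ := span_addgroup Z; have [_ _ ZN] := gZ.
  apply: (addgroupMn _ gZ); apply: ZN; apply: addgroup_sum => // i ii _.
  by apply: (addgroupMn _ gZ); apply: sub_span; exact: s'Z.
have := addgroupMn m gE hE; rewrite mulrnDl -mulrnA mulnC mk mulrnDr mulr1n.
by rewrite mulnC mulrnA pV mul0rn addr0 mulNrn opprK.
Qed.

Lemma span_sum S v : span S v -> exists2 s : seq V, (forall y, y \in s -> S y) & v = \sum_(y <- s) y.
Proof.
move=> hv; apply: (hv [set v | exists2 s : seq V, (forall y, y \in s -> S y) & v = \sum_(y <- s) y]).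
  have hD u w : (exists2 s : seq V, (forall y, y \in s -> S y) & u = \sum_(y <- s) y) ->
     (exists2 s : seq V, (forall y, y \in s -> S y) & w = \sum_(y <- s) y) ->
     (exists2 s : seq V, (forall y, y \in s -> S y) & u + w = \sum_(y <- s) y).
    move=> [s hs ->] [t ht ->]; exists (s ++ t); last by rewrite big_cat.
    by move=> y; rewrite mem_cat => /orP [/hs|/ht].
  split; [by exists [::] => //; rewrite big_nil|exact: hD|].
  move=> u hu; rewrite /= oppr_mulrn; elim: p.-1 => [|n IHn].
    by exists [::] => //; rewrite big_nil.
  by rewrite mulrS; exact: hD.
move=> y Sy; exists [:: y]; last by rewrite big_seq1.
by move=> z; rewrite inE => /eqP ->.
Qed.

Lemma span_comb S v : span S v ->
  exists (s : seq V) (c : V -> nat),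
    [/\ uniq s, forall y, y \in s -> S y & v = \sum_(y <- s) y *+ c y].
Proof.
move=> /span_sum [s hs ->]; exists (undup s), (fun y => count_mem y s).
split; [exact: undup_uniq|by move=> y; rewrite mem_undup => /hs|].
rewrite big_undup_iterop_count; apply: eq_bigr => y _.
by elim: (count_mem y s) => [|[|n] IHn] //; rewrite mulrS -IHn.
Qed.

End Span.

(* A module over the group algebra F_p[Ga] of a p-group that is a directed
   union of finite permutation modules is a permutation module: generators
   with stabilizer of order m are chosen independent modulo the span E m of
   the elements with a larger stabilizer and of the augmentation elements. *)
Section LocallyPermutation.
Variables (Ga : finGroupType) (p : nat) (V : zmodType) (act : Ga -> V -> V).
Hypotheses (pp : prime p) (pGa : (p.-group [set: Ga]%SET)%g).
Hypothesis pV : forall v : V, v *+ p = 0.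
Hypothesis act1 : forall v, act 1%g v = v.
Hypothesis actM : forall g h v, act (g * h)%g v = act g (act h v).
Hypothesis actD : forall g u v, act g (u + v) = act g u + act g v.
Variable C : set V.
Hypotheses (gC : addgroup C) (sC : forall g v, C v -> C (act g v)).
Hypothesis locC : forall s : seq V, (forall v, v \in s -> C v) ->
  exists bs : seq V, [/\ uniq bs, (forall b, b \in bs -> C b),
    (forall g b, b \in bs -> act g b \in bs),
    (forall c : V -> nat, \sum_(b <- bs) b *+ c b = 0 -> forall b, b \in bs -> (p %| c b)%N) &
    forall v, v \in s -> exists c : V -> nat, v = \sum_(b <- bs) b *+ c b].

Local Notation GA := [set: Ga]%G.
Let st v := #|stab act GA v|.
Let aug (S : set V) : set V := [set w | exists g v, S v /\ w = act g v - v].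
Let E m := span ([set v | C v /\ (m < st v)%N] `|` aug C).
Let D m : set V := [set v | C v /\ st v = m].

Let gE m : addgroup (E m). Proof. exact: span_addgroup. Qed.

Let Zc : {Z : nat -> set V | forall m, [/\ Z m `<=` D m, indep p (E m) (Z m) &
  forall d, D m d -> exists2 a, span (Z m) a & E m (d - a)]}.
Proof.
have [m|Z hZ] := @choice _ _ (fun m Z => [/\ Z `<=` D m, indep p (E m) Z &
  forall d, D m d -> exists2 a, span Z a & E m (d - a)]); last by exists Z.
exact: basis_mod.
Qed.
Let Z := sval Zc.
Let Y : set V := [set y | exists m z g, Z m z /\ y = act g z].

Let ZD m z : Z m z -> C z /\ st z = m. Proof. by have [h _ _] := svalP Zc m; exact: h. Qed.
Let Zi m : indep p (E m) (Z m). Proof. by have [_ h _] := svalP Zc m. Qed.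
Let Zs m d : C d -> st d = m -> exists2 a, span (Z m) a & E m (d - a).
Proof. by move=> Cd sd; have [_ _ h] := svalP Zc m; exact: h. Qed.

Let YC : Y `<=` C.
Proof. by move=> y [m [z [g [/ZD [Cz _] ->]]]]; exact: sC. Qed.

Let Yact g y : Y y -> Y (act g y).
Proof. by move=> [m [z [h [Zz ->]]]]; exists m, z, (g * h)%g; rewrite actM. Qed.

Let gA := span_addgroup Y.

Let Aact g v : span Y v -> span Y (act g v).
Proof.
move=> hv; apply: (hv [set v | span Y (act g v)]); last by move=> y /(Yact g) /sub_span.
have [A0 AD AN] := gA; split=> [|u w hu hw|u hu] /=.
- by rewrite (act0 actD).
- by rewrite actD; exact: AD.
- by rewrite (actN actD); exact: AN.
Qed.

Let sum_addgroup (A B : set V) : addgroup A -> addgroup B ->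
  addgroup [set v | exists2 a, A a & B (v - a)].
Proof.
move=> [A0 AD AN] [B0 BD BN]; split.
- by exists 0; rewrite ?subr0.
- move=> u v [a Aa Ba] [b Ab Bb]; exists (a + b); first exact: AD.
  by rewrite opprD addrACA; exact: BD.
- by move=> u [a Aa Ba]; exists (- a); [exact: AN|rewrite -opprD; exact: BN].
Qed.

(** The product of C with the k-th power of the augmentation ideal. *)
Let J := fix J k : set V := if k is k'.+1 then span (aug (J k')) else C.

Let gJ k : addgroup (J k).
Proof. by case: k => [|k] //=; exact: span_addgroup. Qed.

(** Induction from large stabilizers to small ones: modulo [E m] an element with stabilizer of order
    m is a combination of generators, and [E m] is spanned by elements with a larger stabilizer and
    by augmentation elements. *)
Let top_span v : C v -> exists2 a, span Y a & J 1 (v - a).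
Proof.
have gB := sum_addgroup gA (gJ 1).
move: {2}(#|Ga|.+1 - st v)%N (leqnn (#|Ga|.+1 - st v)%N) => n.
elim: n v => [|n IHn] v hn Cv.
  have := max_card (mem (stab act GA v)); rewrite -/(st v) => h.
  by move: hn; rewrite leqn0 subn_eq0 ltnNge h.
have [a Za Ea] := Zs Cv erefl.
have Ya : span Y a.
  apply: span_min Za => // z Zz; apply: sub_span.
  by exists (st v), z, 1%g; rewrite act1.
suff : [set v | exists2 a, span Y a & J 1 (v - a)] (v - a).
  move=> [b Yb Jb]; exists (a + b); first by case: gA => _ AD _; exact: AD.
  by rewrite opprD addrA.
apply: span_min Ea => // w [[Cw lw]|[g [u [Cu ->]]]].
  apply: IHn => //; have := max_card (mem (stab act GA w)); rewrite -/(st w) => h.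
  by move: hn lw h; rewrite !(card_ord, cardE) /=; lia.
exists 0; first by case: gA.
by rewrite subr0; apply: sub_span; exists g, u.
Qed.

(** Nakayama's lemma: by [top_span] Y spans C modulo [J 1], hence modulo every [J k], and [J K] is 0
    for some K because the augmentation ideal is nilpotent. *)
Let spanY v : C v -> span Y v.
Proof.
move=> Cv; have step k w : J k w -> exists2 a, span Y a & J k.+1 (w - a).
  elim: k w => [|k IHk] w; first exact: top_span.
  apply: (span_min (sum_addgroup gA (gJ k.+2))) => _ [g [u [/IHk [a Ya Ja] ->]]].
  exists (act g a - a); first exact: (addgroupB gA (Aact g Ya) Ya).
  by apply: sub_span; exists g, (u - a); split=> //; rewrite (actB actD) !opprB [a - act g a]addrC addrACA [- u + a]addrC.
have all k : exists2 a, span Y a & J k (v - a).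
  elim: k => [|k [a Ya Ja]]; first by exists 0; [case: gA|rewrite subr0].
  have [b Yb Jb] := step _ _ Ja; exists (a + b); last by rewrite opprD addrA.
  by case: gA => _ AD _; exact: AD.
have [K hK] := @p_group_nilpotent Ga p 0 pp pGa V act act1 actM actD pV.
have Jsoc k : (k <= K)%N -> J k `<=` soc act (K - k).
  elim: k => [_ w _|k IHk kK]; first by rewrite subn0.
  apply: span_min.
    split; [exact: (soc0 actD)|move=> ? ?; exact: (socD actD)|move=> ?; exact: (socN actD)].
  move=> _ [g [u [/(IHk (ltnW kK)) hu ->]]].
  by move: hu; rewrite -(subnSK kK) /=; exact.
have [a Ya /(Jsoc K (leqnn K))] := all K.
by rewrite subnn /= => /eqP; rewrite subr_eq0 => /eqP ->.
Qed.

(* Summing over orbits of elements with stabilizer of order m is faithful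
   modulo E m. *)
Section Independence.
Variable zs : seq V.
Hypotheses (uz : uniq zs) (zsZ : forall z, z \in zs -> Z (st z) z).
Variable c : V -> nat.
Hypothesis c0 : \sum_(z <- zs) \sum_(y <- orb act GA z) y *+ c z = 0.

Lemma orbit_indep z : z \in zs -> (p %| c z)%N.
Proof.
move: {2}(#|Ga|.+1 - st z)%N (leqnn (#|Ga|.+1 - st z)%N) => n.
have stle w : (st w <= #|Ga|)%N by rewrite /st max_card.
elim: n z => [|n IHn] z hn zzs; first by have := stle z; lia.
set m := st z.
have big w : w \in zs -> (m < st w)%N -> (p %| c w)%N.
  by move=> wz lw; apply: IHn => //; have := stle w; rewrite /m in lw; lia.
(* A finite permutation basis whose span contains all the orbits in question. The induction runs
   over decreasing stabilizers, so [big] already covers the w with a larger one. *)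
have [|bs [ub bC bG bi bsp]] := locC (s := flatten [seq orb act GA z | z <- zs]).
  move=> v /flatten_mapP [w wz /orbP [g _ ->]]; apply: sC.
  by have [] := ZD (zsZ wz).
have [cf cfP] : {cf : V -> V -> nat | forall v, (exists c : V -> nat, v = \sum_(b <- bs) b *+ c b) ->
    v = \sum_(b <- bs) b *+ cf v b}.
  apply: cid; have [v|cf h] := @choice _ _ (fun v c => (exists c : V -> nat, v = \sum_(b <- bs) b *+ c b) -> v = \sum_(b <- bs) b *+ c b).
    have [[d hd]|nd] := pselect (exists c : V -> nat, v = \sum_(b <- bs) b *+ c b).
      by exists d.
    by exists (fun=> 0%N) => /nd.
  by exists cf.
(* Coordinates reduced below p are unique, hence equivariant ([aact]). *)
pose a v b := (cf v b %% p)%N.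
set Lz := flatten _ in bsp.
have Lzg v g : v \in Lz -> act g v \in Lz.
  move=> /flatten_mapP [w wz wO]; apply/flatten_mapP; exists w => //.
  by apply: (orb_trans actM wO); apply/orbP; exists g; rewrite ?inE.
have zLz w : w \in zs -> w \in Lz.
  by move=> wz; apply/flatten_mapP; exists w => //; exact: orb_refl.
have aP v : v \in Lz -> v = \sum_(b <- bs) b *+ a v b.
  by move=> /bsp h; rewrite [LHS]cfP //; apply: eq_bigr => b _; rewrite mulrn_mod.
have alt v b : (a v b < p)%N by rewrite ltn_mod prime_gt0.
have ainj (f g : V -> nat) : (forall b, f b < p)%N -> (forall b, g b < p)%N ->
    \sum_(b <- bs) b *+ f b = \sum_(b <- bs) b *+ g b -> forall b, b \in bs -> f b = g b.
  move=> fp gp h b bb.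
  have : \sum_(b <- bs) b *+ (f b + (p - g b)) = 0.
    rewrite (eq_big_seq (fun b => b *+ f b - b *+ g b)) ?sumrB ?h ?subrr //.
    move=> i ii; rewrite mulrnDr mulrnBr ?pV ?sub0r //; exact: ltnW (gp i).
  move=> /bi /(_ b bb); have := fp b; have := gp b => gb fb.
  by move=> /dvdnP [[|[|k]] hk]; nia.
have aact v g b : v \in Lz -> b \in bs -> a (act g v) (act g b) = a v b.
  move=> vL bb; rewrite (ainj (a (act g v)) (fun b' => a v (act g^-1%g b'))) ?(gactVK act1 actM) //; last exact: bG.
  rewrite -aP; last exact: Lzg.
  rewrite {1}(aP v vL) (act_sum actD) [RHS](perm_big (map (act g) bs)).
    by rewrite big_map; apply: eq_bigr => i _; rewrite (actMn actD) (gactVK act1 actM).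
  apply: uniq_perm => //; first by rewrite map_inj_uniq //; exact: can_inj (gactVK act1 actM g).
  move=> y; apply/idP/mapP => [yb|[x xb ->]]; last exact: bG.
  by exists (act g^-1%g y); [exact: bG|rewrite (gactKV act1 actM)].
have [|betas sbs pbs] := orb_reps act1 actM (A := GA) ub; first by move=> g b _; exact: bG.
pose lam beta v := (\sum_(b <- orb act GA beta) a v b)%N.
have orbbs beta b : beta \in betas -> b \in orb act GA beta -> b \in bs.
  by move=> /sbs hb /orbP [g _ ->]; exact: bG.
have storb x y : y \in orb act GA x -> st y = st x.
  by move=> /orbP [g _ ->]; rewrite /st size_orb_act // inE.
have pstab x : (p.-group (stab_group act1 actM GA x))%g.
  by apply: pgroupS pGa; exact: finset.subsetT.
have nofix x y : (st x < st y)%N ->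
    ~~ [forall a0 in stab_group act1 actM GA y, act a0 x == x].
  move=> lt; apply/negP => /forall_inP h; move: lt; rewrite ltnNge subset_leq_card //.
  by apply/fintype.subsetP => g gy; rewrite !inE (h g gy).
(* Only the beta with a stabilizer of order m survive modulo [E m]. If the stabilizer is larger,
   beta lies in [E m]; if it is smaller, the stabilizer of w moves every point of the orbit of beta,
   so p divides [lam beta w]. *)
have red w : w \in zs -> st w = m ->
    E m (w - \sum_(beta <- betas) (if st beta == m then beta *+ lam beta w else 0)).
  move=> wz sw; rewrite {1}(aP w (zLz w wz)) (perm_big _ pbs) /= big_flatten big_map /=.
  rewrite -sumrB; apply: addgroup_sum => // beta hbeta _.
  have h1 : E m (\sum_(b <- orb act GA beta) b *+ a w b - beta *+ lam beta w).
    rewrite /lam -sumrMnr -sumrB; apply: addgroup_sum => // b /orbP [g _ ->] _.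
    rewrite -mulrnBl; apply: (addgroupMn _ (gE m)); apply: sub_span; right.
    by exists g, beta; split=> //; apply: bC; exact: sbs.
  case: eqP => [//|/eqP ne]; rewrite subr0.
  suff h2 : E m (beta *+ lam beta w).
    by rewrite -[X in E m X](subrK (beta *+ lam beta w)); have [_ + _] := gE m; apply.
  have [lt|le] := ltnP m (st beta).
    apply: (addgroupMn _ (gE m)); apply: sub_span; left; split=> //; apply: bC; exact: sbs.
  rewrite (mulrn_dvd pV) //; first by have [] := gE m.
  apply: (dvdn_sum_fix act1 actM pp (pstab w)); first exact: orb_uniq.
  - move=> g x _ xO; apply: (orb_trans actM xO); apply/orbP; exists g; rewrite ?inE //.
  - move=> g x; rewrite inE => /andP [_ /eqP gw] xO.
    by rewrite -{1}gw aact ?zLz //; exact: orbbs xO.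
  - move=> x xO; apply: nofix; rewrite (storb _ _ xO) sw ltn_neqAle ne //.
(* Compare the coefficients of beta in the relation [c0]. The w with a larger stabilizer drop out by
   induction, and those with a smaller one because the stabilizer of beta moves every point of their
   orbits. *)
have rel beta : beta \in betas -> st beta = m ->
    (p %| \sum_(w <- zs | st w == m) lam beta w * c w)%N.
  move=> hb sb.
  have bb : beta \in bs by exact: sbs.
  have : \sum_(b <- bs) b *+ (\sum_(w <- zs) \sum_(y <- orb act GA w) a y b * c w)%N = 0.
    rewrite -[RHS]c0; transitivity (\sum_(b <- bs) \sum_(w <- zs) \sum_(y <- orb act GA w) b *+ (a y b * c w)).
      by apply: eq_bigr => b _; rewrite -sumrMnr; apply: eq_bigr => w _; rewrite -sumrMnr.
    rewrite exchange_big /=; apply: eq_big_seq => w wz; rewrite exchange_big /=.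
    apply: eq_big_seq => y yO; rewrite {2}(aP y); last by apply/flatten_mapP; exists w.
    by rewrite -sumrMnl; apply: eq_bigr => b _; rewrite mulrnA.
  move=> /bi /(_ beta bb); rewrite (bigID (fun w => st w == m)) /= => h.
  have h2 : (p %| \sum_(w <- zs | st w != m) \sum_(y <- orb act GA w) a y beta * c w)%N.
    rewrite big_seq_cond; apply: dvdn_sum => w /andP [wz ne]; rewrite -big_distrl /=.
    have [lt|le] := ltnP m (st w); first by rewrite dvdn_mull // big.
    apply: dvdn_mulr; apply: (dvdn_sum_fix act1 actM pp (pstab beta)); first exact: orb_uniq.
    - move=> g x _ xO; apply: (orb_trans actM xO); apply/orbP; exists g; rewrite ?inE //.
    - move=> g x; rewrite inE => /andP [_ /eqP gw] xO.
      by rewrite -{1}gw aact //; apply/flatten_mapP; exists w.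
    - move=> x xO; apply: nofix; rewrite (storb _ _ xO) sb ltn_neqAle ne //.
  move: h; rewrite dvdn_addl // => h; move: h; congr (_ %| _)%N.
  rewrite big_seq_cond [RHS]big_seq_cond; apply: eq_bigr => w /andP [wz /eqP sw].
  rewrite -big_distrl /=; congr (_ * _)%N.
  (* Both stabilizers have order m, so m times either orbit sum is a sum over the whole group; the
     two group sums are exchanged by g -> g^-1. *)
  apply/eqP; rewrite -(@eqn_pmul2r m); last first.
    by rewrite -sw /st card_gt0; apply/set0Pn; exists 1%g; rewrite !inE act1 eqxx.
  have e1 := sum_orb act1 actM GA w (fun y => a y beta).
  have e2 := sum_orb act1 actM GA beta (fun b => a w b).
  rewrite -/(st w) sw -mulr_natr natn in e1; rewrite -/(st beta) sb -mulr_natr natn in e2.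
  apply/eqP; transitivity (\sum_(g in GA) a (act g w) beta)%N; first exact: esym e1.
  rewrite -[RHS](_ : \sum_(g in GA) a w (act g beta) = _)%N; last exact: e2.
  rewrite (reindex_inj invg_inj) /=; apply: eq_big => [g|g _]; first by rewrite !inE.
  by rewrite -[in LHS](gactVK act1 actM g beta) aact ?zLz // bG.
(* By [rel] the reduced parts [rd w] cancel in this sum, and each w - [rd w] lies in [E m]. *)
have Ef : E m (\sum_(w <- [seq w <- zs | st w == m]) w *+ c w).
  rewrite big_filter.
  pose rd w := \sum_(beta <- betas) (if st beta == m then beta *+ lam beta w else 0).
  have -> : \sum_(w <- zs | st w == m) w *+ c w =
      \sum_(w <- zs | st w == m) (w - rd w) *+ c w.
    rewrite -[LHS]subr0 (eq_bigr _ (fun w _ => mulrnBl _ _ _)) sumrB; congr (_ - _).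
    rewrite (eq_bigr (fun w => \sum_(beta <- betas) (if st beta == m then beta *+ (lam beta w * c w)%N else 0))); last first.
      move=> w _; rewrite -sumrMnl; apply: eq_bigr => beta _.
      by case: eqP => _; rewrite ?mul0rn // mulrnA.
    rewrite exchange_big /= big_seq big1 // => beta hb.
    case: eqP => [sb|_]; last by rewrite big1.
    by rewrite sumrMnr (mulrn_dvd pV) // rel.
  apply: addgroup_sum => // w wz /eqP sw; apply: (addgroupMn _ (gE m)); exact: red.
apply: (Zi (filter_uniq _ uz) _ Ef); last by rewrite mem_filter eqxx.
by move=> w; rewrite mem_filter => /andP [/eqP sw wz]; have := zsZ wz; rewrite sw.
Qed.

End Independence.

(** Since z' - z is an augmentation element, distinct z and z' would be dependent modulo
    [E (st z)]. *)
Let Z_orbit z z' : Z (st z) z -> Z (st z') z' -> z' \in orb act GA z -> z = z'.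
Proof.
move=> Zz Zz' /orbP [g _ zz']; have [//|/eqP ne] := eqVneq z z'.
have sz' : st z' = st z by rewrite /st zz' size_orb_act // inE.
have us : uniq [:: z'; z] by rewrite /= inE eq_sym andbT; exact/eqP.
have := @Zi (st z) [:: z'; z] (fun y => if y == z then p.-1 else 1%N) us.
move=> /(_ _ _ z' (mem_head _ _)); rewrite ifN; last by rewrite eq_sym; exact/eqP.
have p1 := prime_gt1 pp; move=> h; suff : (p %| 1)%N by rewrite dvdn1 => /eqP p1'; rewrite p1' in p1.
apply: h => [y|].
  by rewrite !inE => /orP [] /eqP -> //; rewrite -sz'.
rewrite big_cons big_seq1 eqxx ifN ?mulr1n -?oppr_mulrn //; last by rewrite eq_sym; exact/eqP.
by apply: sub_span; right; exists g, z; split; [case: (ZD Zz)|rewrite zz'].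
Qed.

(** The relations supported on the finite stable set [L] form a module killed by p. If it were
    nonzero it would contain a nonzero invariant relation, which is constant on orbits, against
    [orbit_indep]. *)
Let Y_indep (ys : seq V) (c : V -> nat) : uniq ys -> (forall y, y \in ys -> Y y) ->
  \sum_(y <- ys) y *+ c y = 0 -> forall y, y \in ys -> (p %| c y)%N.
Proof.
move=> uys ysY c0; have p1 := prime_gt1 pp.
have [zf zfP] : {zf : V -> V | forall y, Y y -> Z (st (zf y)) (zf y) /\ y \in orb act GA (zf y)}.
  apply: cid; have [y|zf h] := @choice _ _ (fun y z => Y y -> Z (st z) z /\ y \in orb act GA z); last by exists zf.
  have [[m [z [g [Zz ->]]]]|nY] := pselect (Y y); last by exists 0 => /nY.
  exists z => _; have [_ sz] := ZD Zz; rewrite sz; split=> //.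
  by apply/orbP; exists g; rewrite ?inE.
pose zs := undup [seq zf y | y <- ys].
have zsZ z : z \in zs -> Z (st z) z.
  by rewrite mem_undup => /mapP [y yy ->]; have [] := zfP y (ysY y yy).
have uzs : uniq zs by exact: undup_uniq.
pose L := flatten [seq orb act GA z | z <- zs].
have uL : uniq L.
  rewrite /L; clear L; elim: zs uzs zsZ => //= z s IHs /andP [nz us] sZ.
  rewrite cat_uniq orb_uniq IHs // => [|w ws]; last by apply: sZ; rewrite inE ws orbT.
  rewrite andbT /=; apply/hasPn => y /flatten_mapP [w ws yw]; apply/negP => yz.
  have : w \in orb act GA z by exact: (orb_trans actM yz (orb_sym act1 actM yw)).
  move=> wz; move/negP: nz; apply; rewrite (Z_orbit _ _ wz) //; first exact/sZ/mem_head.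
  by apply: sZ; rewrite inE ws orbT.
have ysL y : y \in ys -> y \in L.
  move=> yy; have [_ yO] := zfP y (ysY y yy); apply/flatten_mapP; exists (zf y) => //.
  by rewrite mem_undup; apply: map_f.
have gL g y : y \in L -> act g y \in L.
  move=> /flatten_mapP [w wz wO]; apply/flatten_mapP; exists w => //.
  by apply: (orb_trans actM wO); apply/orbP; exists g; rewrite ?inE.
have pL g : perm_eq L (map (act g) L).
  apply: uniq_perm => //; first by rewrite map_inj_uniq //; exact: can_inj (gactVK act1 actM g).
  move=> y; apply/idP/mapP => [yb|[x xb ->]]; last exact: gL.
  by exists (act g^-1%g y); [exact: gL|rewrite (gactKV act1 actM)].
have ZpD (v : V) (r s : 'Z_p) : v *+ (r + s)%R = v *+ r + v *+ s.
  by rewrite -mulrnDr /= [X in (_ %% X)%N](Zp_cast p1) mulrn_mod.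
have Zp0 (r : 'Z_p) : r *+ p = 0 by rewrite -mulr_natr char_Zp ?mulr0.
pose fact (g : Ga) (f : V -> 'Z_p) : V -> 'Z_p := fun y => f (act g^-1%g y).
have fact1 f : fact 1%g f = f by apply/funext => y; rewrite /fact invg1 act1.
have factM g h f : fact (g * h)%g f = fact g (fact h f).
  by apply/funext => y; rewrite /fact invgM actM.
have factD g (f f' : V -> 'Z_p) : fact g (f + f') = fact g f + fact g f' by [].
have fp (f : V -> 'Z_p) : f *+ (p ^ 1) = 0.
  by apply/funext => y; rewrite natmulfctE /= Zp0.
have [k hk] := @p_group_nilpotent Ga p 0 pp pGa (V -> 'Z_p) fact fact1 factM factD fp.
pose K : set (V -> 'Z_p) := [set f | (forall y, y \notin L -> f y = 0 :> 'Z_p) /\ \sum_(y <- L) y *+ f y = 0].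
have KD f f' : K f -> K f' -> K (f + f').
  move=> [h1 h2] [h1' h2']; split; first by move=> y yL; rewrite fctE h1 // h1' // addr0.
  transitivity (\sum_(y <- L) y *+ f y + \sum_(y <- L) y *+ f' y); last by rewrite h2 h2' addr0.
  by rewrite -big_split; apply: eq_bigr => y _; rewrite /= -ZpD.
have KMn f n : K f -> K (f *+ n).
  move=> Kf; elim: n => [|n IHn]; rewrite ?mulr0n ?mulrS; last exact: KD.
  by split=> //; rewrite big1.
have KJ g f : K f -> K (fact g f - f).
  move=> Kf; apply: KD; last first.
    by rewrite (@oppr_mulrn p) //; exact: KMn.
  have [h1 h2] := Kf; split.
    move=> y yL; apply: h1; apply: contra yL => /(gL g); by rewrite (gactKV act1 actM).
  rewrite (perm_big _ (pL g)) big_map.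
  transitivity (act g (\sum_(y <- L) y *+ f y)); last by rewrite h2 (act0 actD).
  rewrite (act_sum actD).
  by apply: eq_bigr => y _; rewrite (actMn actD) /fact (gactVK act1 actM).
pose f0 : V -> 'Z_p := fun y => if y \in ys then (c y)%:R else 0.
have Zpn (v : V) n : v *+ (n%:R : 'Z_p) = v *+ n.
  by rewrite Zp_nat /= [X in (_ %% X)%N](Zp_cast p1) mulrn_mod.
have Kf0 : K f0.
  split; first by move=> y yL; rewrite /f0 ifN //; apply: contra yL; exact: ysL.
  rewrite -[RHS]c0 (bigID (mem ys)) /= addrC big1 ?add0r => [|y /negPf nys]; last by rewrite /f0 nys.
  rewrite -big_filter; apply: etrans (_ : _ = \sum_(y <- [seq y <- L | y \in ys]) y *+ c y) _.
    apply: eq_big_seq => y; rewrite mem_filter => /andP [yy _].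
    by rewrite /f0 yy Zpn.
  apply: perm_big; apply: uniq_perm => //; first exact: filter_uniq.
  by move=> y; rewrite mem_filter; case: (boolP (y \in ys)) => // /ysL ->.
have f00 : f0 = 0.
  apply: contrapT => nf0; have [w [Kw w0 wf]] := soc_fixed (hk f0) nf0 Kf0 KJ.
  apply: w0; have [h1 h2] := Kw.
  have wact g y : w (act g y) = w y.
    by rewrite -[in LHS](wf g) /fact (gactVK act1 actM).
  have hz : forall z, z \in zs -> (p %| w z)%N.
    apply: (orbit_indep uzs zsZ (c := fun z => nat_of_ord (w z))).
    rewrite -[RHS]h2 /L big_flatten big_map /=; apply: eq_bigr => z _.
    by apply: eq_big_seq => y /orbP [g _ ->]; rewrite wact.
  apply/funext => y; have [yL|/h1->//] := boolP (y \in L).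
  have /flatten_mapP [z zz /orbP [g _ ->]] := yL; rewrite wact.
  apply/val_inj => /=; have := hz z zz; have := ltn_ord (w z).
  rewrite [X in (_ < X)%N](Zp_cast p1) => lt /dvdnP [[|j] e]; first by rewrite e.
  by move: lt; rewrite e mulSn ltnNge leq_addr.
move=> y yy; have := congr1 (fun f => f y) f00; rewrite /f0 yy => h.
have := congr1 (@nat_of_ord _) h; rewrite Zp_nat /= [X in (_ %% X)%N](Zp_cast p1).
by move=> /eqP.
Qed.

Lemma locally_permutation : exists Y : set V,
  [/\ Y `<=` C, forall g y, Y y -> Y (act g y),
      forall v, C v -> exists (s : seq V) (c : V -> nat),
        [/\ uniq s, forall y, y \in s -> Y y & v = \sum_(y <- s) y *+ c y] &
      forall (s : seq V) (c : V -> nat), uniq s -> (forall y, y \in s -> Y y) ->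
        \sum_(y <- s) y *+ c y = 0 -> forall y, y \in s -> (p %| c y)%N].
Proof.
exists Y; split; [exact: YC|exact: Yact| |exact: Y_indep].
by move=> v Cv; exact: (span_comb pp pV (spanY Cv)).
Qed.

End LocallyPermutation.

(** * Divisibility and reduction in Z/p^(N+1) *)

Section Zpower.
Variables (p N : nat).
Hypothesis pp : prime p.
Local Notation R := 'Z_(p ^ N.+1).

Let M_gt1 : (1 < p ^ N.+1)%N.
Proof. by rewrite -(exp1n N.+1) ltn_exp2r // prime_gt1. Qed.

Definition pdv (j : nat) (r : R) := exists s : R, r = s *+ p ^ j.

Definition redp (r : R) : 'Z_p := (nat_of_ord r)%:R.

Lemma ZpE (r : R) : r = (nat_of_ord r)%:R.
Proof. by rewrite natr_Zp. Qed.

Lemma Zp_nat0 n : ((n%:R : R) == 0) = (p ^ N.+1 %| n)%N.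
Proof.
rewrite -val_eqE /= Zp_nat /= [X in (_ %% X)%N](Zp_cast M_gt1) //.
Qed.

Lemma Zp_natp0 n : ((n%:R : 'Z_p) == 0) = (p %| n)%N.
Proof. by rewrite -val_eqE /= Zp_nat /= [X in (_ %% X)%N](Zp_cast (prime_gt1 pp)). Qed.

Lemma val_natr n : (n%:R : R) = (n %% p ^ N.+1)%N :> nat.
Proof. by rewrite Zp_nat /= [X in (_ %% X)%N](Zp_cast M_gt1). Qed.

Lemma mulrn_val (r : R) n : r *+ n = (nat_of_ord r * n)%N%:R.
Proof. by rewrite {1}(ZpE r) -mulrnA. Qed.

Lemma redp_nat n : redp n%:R = n%:R.
Proof.
apply/eqP; rewrite /redp -subr_eq0 val_natr.
rewrite [X in _ - X%:R](divn_eq n (p ^ N.+1)) natrD opprD addrCA subrr addr0.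
by rewrite oppr_eq0 Zp_natp0 expnS mulnCA dvdn_mulr.
Qed.

Lemma redpD r s : redp (r + s) = redp r + redp s.
Proof. by rewrite (ZpE r) (ZpE s) -natrD !redp_nat natrD. Qed.

Lemma redpM r s : redp (r * s) = redp r * redp s.
Proof. by rewrite (ZpE r) (ZpE s) -natrM !redp_nat natrM. Qed.

Lemma redp0 : redp 0 = 0. Proof. by rewrite -[0 in LHS]/(0%:R) redp_nat. Qed.
Lemma redp1 : redp 1 = 1. Proof. by rewrite -[1 in LHS]/(1%:R) redp_nat. Qed.

Lemma redpN r : redp (- r) = - redp r.
Proof. by apply: (addrI (redp r)); rewrite -redpD !subrr redp0. Qed.

Lemma redpMn r n : redp (r *+ n) = redp r *+ n.
Proof. by elim: n => [|n IHn]; rewrite ?mulr0n ?redp0 // !mulrS redpD IHn. Qed.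

Lemma redp_sum I (s : seq I) (P : pred I) (F : I -> R) :
  redp (\sum_(i <- s | P i) F i) = \sum_(i <- s | P i) redp (F i).
Proof. by elim/big_rec2: _ => [|i u v _ <-]; rewrite ?redp0 ?redpD. Qed.

Lemma Zp_eq0 (r : R) : r = 0 <-> (p ^ N.+1 %| r)%N.
Proof. by rewrite {1}(ZpE r) -Zp_nat0; split=> [->|/eqP]. Qed.

Lemma pdvP j (r : R) : (j <= N.+1)%N -> pdv j r <-> (p ^ j %| r)%N.
Proof.
move=> jN; split=> [[s ->]|/dvdnP [k e]].
  rewrite mulrn_val val_natr /dvdn modn_dvdm ?dvdn_exp2l // modnMl //.
by exists k%:R; rewrite -mulrnA -e natr_Zp.
Qed.

Lemma pdv_top (r : R) : pdv N.+1 r <-> r = 0.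
Proof. by rewrite pdvP // Zp_eq0. Qed.

Lemma pdv0 j : pdv j 0. Proof. by exists 0; rewrite mul0rn. Qed.

Lemma pdvD j r s : pdv j r -> pdv j s -> pdv j (r + s).
Proof. by move=> [u ->] [v ->]; exists (u + v); rewrite mulrnDl. Qed.

Lemma pdvN j r : pdv j r -> pdv j (- r).
Proof. by move=> [u ->]; exists (- u); rewrite mulNrn. Qed.

Lemma pdvB j r s : pdv j r -> pdv j s -> pdv j (r - s).
Proof. by move=> h1 h2; apply: pdvD => //; exact: pdvN. Qed.

Lemma pdvM j r s : pdv j s -> pdv j (r * s).
Proof. by move=> [u ->]; exists (r * u); rewrite mulrnAr. Qed.

Lemma pdv_le j k r : (j <= k)%N -> pdv k r -> pdv j r.
Proof. by move=> jk [s ->]; exists (s *+ p ^ (k - j)); rewrite -mulrnA -expnD subnK. Qed.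

Lemma pdv_sum j I (s : seq I) (P : pred I) (F : I -> R) :
  (forall i, P i -> pdv j (F i)) -> pdv j (\sum_(i <- s | P i) F i).
Proof. by move=> h; elim/big_ind: _ => //; [exact: pdv0|exact: pdvD]. Qed.

(** Division by p^k costs k powers of p; this is the loss of precision in each averaging step. *)
Lemma pdv_div j k r : (k <= j <= N.+1)%N -> pdv j (r *+ p ^ k) -> pdv (j - k) r.
Proof.
move=> /andP [kj jN]; have pk0 : (0 < p ^ k)%N by rewrite expn_gt0 prime_gt0.
rewrite !pdvP //; last by lia.
rewrite mulrn_val val_natr {1}/dvdn modn_dvdm ?dvdn_exp2l // -/(dvdn _ _).
by rewrite -{1}(subnK kj) expnD dvdn_pmul2r.
Qed.

Lemma redp_eq0 r : redp r = 0 <-> pdv 1 r.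
Proof.
rewrite pdvP // expn1; split=> [/eqP|h]; first by rewrite Zp_natp0.
by apply/eqP; rewrite Zp_natp0.
Qed.

Lemma unit_mod r : redp r <> 0 -> exists n, r *+ n = 1.
Proof.
move=> h; have nd : ~~ (p %| r)%N by apply/negP => d; apply: h; apply/redp_eq0; rewrite pdvP // expn1.
have r0 : (0 < r)%N by case: (nat_of_ord r) nd => //; rewrite dvdn0.
have : coprime r (p ^ N.+1) by rewrite coprime_sym coprimeXl // prime_coprime.
move=> /(coprimeP _ r0) [[m k] /= e]; exists m.
have {}e : (r * m)%N = (1 + k * p ^ N.+1)%N by lia.
apply/eqP; rewrite mulrn_val e natrD -subr_eq0 addrAC subrr add0r.
by rewrite Zp_nat0 dvdn_mull.
Qed.

End Zpower.

(** * Words and products of noncommutative power series *)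

Section Words.
Variables (Y : eqType) (R : comNzRingType).
Implicit Types (u v w : seq Y) (f g h : seq Y -> R).

(* The factorizations w = u v with v nonempty. *)
Fixpoint psplits w : seq (seq Y * seq Y) :=
  if w is y :: w' then ([::], w) :: [seq (y :: s.1, s.2) | s <- psplits w'] else [::].

(** The coefficient of w in the product of two power series with coefficients f and g. The
    factorization with empty second factor is set apart, since [psplits] omits it. *)
Definition conv f g w : R := f w * g [::] + \sum_(s <- psplits w) f s.1 * g s.2.

Lemma conv_cons f g y w :
  conv f g (y :: w) = f [::] * g (y :: w) + conv (fun v => f (y :: v)) g w.
Proof. by rewrite /conv /= big_cons big_map addrCA. Qed.

Lemma conv_nil f g : conv f g [::] = f [::] * g [::].
Proof. by rewrite /conv big_nil addr0. Qed.

Lemma convDl f f' g w : conv (fun v => f v + f' v) g w = conv f g w + conv f' g w.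
Proof.
rewrite /conv mulrDl addrACA -big_split; congr (_ + _).
by apply: eq_bigr => s _; rewrite mulrDl.
Qed.

Lemma convZl a f g w : conv (fun v => a * f v) g w = a * conv f g w.
Proof. by rewrite /conv mulrDr mulrA mulr_sumr; congr (_ + _); apply: eq_bigr => s _; rewrite mulrA. Qed.

Lemma eq_conv w f f' g g' :
  (forall v, (size v <= size w)%N -> {subset v <= w} -> f v = f' v) ->
  (forall v, (size v <= size w)%N -> {subset v <= w} -> g v = g' v) ->
  conv f g w = conv f' g' w.
Proof.
elim: w f f' => [|y w IHw] f f' hf hg; first by rewrite !conv_nil hf ?hg.
rewrite !conv_cons hf // hg //; congr (_ + _); apply: IHw => v sv vw.
  apply: hf => // x; rewrite !inE => /orP [->//|/vw ->]; exact: orbT.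
apply: hg => [|x /vw]; first exact: leqW.
by rewrite inE => ->; rewrite orbT.
Qed.

Lemma convA f g h w : conv (conv f g) h w = conv f (conv g h) w.
Proof.
elim: w f => [|y w IHw] f; first by rewrite !conv_nil mulrA.
rewrite conv_cons conv_nil [RHS]conv_cons [conv g h (y :: w)]conv_cons -IHw mulrDr mulrA.
rewrite -!addrA; congr (_ + _); rewrite -convZl -convDl.
by apply: eq_conv => // v _ _; rewrite conv_cons.
Qed.

Lemma psplits_cat w s : s \in psplits w -> w = s.1 ++ s.2 /\ s.2 != [::].
Proof.
elim: w s => //= y w IHw s; rewrite inE => /orP [/eqP ->//|/mapP [s' /IHw [e ne] ->] /=].
by rewrite -e.
Qed.

Lemma psplits_size w s : s \in psplits w -> (size s.1 < size w)%N.
Proof.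
move=> /psplits_cat [-> ne]; rewrite size_cat -addn1 leq_add2l.
by case: s.2 ne.
Qed.

Lemma psplits_subset w s : s \in psplits w -> {subset s.1 <= w} /\ {subset s.2 <= w}.
Proof. by move=> /psplits_cat [-> _]; split=> x h; rewrite mem_cat h ?orbT. Qed.

Lemma sum_psplits w u (F : seq Y -> R) :
  \sum_(s <- psplits w | s.1 == u) F s.2 =
  if prefix u w && (size u < size w)%N then F (drop (size u) w) else 0.
Proof.
elim: w u => [|y w IHw] u; first by rewrite big_nil andbF.
rewrite /= big_cons big_map /=; case: u => [|x u] /=.
  by rewrite big1 ?addr0.
rewrite (eq_bigl (fun s => (x == y) && (s.1 == u))); last first.
  by move=> s; rewrite eqseq_cons eq_sym.
case: (x == y) => /=; first by rewrite IHw ltnS.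
by rewrite big_pred0_eq.
Qed.

End Words.

(** * Characters and Magnus coefficients *)

Definition addhom (F : topGroupType) (V : zmodType) (psi : F -> V) :=
  forall x y, psi (x * y)%g = psi x + psi y.

Section AddHom.
Variables (F : topGroupType) (V : zmodType) (psi : F -> V).
Hypothesis hpsi : addhom psi.

Lemma addhom1 : psi 1%g = 0.
Proof. by apply: (addrI (psi 1%g)); rewrite -hpsi mulg1 addr0. Qed.

Lemma addhomV x : psi x^-1%g = - psi x.
Proof. by apply: (addrI (psi x)); rewrite -hpsi mulgV addhom1 subrr. Qed.

Lemma addhomX x n : psi (x ^+ n)%g = psi x *+ n.
Proof. by elim: n => [|n IHn]; rewrite ?expg0 ?addhom1 // expgS hpsi IHn mulrS. Qed.

Lemma addhom_prod (I : Type) (s : seq I) (P : pred I) (G : I -> F) :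
  psi (\prod_(i <- s | P i) G i)%g = \sum_(i <- s | P i) psi (G i).
Proof. by elim/big_rec2: _ => [|i u v _ <-]; rewrite ?addhom1. Qed.

End AddHom.

Lemma addhom_sum (F : topGroupType) (V : zmodType) (I : Type) (s : seq I) (f : I -> F -> V) :
  (forall i, addhom (f i)) -> addhom (fun x => \sum_(i <- s) f i x).
Proof. by move=> h x y; rewrite -big_split; apply: eq_bigr => i _; exact: h. Qed.

Lemma addhomMn (F : topGroupType) (V : zmodType) (f : F -> V) n :
  addhom f -> addhom (fun x => f x *+ n).
Proof. by move=> h x y; rewrite h mulrnDl. Qed.

Lemma addhomB (F : topGroupType) (V : zmodType) (f g : F -> V) :
  addhom f -> addhom g -> addhom (fun x => f x - g x).
Proof. by move=> hf hg x y; rewrite hf hg opprD addrACA. Qed.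

(* A compatible system of homomorphisms to Z/p^(N+1), reducing modulo p to a
   basis of Hom(F, F_p). *)
Section Characters.
Variables (p : nat) (F : topGroupType) (Y : eqType).
Hypothesis pp : prime p.
Variable chi : forall N, Y -> F -> 'Z_(p ^ N.+1).
Variable chi0 : Y -> F -> 'Z_p.
Hypothesis chiM : forall N y, addhom (chi N y).
Hypothesis chi_lc : forall N y, lc (chi N y).
Hypothesis chi_red : forall N y x, redp (chi N y x) = chi0 y x.
Hypothesis chi_indep : forall (ys : seq Y) (c : Y -> nat), uniq ys ->
  (forall x, \sum_(y <- ys) chi0 y x *+ c y = 0) -> forall y, y \in ys -> (p %| c y)%N.
Hypothesis chi_span : forall psi : F -> 'Z_p, addhom psi -> lc psi ->
  exists (ys : seq Y) (c : Y -> nat), forall x, psi x = \sum_(y <- ys) chi0 y x *+ c y.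

Lemma chi0M y : addhom (chi0 y).
Proof. by move=> x x'; rewrite -!(chi_red 0) chiM redpD. Qed.

(** Gaussian elimination. The map [k] makes the earlier characters vanish. If chi y0 were 0 modulo p
    on all values of [k], the [chi0] would be dependent; so it takes a unit as value, which a power
    normalizes to 1, and the earlier elements are corrected by powers of the new one. *)
Lemma dual_elements N (ys : seq Y) : uniq ys ->
  exists h : Y -> F, forall y y', y \in ys -> y' \in ys -> chi N y' (h y) = (y' == y)%:R.
Proof.
elim: ys => [|y0 ys IHys]; first by exists (fun=> 1%g).
move=> /= /andP [ny0 uys]; have [h hP] := IHys uys.
have p1 := prime_gt1 pp.
pose k f : F := (f * \prod_(y <- ys) (h y) ^+ nat_of_ord (- chi N y f))%g.
have chik y f : chi N y (k f) = chi N y f - \sum_(y' <- ys) chi N y' f * chi N y (h y').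
  rewrite /k chiM (addhom_prod (chiM N y)) -sumrN; congr (_ + _); apply: eq_bigr => y' _.
  by rewrite (addhomX (chiM N y)) -mulr_natl natr_Zp mulNr.
have k0 y f : y \in ys -> chi N y (k f) = 0.
  move=> yy; rewrite chik (bigD1_seq y) //= hP // eqxx mulr1.
  rewrite big_seq_cond big1 ?addr0 ?subrr // => y' /andP [y'y ne].
  by rewrite hP // eq_sym (negPf ne) mulr0.
have [f nf] : exists f, redp (chi N y0 (k f)) <> 0.
  apply: contrapT => /forallNP nf.
  pose c y := if y == y0 then 1%N else nat_of_ord (- chi0 y0 (h y)).
  suff : (p %| c y0)%N by rewrite /c eqxx dvdn1 => /eqP e; rewrite e in p1.
  have uys0 : uniq (y0 :: ys) by rewrite /= ny0.
  apply: (chi_indep uys0 _ (mem_head _ _)) => x.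
  have : redp (chi N y0 (k x)) = 0 by apply: contrapT; exact: nf.
  rewrite chik redpD // redpN // redp_sum // chi_red => e.
  rewrite -[RHS]e big_cons {1}/c eqxx mulr1n -sumrN; congr (_ + _).
  apply: eq_big_seq => y yy; rewrite redpM // !chi_red /c ifN; last first.
    by apply: contraNneq ny0 => <-.
  by rewrite -mulr_natr natr_Zp mulrN.
have [n hn] := unit_mod pp nf.
pose g := (k f ^+ n)%g.
have g1 : chi N y0 g = 1 by rewrite (addhomX (chiM N y0)).
have g0 y : y \in ys -> chi N y g = 0.
  by move=> yy; rewrite (addhomX (chiM N y)) k0 // mul0rn.
exists (fun y => if y == y0 then g else (h y * g ^+ nat_of_ord (- chi N y0 (h y)))%g).
have ne y : y \in ys -> (y == y0) = false.
  by move=> yy; apply/negbTE; apply: contraNneq ny0 => <-.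
move=> y y'; rewrite !inE => /orP [/eqP->|yy] /orP [/eqP->|yy'].
- by rewrite !eqxx.
- by rewrite eqxx g0 // (ne y').
- rewrite (ne y) // chiM (addhomX (chiM N y0)) g1 eq_sym (ne y) //.
  by rewrite natr_Zp subrr.
- rewrite (ne y) // chiM (addhomX (chiM N y')) g0 // mul0rn addr0.
  exact: hP.
Qed.

(** Successive approximation: a homomorphism with values divisible by p^i, once divided by p^i, is
    well defined modulo p, hence a combination of the [chi0]; subtracting p^i times the same
    combination of the [chi N] gains one power of p. *)
Lemma chi_spanN N (psi : F -> 'Z_(p ^ N.+1)) : addhom psi -> lc psi ->
  exists (ys : seq Y) (c : Y -> nat), forall x, psi x = \sum_(y <- ys) chi N y x *+ c y.
Proof.
suff main j : (j <= N.+1)%N -> forall phi : F -> 'Z_(p ^ N.+1), addhom phi -> lc phi ->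
    (forall x, pdv (N.+1 - j) (phi x)) ->
    exists (l : seq (Y * nat)), forall x, phi x = \sum_(yc <- l) chi N yc.1 x *+ yc.2.
  move=> hpsi lpsi; have [|l hl] := main N.+1 (leqnn _) psi hpsi lpsi.
    by move=> x; rewrite subnn; exists (psi x); rewrite expn0 mulr1n.
  exists (undup (map fst l)), (fun y => \sum_(yc <- l | yc.1 == y) yc.2)%N => x.
  rewrite hl; transitivity (\sum_(y <- undup (map fst l)) \sum_(yc <- l | yc.1 == y) chi N yc.1 x *+ yc.2).
    rewrite (exchange_big_dep xpredT) //= big_seq [RHS]big_seq; apply: eq_bigr => yc ycl.
    rewrite (eq_bigl (fun y => y == yc.1)); last by move=> y; rewrite eq_sym.
    rewrite -big_filter filter_pred1_uniq ?undup_uniq ?big_seq1 //.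
    by rewrite mem_undup map_f.
  apply: eq_bigr => y _; rewrite -sumrMnr; apply: eq_bigr => yc /eqP -> //.
elim: j => [_|j IHj jN] phi hphi lphi phid.
  exists [::] => x; rewrite big_nil; apply/(pdv_top pp); have := phid x; by rewrite subn0.
set i := (N.+1 - j.+1)%N in phid.
have /choice [q qP] := phid.
have qred (r : 'Z_(p ^ N.+1)) : r *+ p ^ i = 0 -> redp r = 0.
  move=> r0; apply/(redp_eq0 pp); have : pdv (N.+1 - i) r.
    apply: (pdv_div pp); first by rewrite leqnn andbT /i leq_subr.
    by rewrite r0; exact: pdv0.
  by apply: pdv_le; rewrite /i; lia.
have qM : addhom (fun x => redp (q x)).
  move=> x y; apply/eqP; rewrite -subr_eq0 -redpD // -redpN // -redpD //; apply/eqP.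
  by apply: qred; rewrite mulrnBl mulrnDl -!qP hphi subrr.
have [|ys [c hc]] := chi_span qM.
  have [W [oW hW]] := lphi; exists W; split=> // x w Ww.
  apply/eqP; rewrite -subr_eq0 -redpN // -redpD //; apply/eqP.
  by apply: qred; rewrite mulrnBl -!qP hW // subrr.
pose phi' x := phi x - \sum_(y <- ys) chi N y x *+ (c y * p ^ i).
have [||||l hl] := IHj _ phi'.
- exact: ltnW.
- apply: addhomB => //; apply: addhom_sum => y; exact: addhomMn.
- apply: (@lc_op _ _ _ _ (fun a b => a - b) _ _ lphi).
  by apply: lc_sum => y _; exact: (lc_comp (fun r => r *+ (c y * p ^ i)) (chi_lc N y)).
- move=> x; have : redp (q x - \sum_(y <- ys) chi N y x *+ c y) = 0.
    rewrite redpD // redpN // redp_sum // hc; apply/eqP; rewrite subr_eq0; apply/eqP.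
    by apply: eq_bigr => y _; rewrite redpMn // chi_red.
  move=> /(redp_eq0 pp) [s hs]; exists s; rewrite /phi' qP.
  have -> : \sum_(y <- ys) chi N y x *+ (c y * p ^ i) = (\sum_(y <- ys) chi N y x *+ c y) *+ p ^ i.
    by rewrite -sumrMnl; apply: eq_bigr => y _; rewrite mulrnA.
  rewrite -mulrnBl hs -mulrnA -expnD; congr (_ *+ p ^ _); rewrite /i; lia.
exists ([seq (y, (c y * p ^ i)%N) | y <- ys] ++ l) => x.
rewrite big_cat big_map /= -hl /phi' addrC subrK //.
Qed.

End Characters.

Section Twist.
Variables (Q : finGroupType) (A : finZmodType) (c : Q -> Q -> A).

(** Normalized 2-cocycles for the trivial action of Q on A. *)
Definition is_cocycle := [/\ forall a, c 1%g a = 0, forall a, c a 1%g = 0 &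
  forall a b d, c a b + c (a * b)%g d = c b d + c a (b * d)%g].

Hypothesis hc : is_cocycle.

(* The phantom argument makes the cocycle condition available to the group instance. *)
Definition twist of is_cocycle : Type := (Q * A)%type.
HB.instance Definition _ := Finite.copy (twist hc) (Q * A)%type.
Local Notation T := (twist hc).

Definition twist_mul (x y : T) : T := ((x.1 * y.1)%g, x.2 + y.2 + c x.1 y.1).
Definition twist_one : T := (1%g, 0).
Definition twist_inv (x : T) : T := (x.1^-1%g, - x.2 - c x.1^-1%g x.1).

Lemma twist_mulA : associative twist_mul.
Proof.
have [_ _ hA] := hc; move=> [a r] [b s] [d t]; congr pair; rewrite /= ?mulgA //.
by rewrite !addrA [r + s + c a b + t]addrAC -[LHS]addrA -[RHS]addrA hA.
Qed.

Lemma twist_mul1 : left_id twist_one twist_mul.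
Proof. by have [h _ _] := hc; move=> [a r]; rewrite /twist_mul /= mul1g h add0r addr0. Qed.

Lemma twist_1mul : right_id twist_one twist_mul.
Proof. by have [_ h _] := hc; move=> [a r]; rewrite /twist_mul /= mulg1 h !addr0. Qed.

Lemma twist_mulV : left_inverse twist_one twist_inv twist_mul.
Proof.
case=> a r; rewrite /twist_mul /twist_inv /= mulVg; congr pair.
by rewrite [_ - _ + r]addrAC addNr sub0r addNr.
Qed.

Lemma twist_Vmul : right_inverse twist_one twist_inv twist_mul.
Proof.
have [h1 h2 hA] := hc; move=> [a r]; rewrite /twist_mul /twist_inv /= mulgV; congr pair.
have := hA a a^-1%g a; rewrite mulgV mulVg h1 h2 !addr0 => ->.
by rewrite addrA subrr sub0r addNr.
Qed.

HB.instance Definition _ := isGroup.Build T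
  twist_mulA twist_mul1 twist_1mul twist_mulV twist_Vmul.

Lemma twist_pgroup (p : nat) : prime p ->
  (p.-group [set: Q]%SET)%g -> (p.-nat #|{: A}|)%N -> (p.-group [set: T]%SET)%g.
Proof.
move=> pp pQ pA; rewrite /pgroup cardsT.
by rewrite [#|_|](card_prod Q A) pnatM pA andbT -cardsT.
Qed.

End Twist.

Section Magnus.
Variables (p : nat) (F : topGroupType).
Hypotheses (pp : prime p) (ppF : pro_p_group p F).
Hypothesis liftF : forall (E Q : finGroupType) (f : E -> Q) (q : F -> Q),
  {morph f : x y / (x * y)%g} -> (forall y, exists x, f x = y) ->
  (p.-group [set: E]%SET)%g -> (p.-group [set: Q]%SET)%g ->
  {morph q : x y / (x * y)%g} -> lc q ->
  exists e : F -> E, [/\ {morph e : x y / (x * y)%g}, lc e & forall x, f (e x) = q x].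
Variables (N : nat) (Y : eqType).
Local Notation R := 'Z_(p ^ N.+1).
Variable chi : Y -> F -> R.
Hypotheses (chiM : forall y, addhom (chi y)) (chi_lc : forall y, lc (chi y)).
Implicit Types (m : seq Y -> F -> R) (u v w : seq Y).

Let pR : (p.-nat #|{: R}|)%N.
Proof. by rewrite card_ord Zp_cast ?pnatX ?pnat_id // -(exp1n N.+1) ltn_exp2r // prime_gt1. Qed.

Lemma lc_words m k w : (forall v, (size v <= k)%N -> lc (m v)) ->
  exists W, onormal W /\ forall v, (size v <= k)%N -> {subset v <= w} ->
    forall x z, W z -> m v (x * z)%g = m v x.
Proof.
elim: k m => [|k IHk] m lm.
  have [W [oW hW]] := lm [::] isT; exists W; split=> // v; rewrite leqn0 size_eq0 => /eqP -> _.
  exact: hW.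
have [W0 [oW0 hW0]] := lm [::] isT.
have [W1 [oW1 hW1]] : exists W, onormal W /\ forall y v, y \in w -> (size v <= k)%N ->
    {subset v <= w} -> forall x z, W z -> m (y :: v) (x * z)%g = m (y :: v) x.
  suff h (s : seq Y) : {subset s <= w} -> exists W, onormal W /\ forall y v, y \in s -> (size v <= k)%N ->
    {subset v <= w} -> forall x z, W z -> m (y :: v) (x * z)%g = m (y :: v) x by exact: h.
  elim: s => [_|y s IHs sw]; first by exists setT; split=> //; exact: onormalT.
  have [|W [oW hW]] := IHs; first by move=> z zs; apply: sw; rewrite inE zs orbT.
  have [|W' [oW' hW']] := IHk (fun v => m (y :: v)); first by move=> v sv; exact: lm.
  exists (W `&` W'); split; first exact: onormalI.
  move=> z v; rewrite inE => /orP [/eqP->|zs] sv vw x u [Wu W'u]; first exact: hW'.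
  exact: hW.
exists (W0 `&` W1); split; first exact: onormalI.
move=> [_ _ x u [W0u _]|y v sv vw x u [_ W1u]]; first exact: hW0.
apply: hW1 => //; first by apply: vw; rewrite inE eqxx.
by move=> z zv; apply: vw; rewrite inE zv orbT.
Qed.

(* [m w x] is the coefficient of [w] in a Magnus expansion of [x]: a multiplicative
   map to noncommutative power series in Y, truncated at degree n. *)
Definition comul n m := [/\ forall x, m [::] x = 1, forall y x, m [:: y] x = chi y x &
  forall w, (size w <= n)%N -> lc (m w) /\
    forall x h, m w (x * h)%g = conv (m^~ x) (m^~ h) w].

Lemma conv_ends (f g : seq Y -> R) y w : conv f g (y :: w) =
  f [::] * g (y :: w) + f (y :: w) * g [::] + \sum_(s <- psplits w) f (y :: s.1) * g s.2.
Proof. by rewrite conv_cons /conv addrA. Qed.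

Lemma comul_1 n m w : comul n m -> (size w <= n)%N -> w != [::] -> m w 1%g = 0.
Proof.
move=> [m1 _ mM]; move: {2}(size w) (leqnn (size w)) => k.
elim: k w => [|k IHk] [|y w] //= sk sn _.
have [_ h] := mM (y :: w) sn; have := h 1%g 1%g; rewrite mulg1 conv_ends m1 mul1r mulr1.
rewrite big_seq big1 ?addr0 => [|s sw]; first by move/eqP; rewrite -subr_eq0 opprD addNKr oppr_eq0 => /eqP.
have := psplits_size sw => lt; rewrite IHk ?mul0r //=.
  exact: leq_trans lt sk.
by apply: leq_trans sn; exact: ltnW.
Qed.

(** The coefficients at shorter words in the letters of w factor through a finite p-quotient. There
    the mixed terms of the product formula at w form a 2-cocycle, by associativity of [conv]. The
    quotient map lifts to the central extension of this cocycle because F is free, and the second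
    coordinate of the lift is the missing coefficient. *)
Lemma magnus_step n m w : comul n m -> size w = n.+1 ->
  exists mw : F -> R, lc mw /\ forall x h, mw (x * h)%g = mw x + mw h +
    conv (fun v => if (size v <= n)%N then m v x else 0)
         (fun v => if (size v <= n)%N then m v h else 0) w.
Proof.
move=> cm sw; have [m1 _ mM] := cm.
have [W [oW hW]] := @lc_words m n w (fun v sv => (mM v sv).1).
have [t [q [qM qS qP pQ]]] := pro_p_quotient pp ppF oW.
have /choice [r rK] := qS.
(* Truncation gives w itself the coefficient 0, so that [c] consists of the mixed terms only. *)
pose m' x v := if (size v <= n)%N then m v x else 0.
pose T a := m' (r a).
have m'q x v : {subset v <= w} -> T (q x) v = m' x v.
  move=> vw; rewrite /T /m'; case: ifP => // sv.
  have /qP Wx : q (r (q x)) = q x by rewrite rK.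
  by rewrite -[in RHS](mulKVg (r (q x)) x) hW.
pose c a b : R := conv (T a) (T b) w.
have m'nil x : m' x [::] = 1 by rewrite /m' m1.
have m'w x : m' x w = 0 by rewrite /m' sw ltnn.
have Tw a : T a w = 0 by exact: m'w.
have Tn a : T a [::] = 1 by exact: m'nil.
have T1 v : v != [::] -> {subset v <= w} -> T 1%g v = 0.
  move=> nv vw; rewrite -(morph1_grp qM) m'q // /m'; case: ifP => // sv.
  exact: comul_1 cm sv nv.
have TM a b v : (size v <= n)%N -> {subset v <= w} -> T (a * b)%g v = conv (T a) (T b) v.
  move=> sv vw; rewrite -{1}(rK a) -{1}(rK b) -qM m'q // /m' sv (mM v sv).2.
  by apply: eq_conv => v' sv' _; rewrite /T /m' (leq_trans sv' sv).
have [y [w' ew]] : exists y w', w = y :: w' by case: (w) sw => // y w' _; exists y, w'.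
have hc : is_cocycle c.
  split=> [a|a|a b d].
  - rewrite /c ew conv_ends -ew Tw mulr0 add0r T1 // ?mul0r ?add0r; last by rewrite ew.
    rewrite big_seq big1 // => s sw'; rewrite T1 ?mul0r //.
    have [h _] := psplits_subset sw'; move=> z; rewrite ew !inE => /orP [->//|/h ->]; exact: orbT.
  - rewrite /c /conv Tw mul0r add0r big_seq big1 // => s sw'.
    have [h1 h2] := psplits_cat sw'; have [_ h3] := psplits_subset sw'.
    by rewrite T1 ?mulr0.
  (* [T] is multiplicative in degrees at most n and fails at w exactly by [c]; hence the two
     bracketings of a triple product give the two sides of the cocycle identity. *)
  - have e1 : c (a * b)%g d = conv (conv (T a) (T b)) (T d) w - c a b.
      rewrite /c [conv (T (a * b)%g) _ _]/conv [conv (conv _ _) _ _]/conv Tw mul0r add0r Tn mulr1.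
      rewrite addrAC subrr add0r.
      rewrite big_seq [RHS]big_seq; apply: eq_bigr => s sw'; rewrite TM //.
        by have := psplits_size sw'; rewrite sw.
      by have [] := psplits_subset sw'.
    have e2 : c a (b * d)%g = conv (T a) (conv (T b) (T d)) w - c b d.
      have cE f g : conv f g w = f [::] * g w + conv (fun v => f (y :: v)) g w'.
        by rewrite {1}ew conv_cons -ew.
      rewrite /c [conv (T a) (T _) w]cE [conv (T a) (conv _ _) w]cE Tn !mul1r Tw add0r.
      rewrite addrAC subrr add0r; apply: eq_conv => // v sv vw'.
      rewrite TM //; first by move: sv sw; rewrite ew /= => h [<-].
      by move=> z /vw'; rewrite ew inE => ->; rewrite orbT.
    by rewrite e1 e2 convA addrC subrK addrC subrK.
have [|||e [eM le eq]] := @liftF (twist hc) (fcar t) fst q _ _ (twist_pgroup hc pp pQ pR) pQ qM.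
- by [].
- by move=> a; exists (a, 0).
- exact: lc_of_quotient oW qP.
exists (snd \o e); split; first exact: lc_comp.
move=> x h; rewrite /= eM /= !eq; congr (_ + _).
by apply: eq_conv => v _ vw; rewrite -/(m' _ _) m'q.
Qed.

Lemma magnus_exists n : exists m, comul n.+1 m.
Proof.
elim: n => [|n [m cm]].
  exists (fun w x => if w is [:: y] then chi y x else if w is [::] then 1 else 0).
  split=> // -[|y [|//]] _.
    by split; [exact: lc_cst|move=> x h; rewrite conv_nil mulr1].
  split=> [//|x h]; rewrite conv_ends big_nil addr0 mul1r mulr1 chiM addrC //.
have [m1 my mM] := cm.
have /choice [mw hmw] : forall w, exists mw : F -> R, size w = n.+2 -> lc mw /\
    forall x h, mw (x * h)%g = mw x + mw h +
    conv (fun v => if (size v <= n.+1)%N then m v x else 0)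
         (fun v => if (size v <= n.+1)%N then m v h else 0) w.
  move=> w; have [sw|nsw] := pselect (size w = n.+2); last by exists (fun=> 0) => /nsw.
  by have [mw h] := magnus_step cm sw; exists mw.
exists (fun w => if (size w <= n.+1)%N then m w else mw w); split=> // w sw.
case: ifP => [sw1|/negbT]; last rewrite -ltnNge => sw1.
  split=> [|x h]; first exact: (mM w sw1).1.
  by rewrite (mM w sw1).2; apply: eq_conv => v sv _; rewrite (leq_trans sv sw1).
have sw2 : size w = n.+2 by lia.
have [lw hw] := hmw w sw2; split=> // x h; rewrite hw.
case: w sw {sw1} sw2 {lw hw} => // y w sw sw2.
rewrite !conv_ends sw2 !ltnn /= !m1 !mul0r !mulr0 !mul1r !mulr1 !add0r addrAC -addrA [mw _ h + _]addrC addrA addrC.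
rewrite addrCA addrA; congr (_ + _).
rewrite big_seq [RHS]big_seq; apply: eq_bigr => s sw'.
have h1 := psplits_size sw'; have [h2 _] := psplits_cat sw'.
have : (size (s.1 ++ s.2) <= n.+1)%N by rewrite -h2; move: sw2 => /= [->].
rewrite size_cat => h3; have e : size w = n.+1 by case: sw2.
have a1 : (size s.1 < n.+1)%N by lia.
have a2 : (size s.2 <= n.+1)%N by lia.
by rewrite a1 a2.
Qed.

End Magnus.

(** * Polynomial functions and invariant functionals *)

Section Polynomial.
Variables (p : nat) (F : topGroupType).
Hypotheses (pp : prime p) (ppF : pro_p_group p F).
Variables (N n : nat) (Y : eqType).
Local Notation R := 'Z_(p ^ N.+1).
Variable chi : Y -> F -> R.
Hypotheses (chiM : forall y, addhom (chi y)) (chi_lc : forall y, lc (chi y)).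
Hypothesis chi_dual : forall ys : seq Y, uniq ys ->
  exists h : Y -> F, forall y y', y \in ys -> y' \in ys -> chi y' (h y) = (y' == y)%:R.
Hypothesis chi_spanN : forall psi : F -> R, addhom psi -> lc psi ->
  exists (ys : seq Y) (c : Y -> nat), forall x, psi x = \sum_(y <- ys) chi y x *+ c y.
Variable m : seq Y -> F -> R.
Hypothesis cm : comul chi n m.
Implicit Types (g : F -> R) (l : seq (R * seq Y)) (u v w : seq Y) (t : seq Y -> R).

Let m1 x : m [::] x = 1. Proof. by case: cm. Qed.
Let mchi y x : m [:: y] x = chi y x. Proof. by case: cm. Qed.
Let m_lc w : (size w <= n)%N -> lc (m w). Proof. by case: cm => _ _ h /h []. Qed.
Let mM w x h : (size w <= n)%N -> m w (x * h)%g = conv (m^~ x) (m^~ h) w.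
Proof. by case: cm => _ _ hm /hm []. Qed.

Definition shift (h : F) g : F -> R := fun x => g (x * h)%g - g x.

(* Functions killed by the k-th power of the augmentation ideal. *)
Fixpoint poly_lt (k : nat) g : Prop :=
  if k is k'.+1 then forall h, poly_lt k' (shift h g) else forall x, g x = 0.

Lemma poly_lt0 k : poly_lt k (fun=> 0).
Proof. by elim: k => //= k IHk h; have -> : shift h (fun=> 0) = (fun=> 0) by apply/funext => x; rewrite /shift subrr. Qed.

Lemma poly_ltD k g g' : poly_lt k g -> poly_lt k g' -> poly_lt k (fun x => g x + g' x).
Proof.
elim: k g g' => [|k IHk] g g' /= hg hg'; first by move=> x; rewrite hg hg' addr0.
move=> h; have -> : shift h (fun x => g x + g' x) = (fun x => shift h g x + shift h g' x).
  by apply/funext => x; rewrite /shift opprD addrACA.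
exact: IHk.
Qed.

Lemma poly_ltZ k a g : poly_lt k g -> poly_lt k (fun x => a * g x).
Proof.
elim: k g => [|k IHk] g /= hg; first by move=> x; rewrite hg mulr0.
move=> h; have -> : shift h (fun x => a * g x) = (fun x => a * shift h g x).
  by apply/funext => x; rewrite /shift mulrBr.
exact: IHk.
Qed.

Lemma poly_lt_sum k (I : eqType) (s : seq I) (G : I -> F -> R) :
  (forall i, i \in s -> poly_lt k (G i)) -> poly_lt k (fun x => \sum_(i <- s) G i x).
Proof.
elim: s => [_|i s IHs h].
  have -> : (fun x => \sum_(i <- [::]) G i x) = (fun=> 0) by apply/funext => x; rewrite big_nil.
  exact: poly_lt0.
have -> : (fun x => \sum_(j <- i :: s) G j x) = (fun x => G i x + \sum_(j <- s) G j x).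
  by apply/funext => x; rewrite big_cons.
apply: poly_ltD; first by apply: h; rewrite inE eqxx.
by apply: IHs => j js; apply: h; rewrite inE js orbT.
Qed.

Lemma poly_ltS k g : poly_lt k g -> poly_lt k.+1 g.
Proof. by elim: k g => [g /= h0 h x|k IHk g /= hg h]; [rewrite /shift !h0 subrr|exact: IHk]. Qed.

Lemma poly_lt_le k k' g : (k <= k')%N -> poly_lt k g -> poly_lt k' g.
Proof. by move=> /subnK <-; elim: (k' - k)%N => // i IHi /IHi; rewrite addSn; exact: poly_ltS. Qed.

(* A list of pairs (c, w) stands for the formal sum of the c w; [comb l] is the
   function obtained for w = m w, and [ell t l] the value for w = t w. *)
Definition comb l : F -> R := fun x => \sum_(cw <- l) cw.1 * m cw.2 x.
Definition wlt k l := forall cw, cw \in l -> (size cw.2 < k)%N.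
Definition cf l u : R := \sum_(cw <- l | cw.2 == u) cw.1.
Definition dlist l h : seq (R * seq Y) :=
  [seq (cw.1 * m s.2 h, s.1) | cw <- l, s <- psplits cw.2].
Definition negl l : seq (R * seq Y) := [seq (- cw.1, cw.2) | cw <- l].
Definition ell t l : R := \sum_(cw <- l) cw.1 * t cw.2.

Lemma ell_cat t l l' : ell t (l ++ l') = ell t l + ell t l'.
Proof. by rewrite /ell big_cat. Qed.
Lemma ell_neg t l : ell t (negl l) = - ell t l.
Proof. by rewrite /ell big_map -sumrN; apply: eq_bigr => cw _; rewrite mulNr. Qed.
Lemma combE l x : comb l x = ell (m^~ x) l. Proof. by []. Qed.
Lemma cf_cat l l' u : cf (l ++ l') u = cf l u + cf l' u.
Proof. by rewrite /cf big_cat. Qed.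
Lemma cf_neg l u : cf (negl l) u = - cf l u.
Proof. by rewrite /cf big_map sumrN. Qed.

Lemma wlt_cat k l l' : wlt k l -> wlt k l' -> wlt k (l ++ l').
Proof. by move=> h h' cw; rewrite mem_cat => /orP [/h|/h']. Qed.
Lemma wlt_neg k l : wlt k l -> wlt k (negl l).
Proof. by move=> h cw /mapP [cw' /h ? ->]. Qed.
Lemma wlt_le k k' l : (k <= k')%N -> wlt k l -> wlt k' l.
Proof. by move=> kk h cw /h lt; exact: leq_trans lt kk. Qed.

Lemma ell_cf t l : ell t l = \sum_(v <- undup (map snd l)) cf l v * t v.
Proof.
rewrite /ell; transitivity (\sum_(cw <- l) \sum_(v <- undup (map snd l) | cw.2 == v) cw.1 * t v).
  apply: eq_big_seq => cw cwl; rewrite (eq_bigl (fun v => v == cw.2)); last by move=> v; rewrite eq_sym.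
  by rewrite -big_filter filter_pred1_uniq ?undup_uniq ?big_seq1 // mem_undup map_f.
by rewrite (exchange_big_dep xpredT) //=; apply: eq_bigr => v _; rewrite mulr_suml.
Qed.

Lemma cf_out l u : u \notin map snd l -> cf l u = 0.
Proof.
move=> nu; rewrite /cf big_seq_cond big1 // => cw /andP [cwl /eqP e].
by case/negP: nu; rewrite -e; exact: map_f.
Qed.

Lemma ell_eq0 t l : (forall u, cf l u = 0) -> ell t l = 0.
Proof. by move=> h; rewrite ell_cf big1 // => v _; rewrite h mul0r. Qed.

Lemma wlt_dlist k l h : wlt k.+1 l -> wlt k (dlist l h).
Proof.
by move=> hl cw /allpairsPdep [cw' [s [/hl h1 /psplits_size h2 ->]]] /=; exact: leq_trans h2 h1.
Qed.

Lemma shift_comb l h : wlt n.+1 l -> shift h (comb l) = comb (dlist l h).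
Proof.
move=> hl; apply/funext => x; rewrite /shift /comb big_allpairs_dep /= -sumrB.
apply: eq_big_seq => cw /hl; rewrite ltnS => sw; rewrite mM // /conv m1 mulr1 mulrDr addrC addKr.
by rewrite mulr_sumr; apply: eq_bigr => s _; ring.
Qed.

Lemma poly_lt_comb k l : (k <= n.+1)%N -> wlt k l -> poly_lt k (comb l).
Proof.
elim: k l => [|k IHk] l kn hl.
  by move=> x; rewrite /comb big_seq big1 // => cw /hl.
by move=> h; rewrite shift_comb; [apply: IHk; [exact: ltnW|exact: wlt_dlist]|exact: wlt_le hl].
Qed.

Lemma lc_comb l : wlt n.+1 l -> lc (comb l).
Proof.
by move=> hl; apply: lc_sum => cw /hl; rewrite ltnS => /m_lc; exact: (lc_comp (fun r => cw.1 * r)).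
Qed.

Lemma cf_dlist l h u : cf (dlist l h) u =
  \sum_(cw <- l) (if prefix u cw.2 && (size u < size cw.2)%N
                  then cw.1 * m (drop (size u) cw.2) h else 0).
Proof.
rewrite /cf /dlist big_mkcond big_allpairs_dep /=; apply: eq_bigr => cw _.
by rewrite -big_mkcond /= (sum_psplits cw.2 u (fun v => cw.1 * m v h)).
Qed.

Definition trim k l := [seq cw <- l | (size cw.2 < k)%N].

Lemma wlt_trim k l : wlt k (trim k l).
Proof. by move=> cw; rewrite mem_filter => /andP []. Qed.

Lemma cf_trim k l v : (size v < k)%N -> cf (trim k l) v = cf l v.
Proof.
move=> sv; rewrite /cf big_filter_cond; apply: eq_bigl => cw; case: eqP => // e; last by rewrite andbF.
by rewrite e sv.
Qed.

Lemma comb_trim k l : wlt k.+1 l -> (forall v, size v = k -> cf l v = 0) ->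
  comb l =1 comb (trim k l).
Proof.
move=> hl top x; rewrite !combE; pose t v := if (size v < k)%N then m v x else 0.
transitivity (ell t l); last first.
  rewrite /ell big_filter [RHS]big_mkcond; apply: eq_bigr => cw _; rewrite /t; case: ifP => //.
  by rewrite mulr0.
rewrite !ell_cf; apply: eq_big_seq => v; rewrite mem_undup => /mapP [cw /hl sv ev]; rewrite /t.
case: ifP => // nlt; rewrite top ?mul0r //.
by apply/eqP; move: sv; rewrite ltnS leq_eqVlt -ev nlt orbF.
Qed.

(** Shifting by the element dual to y turns the coefficient of a longest word [rcons v y] into the
    coefficient of v, which vanishes by induction. The longest words can then be trimmed. *)
Lemma comb_indep k l : (k <= n.+1)%N -> wlt k l -> (forall x, comb l x = 0) -> forall u, cf l u = 0.
Proof.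
elim: k l => [|k IHk] l kn hl l0 u.
  by rewrite /cf big_seq_cond big1 // => cw /andP [/hl].
have top v : size v = k -> cf l v = 0.
  case: k IHk kn hl => [|k] IHk kn hl sv.
    rewrite -[RHS](l0 1%g) /cf /comb big_seq_cond [RHS]big_seq; apply: eq_big => [cw|cw /andP [cwl /eqP ->]].
      by apply: andb_idr => /hl; rewrite ltnS leqn0 size_eq0 => /eqP ->; move/size0nil: sv => ->.
    by move/size0nil: sv => ->; rewrite m1 mulr1.
  case/lastP: v sv => // v y; rewrite size_rcons => -[sv].
  pose ys := undup (flatten (map snd l)).
  have [yys|nys] := boolP (y \in ys); last first.
    apply: cf_out; apply: contra nys => h; rewrite mem_undup; apply/flattenP.
    by exists (rcons v y) => //; rewrite mem_rcons mem_head.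
  have [h hP] := chi_dual (undup_uniq (flatten (map snd l))).
  have := IHk (dlist l (h y)) (ltnW kn) (wlt_dlist (h:=h y) hl) _ v.
  rewrite -shift_comb; last exact: wlt_le hl.
  move=> <- => [|x]; last by rewrite /shift !l0 subrr.
  rewrite cf_dlist /cf [LHS]big_mkcond /=; apply: eq_big_seq => cw cwl.
  have := hl cw cwl; rewrite ltnS => sw.
  have [e|ne] := eqVneq cw.2 (rcons v y).
    rewrite e prefix_rcons size_rcons ltnS leqnn /= drop_rcons // drop_size mchi hP ?eqxx ?mulr1 //.
  case: ifP => // /andP [/prefixP [v' e] lt].
  have sv' : size v' = 1%N by move: sw lt; rewrite e size_cat sv; lia.
  case: v' e sv' => [//|y' [|//]] e _; rewrite e drop_size_cat // mchi hP //.
    rewrite eq_sym; case: eqP => [yy|_]; last by rewrite mulr0.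
    by rewrite e yy cats1 eqxx in ne.
  rewrite mem_undup; apply/flattenP; exists cw.2; first exact: map_f.
  by rewrite e mem_cat inE eqxx orbT.
have [lt|ge] := ltnP (size u) k; last first.
  have [e|ne] := eqVneq (size u) k; first exact: top.
  apply: cf_out; apply/negP => /mapP [cw /hl lt e]; move: lt; by rewrite -e ltnS leq_eqVlt ltnNge ge (negPf ne).
rewrite -(cf_trim l lt); apply: IHk; [exact: ltnW|exact: wlt_trim|].
by move=> x; rewrite -(comb_trim hl top) l0.
Qed.

Lemma ell_ext t l l' : wlt n.+1 l -> wlt n.+1 l' -> comb l =1 comb l' -> ell t l = ell t l'.
Proof.
move=> hl hl' e; apply/eqP; rewrite -subr_eq0 -ell_neg -ell_cat; apply/eqP; apply: ell_eq0.
apply: (comb_indep (leqnn _)); first by apply: wlt_cat => //; exact: wlt_neg.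
by move=> x; rewrite combE ell_cat ell_neg -!combE e subrr.
Qed.

Lemma cf_ext l l' u : wlt n.+1 l -> wlt n.+1 l' -> comb l =1 comb l' -> cf l u = cf l' u.
Proof.
move=> hl hl' e; apply/eqP; rewrite -subr_eq0 -cf_neg -cf_cat; apply/eqP.
apply: (comb_indep (leqnn _)); first by apply: wlt_cat => //; exact: wlt_neg.
by move=> x; rewrite combE ell_cat ell_neg -!combE e subrr.
Qed.

Lemma lc_shift h g : lc g -> lc (shift h g).
Proof.
by move=> lg; exact: (@lc_op _ _ _ _ (fun a b => a - b) _ _ (lc_translate h lg) lg).
Qed.

(** The top coefficients of [shift h g] are homomorphisms in h, hence combinations of the chi.
    Appending to each word u the letters y with these coefficients gives [l'], whose shifts have the
    same top part as those of g; so the difference [g1] has lower degree. *)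
Lemma poly_lt_span k g : (k <= n.+1)%N -> lc g -> poly_lt k g ->
  exists l, wlt k l /\ g =1 comb l.
Proof.
elim: k g => [|k IHk] g kn lg gk.
  by exists [::]; split=> // x; rewrite /comb big_nil gk.
case: k IHk kn gk => [|k] IHk kn gk.
  exists [:: (g 1%g, [::])]; split=> [cw|x]; first by rewrite inE => /eqP ->.
  rewrite /comb big_seq1 m1 mulr1; have := gk x 1%g; rewrite /shift mul1g => /eqP.
  by rewrite subr_eq0 => /eqP.
(* Choosing the list as a function of f alone makes [L h] depend only on the class of h modulo W.
   Hence only the finitely many words of [U] occur. *)
have /choice [ls lsP] : forall f : F -> R, exists l, lc f -> poly_lt k.+1 f -> wlt k.+1 l /\ f =1 comb l.
  move=> f; have [[lf fk]|nf] := pselect (lc f /\ poly_lt k.+1 f).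
    by have [l hl] := IHk f (ltnW kn) lf fk; exists l.
  by exists [::] => lf fk; case: nf.
have kn1 : (k.+1 <= n.+1)%N by exact: ltnW.
pose L h := ls (shift h g).
have LP h : wlt k.+1 (L h) /\ shift h g =1 comb (L h).
  by apply: lsP => //; exact: lc_shift.
have Ln h : wlt n.+1 (L h) by exact: wlt_le kn1 (LP h).1.
have [W [oW hW]] := lg; have [t [q [qM qS qP pQ]]] := pro_p_quotient pp ppF oW.
have Lq h h' : q h = q h' -> L h = L h'.
  move=> /qP Whh'; rewrite /L; congr ls; apply/funext => x; rewrite /shift; congr (_ - _).
  have -> : (x * h' = x * h * (h^-1 * h'))%g by rewrite -mulgA mulKVg.
  by rewrite [RHS]hW.
have /choice [r rK] := qS.
pose U := [seq u <- undup (flatten [seq map snd (L (r a)) | a <- enum {: fcar t}]) | size u == k].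
have cU h u : size u = k -> u \notin U -> cf (L h) u = 0.
  move=> su nu; rewrite (Lq h (r (q h))) ?rK //; apply: cf_out; apply: contra nu => h'.
  rewrite mem_filter su eqxx mem_undup; apply/flatten_mapP; exists (q h) => //.
  by rewrite mem_enum.
have ch u : size u = k -> exists d : seq Y * (Y -> nat),
    forall h, cf (L h) u = \sum_(y <- d.1) chi y h *+ d.2 y.
  (* Additivity: [shift (h * h') g] is the sum of [shift h g], [shift h' g] and a second-order shift
     that contains no word of length k. *)
  move=> su; have [||ys [c hc]] := @chi_spanN (fun h => cf (L h) u); last by exists (ys, c).
    move=> h h'; rewrite (@cf_ext _ (L h' ++ L h ++ dlist (L h') h)) //.
    - rewrite !cf_cat addrC -addrA; congr (_ + _); rewrite addrC -[RHS]addr0; congr (_ + _).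
      apply: cf_out; apply/negP => /mapP [cw /(wlt_dlist (h:=h) (LP h').1) lt e].
      by move: lt; rewrite -e su ltnn.
    - by apply: wlt_cat => //; apply: wlt_cat => //; apply: wlt_le (wlt_dlist (h:=h) (LP h').1); exact: ltnW.
    - move=> x; rewrite -(LP _).2 combE !ell_cat -!combE -shift_comb // -!(LP _).2.
      have e z : comb (L h') z = shift h' g z by rewrite (LP _).2.
      by rewrite [shift h (comb _) x]/shift !e /shift mulgA; ring.
  exists W; split=> // h w Ww; rewrite (Lq _ h) //; apply/esym/qP; rewrite mulKg //.
have /choice [d dP] : forall u, exists d : seq Y * (Y -> nat), size u = k ->
    forall h, cf (L h) u = \sum_(y <- d.1) chi y h *+ d.2 y.
  move=> u; have [su|nsu] := pselect (size u = k); last by exists ([::], fun=> 0%N).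
  by have [d hd] := ch u su; exists d.
pose l' : seq (R * seq Y) := [seq (((d u).2 y)%:R, rcons u y) | u <- U, y <- (d u).1].
have kn2 : (k < n.+1)%N by exact: ltnW.
have wl' : wlt k.+2 l'.
  move=> cw /allpairsPdep [u [y [uU _ ->]]] /=; move: uU.
  by rewrite mem_filter size_rcons => /andP [/eqP -> _].
have wl'n : wlt n.+1 l' by exact: wlt_le wl'.
have cl' h v : size v = k -> cf (dlist l' h) v = cf (L h) v.
  move=> sv; rewrite cf_dlist big_allpairs_dep /=.
  rewrite (eq_big_seq (fun u => if u == v then cf (L h) v else 0)) => [|u].
    have [vU|nvU] := boolP (v \in U).
      rewrite -big_mkcond -big_filter filter_pred1_uniq ?big_seq1 //.
      by rewrite filter_uniq // undup_uniq.
    rewrite big_seq big1 => [|u uU]; first by rewrite (cU _ _ sv nvU).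
    by case: eqP => // e; case/negP: nvU; rewrite -e.
  rewrite mem_filter => /andP [/eqP su _]; case: eqP => [e|ne].
    rewrite -{v sv}e dP //; apply: eq_bigr => y _.
    rewrite prefix_rcons size_rcons leqnn /= drop_rcons // drop_size mchi.
    by rewrite mulr_natl.
  rewrite big1 // => y _; case: ifP => // /andP [/prefixP [w e] _].
  case: ne; have := congr1 (take k) e; rewrite -cats1 -su take_size_cat // su -sv take_size_cat //.
pose g1 x := g x - comb l' x.
have [|||l'' [wl'' hl'']] := IHk g1.
- exact: ltnW.
- by apply: (@lc_op _ _ _ _ (fun a b => a - b)) => //; exact: lc_comb.
- move=> h; pose ll := L h ++ negl (dlist l' h).
  have wll : wlt k.+1 ll.
    by apply: wlt_cat; [exact: (LP h).1|apply: wlt_neg; exact: wlt_dlist].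
  have -> : shift h g1 = comb (trim k ll).
    apply/funext => x; rewrite -comb_trim //; last first.
      by move=> v sv; rewrite cf_cat cf_neg cl' // subrr.
    rewrite combE ell_cat ell_neg -!combE -shift_comb // -(LP h).2.
    by rewrite /shift /g1; ring.
  by apply: poly_lt_comb; [exact: ltnW|exact: wlt_trim].
exists (l' ++ l''); split; first by apply: wlt_cat => //; exact: wlt_le wl''.
by move=> x; rewrite combE ell_cat -!combE -hl'' /g1 addrC subrK.
Qed.

End Polynomial.

Lemma conv_map (Y Z : eqType) (R : comNzRingType) (a : Y -> Z) (f g : seq Z -> R) w :
  conv f g (map a w) = conv (f \o map a) (g \o map a) w.
Proof.
elim: w f => [|y w IHw] f; first by rewrite !conv_nil.
by rewrite /= !conv_cons IHw.
Qed.

Section Evaluation.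
Variables (p : nat) (F : topGroupType).
Hypotheses (pp : prime p) (ppF : pro_p_group p F).
Variables (N n : nat) (Y : eqType).
Local Notation R := 'Z_(p ^ N.+1).
Variable chi : Y -> F -> R.
Hypothesis chi_dual : forall ys : seq Y, uniq ys ->
  exists h : Y -> F, forall y y', y \in ys -> y' \in ys -> chi y' (h y) = (y' == y)%:R.
Hypothesis chi_spanN : forall psi : F -> R, addhom psi -> lc psi ->
  exists (ys : seq Y) (c : Y -> nat), forall x, psi x = \sum_(y <- ys) chi y x *+ c y.
Implicit Types (g : F -> R) (l : seq (R * seq Y)) (u v w : seq Y) (t : seq Y -> R).

Definition PL k g := lc g /\ poly_lt k g.

Definition lst (m : seq Y -> F -> R) g : seq (R * seq Y) :=
  if pselect (exists l, wlt n.+1 l /\ g =1 comb m l) is left h then projT1 (cid h) else [::].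

(* The linear form [m w |-> t w] at [g]; it is 0 when [g] is not a combination of
   the [m w] with [size w <= n]. *)
Definition ev m t g : R := ell t (lst m g).

Lemma PLD k g g' : PL k g -> PL k g' -> PL k (fun x => g x + g' x).
Proof. by move=> [l h] [l' h']; split; [exact: lc_op|exact: poly_ltD]. Qed.

Lemma PLZ k a g : PL k g -> PL k (fun x => a * g x).
Proof. by move=> [l h]; split; [exact: (lc_comp (fun r => a * r))|exact: poly_ltZ]. Qed.

Lemma PL_le k k' g : (k <= k')%N -> PL k g -> PL k' g.
Proof. by move=> kk [? ?]; split=> //; exact: poly_lt_le kk _. Qed.

(** Two expansions with the same linear part have the same leading terms: in the shift of the
    difference, the terms of highest order carry differences at single letters, and these vanish.
    Used to compare m with its translate by an element of the group. *)
Lemma comul_diff m m' w : comul chi n m -> comul chi n m' -> (size w <= n)%N ->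
  PL (size w) (fun x => m' w x - m w x).
Proof.
move=> [m1 my mM] [m'1 m'y m'M] sw; split.
  by apply: (@lc_op _ _ _ _ (fun a b => a - b)); [exact: (m'M w sw).1|exact: (mM w sw).1].
move: {2}(size w) (leqnn (size w)) sw => k.
elim: k w => [|k IHk] w sk sn.
  move: sk; rewrite leqn0 size_eq0 => /eqP -> x /=; rewrite m1 m'1 subrr //.
case: w sk sn => [|y0 w0] sk sn; first by move=> x; rewrite m1 m'1 subrr.
set w := y0 :: w0 in sk sn *; have -> : size w = (size w0).+1 by [].
move=> h; have -> : shift h (fun x => m' w x - m w x) = fun x =>
    \sum_(s <- psplits w) ((m' s.2 h * (m' s.1 x - m s.1 x)) + (m' s.2 h - m s.2 h) * m s.1 x).
  apply/funext => x; rewrite /shift (m'M w sn).2 (mM w sn).2 /conv m1 m'1 !mulr1.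
  have e (a b c d : R) : a + b - (c + d) - (a - c) = b - d by ring.
  rewrite e -sumrB; apply: eq_bigr => s _; ring.
have sw : size w = (size w0).+1 by [].
apply: poly_lt_sum => s sw'; have := psplits_size sw'; rewrite sw ltnS => s1.
have sn1 : (size s.1 <= n)%N by apply: leq_trans s1 _; exact: ltnW.
have sk1 : (size s.1 <= k)%N by exact: leq_trans s1 sk.
apply: poly_ltD; first by apply: poly_ltZ; apply: poly_lt_le s1 _; exact: IHk.
move: s1; rewrite leq_eqVlt => /orP [/eqP e|lt].
  have [e' ne] := psplits_cat sw'; have := congr1 size e'; rewrite size_cat e sw -addn1 => /addnI.
  case: s.2 ne => [//|y [|//]] _ _; rewrite m'y my subrr.
  have -> : (fun x => 0 * m s.1 x) = (fun=> 0) by apply/funext => x; rewrite mul0r.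
  exact: poly_lt0.
apply: poly_ltZ; apply: poly_lt_le lt _.
have -> : m s.1 = comb m [:: (1, s.1)] by apply/funext => x; rewrite /comb big_seq1 mul1r.
apply: (@poly_lt_comb _ _ _ n _ chi); rewrite ?ltnS //.
by move=> cw; rewrite inE => /eqP ->.
Qed.

Variable m : seq Y -> F -> R.
Hypothesis cm : comul chi n m.

Lemma evE t l g : wlt n.+1 l -> g =1 comb m l -> ev m t g = ell t l.
Proof.
move=> hl gl; rewrite /ev /lst; case: pselect => [h|[]]; last by exists l.
case: (cid h) => l' /= [hl' gl']; apply: (ell_ext pp chi_dual cm) => // x.
by rewrite -gl' gl.
Qed.

Lemma PL_comb k l : (k <= n.+1)%N -> wlt k l -> PL k (comb m l).
Proof.
move=> kn hl; split; last exact: (poly_lt_comb cm).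
by apply: (lc_comb cm); exact: wlt_le hl.
Qed.

Lemma wlt1 k w (c : R) : (size w < k)%N -> wlt k [:: (c, w)].
Proof. by move=> sw cw; rewrite inE => /eqP ->. Qed.

Lemma comb1 w : m w =1 comb m [:: (1, w)].
Proof. by move=> x; rewrite /comb big_seq1 mul1r. Qed.

Lemma PL_m k w : (size w < k)%N -> (k <= n.+1)%N -> PL k (m w).
Proof. by move=> sw kn; rewrite (funext (comb1 w)); apply: PL_comb => //; exact: wlt1. Qed.

Lemma ev_m t w : (size w <= n)%N -> ev m t (m w) = t w.
Proof.
move=> sw; rewrite (evE t (l := [:: (1, w)])); [by rewrite /ell big_seq1 mul1r|exact: wlt1|exact: comb1].
Qed.

Lemma PL_span k g : (k <= n.+1)%N -> PL k g -> exists2 l, wlt k l & g = comb m l.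
Proof.
move=> kn [lg pg]; have [l [wl gl]] := poly_lt_span pp ppF chi_dual chi_spanN cm kn lg pg.
by exists l => //; exact/funext.
Qed.

Lemma evDZ t a g g' : PL n.+1 g -> PL n.+1 g' ->
  ev m t (fun x => a * g x + g' x) = a * ev m t g + ev m t g'.
Proof.
move=> /(PL_span (leqnn _)) [l wl ->] /(PL_span (leqnn _)) [l' wl' ->].
rewrite (@evE t l (comb m l)) // (@evE t l' (comb m l')) // (@evE t ([seq (a * cw.1, cw.2) | cw <- l] ++ l')).
- rewrite ell_cat /ell big_map mulr_sumr; congr (_ + _).
  by apply: eq_bigr => cw _; rewrite mulrA.
- by apply: wlt_cat => // cw /mapP [cw' /wl h ->].
- move=> x; rewrite !combE ell_cat /ell big_map mulr_sumr; congr (_ + _).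
  by apply: eq_bigr => cw _; rewrite mulrA.
Qed.

Lemma ev_sum t (I : eqType) (s : seq I) (c : I -> R) (G : I -> F -> R) :
  (forall i, i \in s -> PL n.+1 (G i)) ->
  ev m t (fun x => \sum_(i <- s) c i * G i x) = \sum_(i <- s) c i * ev m t (G i).
Proof.
move=> h; suff : PL n.+1 (fun x => \sum_(i <- s) c i * G i x) /\
  ev m t (fun x => \sum_(i <- s) c i * G i x) = \sum_(i <- s) c i * ev m t (G i) by case.
elim: s h => [|i s IHs] h.
  have -> : (fun x : F => \sum_(i <- [::]) c i * G i x) = comb m [::].
    by apply/funext => x; rewrite /comb !big_nil.
  split; first by apply: PL_comb.
  by rewrite (@evE t [::]) // /ell !big_nil.
have -> : (fun x : F => \sum_(j <- i :: s) c j * G j x) =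
    (fun x => c i * G i x + \sum_(j <- s) c j * G j x).
  by apply/funext => x; rewrite big_cons.
have h1 : PL n.+1 (G i) by apply: h; rewrite mem_head.
have [|h2 h3] := IHs; first by move=> j js; apply: h; rewrite inE js orbT.
split; first by apply: PLD => //; exact: PLZ.
by rewrite evDZ // h3 big_cons.
Qed.

Lemma ev_comb t (G : seq Y -> F -> R) l : (forall cw, cw \in l -> PL n.+1 (G cw.2)) ->
  ev m t (fun x => \sum_(cw <- l) cw.1 * G cw.2 x) = \sum_(cw <- l) cw.1 * ev m t (G cw.2).
Proof. exact: (@ev_sum t _ l fst (fun cw => G cw.2)). Qed.

Section Invariance.
Variables (Ga : finGroupType) (actF : Ga -> F -> F) (yact : Ga -> Y -> Y).
Hypothesis actFM : forall a, {morph actF a : x y / (x * y)%g}.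
Hypothesis actFc : forall a, continuous (actF a).
Hypothesis actF1 : forall x, actF 1%g x = x.
Hypothesis actFA : forall a b x, actF (a * b)%g x = actF a (actF b x).
Hypothesis yact1 : forall y, yact 1%g y = y.
Hypothesis yactA : forall a b y, yact (a * b)%g y = yact a (yact b y).
Hypothesis chi_act : forall a y x, chi (yact a y) (actF a x) = chi y x.

Definition wact (a : Ga) w := map (yact a) w.

Lemma wact1 w : wact 1%g w = w. Proof. by rewrite /wact (eq_map yact1) map_id. Qed.
Lemma wactA a b w : wact (a * b)%g w = wact a (wact b w).
Proof. by rewrite /wact -map_comp; apply: eq_map => y; exact: yactA. Qed.

Lemma lc_pull a T (g : F -> T) : lc g -> lc (g \o actF a).
Proof. by move=> lg; have [W [oW h]] := lc_precomp (@actFM a) (@actFc a) lg; exists W. Qed.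

Lemma PL_pull a k g : PL k g -> PL k (g \o actF a).
Proof.
move=> [lg pg]; split; first exact: lc_pull.
elim: k g pg {lg} => [|k IHk] g /= pg; first by move=> x; rewrite /= pg.
move=> h; have -> : shift h (g \o actF a) = shift (actF a h) g \o actF a.
  by apply/funext => x; rewrite /shift /= actFM.
exact: IHk.
Qed.

Lemma comul_pull a : comul chi n (fun w x => m (wact a w) (actF a x)).
Proof.
have [m1 my mM] := cm; split=> [x|y x|w sw]; first exact: m1.
  by rewrite /= my chi_act.
have sw' : (size (wact a w) <= n)%N by rewrite size_map.
split; first exact: (lc_pull a (mM _ sw').1).
by move=> x h; rewrite actFM (mM _ sw').2 conv_map.
Qed.

Variables (A : {group Ga}) (kap : nat) (y0 : Y).
Hypothesis cardA : #|A| = (p ^ kap)%N.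
Hypothesis fix_y0 : forall a, a \in A -> yact a y0 = y0.

Definition avg t g : R := \sum_(b in A) ev m t (g \o actF b).

Lemma avg_inv t a g : a \in A -> avg t (g \o actF a) = avg t g.
Proof.
move=> aA; rewrite /avg [RHS](reindex_inj (mulgI a)) /=.
rewrite [RHS](eq_bigl (fun b => b \in A)); last by move=> b; rewrite groupMl.
apply: eq_bigr => b _; congr (ev _ _ _); apply/funext => x /=; by rewrite actFA.
Qed.

Lemma avgDZ t a g g' : PL n.+1 g -> PL n.+1 g' ->
  avg t (fun x => a * g x + g' x) = a * avg t g + avg t g'.
Proof.
move=> hg hg'; rewrite /avg mulr_sumr -big_split; apply: eq_bigr => b _.
exact: (evDZ t a (PL_pull b hg) (PL_pull b hg')).
Qed.

Lemma avg_comb t l : wlt n.+1 l -> avg t (comb m l) = \sum_(cw <- l) cw.1 * avg t (m cw.2).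
Proof.
move=> wl; rewrite /avg.
transitivity (\sum_(b in A) \sum_(cw <- l) cw.1 * ev m t (m cw.2 \o actF b)).
  apply: eq_bigr => b _; rewrite -(ev_comb t (G := fun w => m w \o actF b)) // => cw /wl sw.
  by apply: PL_pull; exact: PL_m.
by rewrite exchange_big; apply: eq_bigr => cw _; rewrite mulr_sumr.
Qed.

(* On words of length k+2, the average s w = avg t (m w) is A-invariant modulo |A|;
   the new t is (s w - s (rho w)) / |A| there, rho w representing the orbit of w. *)
Lemma invariant_step k t : (k.+2 <= n)%N -> (kap * k.+1 <= N.+1)%N ->
  (forall a g, a \in A -> PL k.+2 g ->
    pdv (N.+1 - kap * k) (ev m t (g \o actF a) - ev m t g)) ->
  exists2 t', (forall w, (size w <= k.+1)%N -> t' w = t w) &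
    forall a g, a \in A -> PL k.+3 g ->
      pdv (N.+1 - kap * k.+1) (ev m t' (g \o actF a) - ev m t' g).
Proof.
move=> kn hN ht; set m0 := (N.+1 - kap * k)%N in ht.
have kapm : (kap <= m0)%N by rewrite /m0; lia.
(* In the degrees already treated, t is invariant modulo p^m0, so summing over A multiplies it by
   |A|. *)
have fact1 g : PL k.+2 g -> pdv m0 (avg t g - ev m t g *+ p ^ kap).
  move=> hg; rewrite -cardA -sumr_const -sumrB; apply: pdv_sum => b bA; exact: ht.
have PLn j g : (j <= n.+1)%N -> PL j g -> PL n.+1 g by exact: PL_le.
pose s w := avg t (m w).
have dlt a w : size w = k.+2 -> PL k.+2 (fun x => m (wact a w) (actF a x) - m w x).
  by move=> sw; rewrite -{1}sw; apply: (comul_diff cm (comul_pull a)); rewrite sw.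
(* The average is exactly invariant, so the difference is the average of the lower-degree function
   [d], to which [fact1] applies. *)
have fact2 a w : a \in A -> size w = k.+2 -> pdv kap (s (wact a w) - s w).
  move=> aA sw; rewrite /s -(avg_inv t _ aA).
  set d := (fun x => m (wact a w) (actF a x) - m w x).
  have dP : PL k.+2 d by exact: dlt.
  have -> : m (wact a w) \o actF a = (fun x => 1 * d x + m w x).
    by apply/funext => x; rewrite mul1r /d subrK.
  rewrite avgDZ; [|by apply: PLn dP; exact: ltnW|by apply: PL_m => //; rewrite sw ltnS].
  rewrite mul1r addrK -(subrK (ev m t d *+ p ^ kap) (avg t d)).
  apply: pdvD; first by apply: (pdv_le kapm); exact: fact1.
  by exists (ev m t d).
have /choice [rep repP] : forall S : set (seq Y), exists v, S !=set0 -> S v.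
  by move=> S; have [[v Sv]|nS] := pselect (S !=set0); [exists v|exists [::]].
pose rho w := rep [set v | v \in orb wact A w].
have rhoP w : exists2 a, a \in A & rho w = wact a w.
  have /orbP [a aA e] : rho w \in orb wact A w.
    by apply: (repP [set v | v \in orb wact A w]); exists w; exact: (orb_refl wact1).
  by exists a.
have rhoA a w : a \in A -> rho (wact a w) = rho w.
  move=> aA; rewrite /rho; congr rep; apply/seteqP.
  have h : wact a w \in orb wact A w by apply/orbP; exists a.
  split=> v /= hv; first exact: (orb_trans wactA h hv).
  exact: (orb_trans wactA (orb_sym wact1 wactA h) hv).
have /choice [t' t'P] : forall w, exists r : R, size w = k.+2 -> s w - s (rho w) = r *+ p ^ kap.
  move=> w; have [sw|nsw] := pselect (size w = k.+2); last by exists 0 => /nsw.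
  have [a aA ->] := rhoP w; have [r hr] := pdvN (fact2 a w aA sw).
  by exists r => _; rewrite -hr opprB.
pose t2 w := if (size w <= k.+1)%N then t w else t' w.
(* The form [sg] depends only on the orbits of words of top length and is invariant ([fact4]).
   Modulo p^m0, p^kap times the form of [t2] is the average minus [sg] ([fact3]); dividing by p^kap
   makes [t2] invariant. *)
pose sg w := if size w == k.+2 then s (rho w) else 0.
have sgP g : PL k.+2 g -> ev m sg g = 0.
  move=> /PL_span; case=> [|l wl ->]; first exact: ltnW.
  rewrite (@evE sg l) //; last by apply: wlt_le wl; exact: ltnW.
  rewrite /ell big_seq big1 // => cw /wl lt; rewrite /sg ifN ?mulr0 //.
  by rewrite neq_ltn lt.
have fact3 g : PL k.+3 g -> pdv m0 (ev m t2 g *+ p ^ kap - (avg t g - ev m sg g)).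
  move=> /PL_span; case=> // l wl ->; have wln : wlt n.+1 l by exact: wlt_le wl.
  rewrite (evE t2 wln (frefl _)) (evE sg wln (frefl _)) (avg_comb t wln) /ell.
  rewrite -sumrB -sumrMnl -sumrB big_seq; apply: pdv_sum => cw cwl.
  rewrite -mulrBr -mulrnAr -mulrBr; apply: pdvM; rewrite /sg /t2.
  have := wl cw cwl; rewrite ltnS leq_eqVlt => /orP [/eqP e|lt].
    by rewrite e eqxx ltnn -t'P // subrr; exact: pdv0.
  rewrite -ltnS lt ifN; last by rewrite neq_ltn lt.
  rewrite subr0 -opprB; apply: pdvN; rewrite -(@ev_m t cw.2); last by apply: leq_trans kn; exact: ltnW.
  by apply: fact1; apply: PL_m => //; exact: ltnW.
have fact4 a g : a \in A -> PL k.+3 g -> ev m sg (g \o actF a) = ev m sg g.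
  move=> aA /PL_span; case=> // l wl ->; have wln : wlt n.+1 l by exact: wlt_le wl.
  rewrite (evE sg wln (frefl _)) /ell.
  rewrite -[LHS]/(ev m sg (fun x => \sum_(cw <- l) cw.1 * (m cw.2 \o actF a) x)).
  rewrite (@ev_comb sg (fun w => m w \o actF a)) => [|cw /wln sw]; last by apply: PL_pull; exact: PL_m.
  apply: eq_big_seq => cw cwl; congr (_ * _).
  have := wl cw cwl; rewrite ltnS leq_eqVlt => /orP [/eqP e|lt]; last first.
    rewrite sgP; last by apply: PL_pull; apply: PL_m => //; exact: ltnW.
    by rewrite /sg ifN // neq_ltn lt.
  set v := wact a^-1%g cw.2; have ew : cw.2 = wact a v by rewrite /v -wactA mulgV wact1.
  have sv : size v = k.+2 by rewrite size_map.
  set d := (fun x => m (wact a v) (actF a x) - m v x).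
  have -> : m cw.2 \o actF a = (fun x => 1 * d x + m v x).
    by apply/funext => x; rewrite mul1r /d subrK -ew.
  have dP : PL k.+2 d by exact: dlt.
  rewrite evDZ; [|by apply: PLn dP; exact: ltnW|by apply: PL_m => //; rewrite sv ltnS].
  by rewrite (sgP d) // mulr0 add0r ev_m ?sv // /sg sv e eqxx ew rhoA.
exists t2 => [w sw|a g aA gP]; first by rewrite /t2 sw.
have -> : (N.+1 - kap * k.+1 = m0 - kap)%N by rewrite /m0; lia.
apply: (pdv_div pp); first by rewrite kapm /m0 leq_subr.
rewrite mulrnBl; have := pdvB (fact3 _ (PL_pull a gP)) (fact3 _ gP).
rewrite avg_inv // fact4 // => h.
have e (x y z : R) : x - z - (y - z) = x - y by ring.
by rewrite e in h.
Qed.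

(** In degree at most 1 the form is exactly invariant because A fixes y0. Each further degree costs
    kap powers of p. *)
Lemma invariant_functional k : (k.+1 <= n)%N -> (kap * k <= N.+1)%N ->
  exists2 t, (forall y, t [:: y] = (y == y0)%:R) &
    forall a g, a \in A -> PL k.+2 g ->
      pdv (N.+1 - kap * k) (ev m t (g \o actF a) - ev m t g).
Proof.
elim: k => [|k IHk] kn kN; last first.
  have [||t ty ht] := IHk; [exact: ltnW|lia|].
  have [t' t'w ht'] := invariant_step kn kN ht; exists t' => // y.
  by rewrite t'w // ty.
have [m1 my _] := cm.
pose t w : R := if w is [:: y] then (y == y0)%:R else 0.
exists t => // a g aA /PL_span; case=> // l wl ->.
have wln : wlt n.+1 l by exact: wlt_le wl.
rewrite (evE t wln (frefl _)) /ell.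
rewrite -[ev m t (_ \o _)]/(ev m t (fun x => \sum_(cw <- l) cw.1 * (m cw.2 \o actF a) x)).
rewrite (@ev_comb t (fun w => m w \o actF a)) => [|cw /wln sw]; last by apply: PL_pull; exact: PL_m.
suff -> : \sum_(cw <- l) cw.1 * ev m t (m cw.2 \o actF a) = \sum_(cw <- l) cw.1 * t cw.2.
  by rewrite subrr; exact: pdv0.
apply: eq_big_seq => cw /wl; case: cw => c [|y [|//]] //= _; congr (_ * _).
  have -> : m [::] \o actF a = m [::] by apply/funext => x /=; rewrite !m1.
  by rewrite ev_m.
have -> : m [:: y] \o actF a = m [:: yact a^-1%g y].
  by apply/funext => x /=; rewrite !my -[in RHS](chi_act a) -yactA mulgV yact1.
rewrite ev_m //=; congr (nat_of_bool _)%:R; apply/eqP/eqP => [e|->].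
  by rewrite -(fix_y0 aA) -e -yactA mulgV yact1.
by rewrite -{1}(fix_y0 aA) -yactA mulVg yact1.
Qed.

End Invariance.
End Evaluation.

Section StableCore.
Variables (F : topGroupType) (Ga : finGroupType) (actF : Ga -> F -> F).
Hypothesis actFM : forall a, {morph actF a : x y / (x * y)%g}.
Hypothesis actFc : forall a, continuous (actF a).
Hypothesis actF1 : forall x, actF 1%g x = x.
Hypothesis actFA : forall a b x, actF (a * b)%g x = actF a (actF b x).

Lemma stable_core W : onormal W ->
  exists W', [/\ onormal W', (forall a x, W' x -> W' (actF a x)) & W' `<=` W].
Proof.
move=> oW; have nW := oW.1; pose W' : set F := [set x | forall a, W (actF a x)].
have a1 a : actF a 1%g = 1%g := morph1_grp (actFM a).
have aV a x : actF a x^-1%g = (actF a x)^-1%g := morphV_grp (actFM a) x.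
exists W'; split; last by move=> x /(_ 1%g); rewrite actF1.
  have nW' : is_normal_subgroup W'.
    split; first split.
    - by move=> a; rewrite a1; exact: nsub1.
    - by move=> x y hx hy a; rewrite actFM; exact: nsubM.
    - by move=> x hx a; rewrite aV; exact: nsubV.
    - by move=> g x hx a; rewrite !actFM aV; exact: nsubJ.
  split=> //; apply: subgroup_nbhs_open; first exact: nW'.1.
  have h a : nbhs (1%g : F) [set x | W (actF a x)].
    by apply: (@actFc a 1%g W); rewrite a1; exact: onormal_nbhs.
  exact: filter_forall h.
by move=> a x hx b; rewrite -actFA.
Qed.

End StableCore.

(** * Elements fixed by A with prescribed characters *)

Section ModP.
Variables (p : nat) (F : topGroupType) (Y : eqType).
Hypotheses (pp : prime p) (ppF : pro_p_group p F).
Hypothesis liftF : forall (E Q : finGroupType) (f : E -> Q) (q : F -> Q),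
  {morph f : x y / (x * y)%g} -> (forall y, exists x, f x = y) ->
  (p.-group [set: E]%SET)%g -> (p.-group [set: Q]%SET)%g ->
  {morph q : x y / (x * y)%g} -> lc q ->
  exists e : F -> E, [/\ {morph e : x y / (x * y)%g}, lc e & forall x, f (e x) = q x].
Variable chi : forall N, Y -> F -> 'Z_(p ^ N.+1).
Variable chi0 : Y -> F -> 'Z_p.
Hypothesis chiM : forall N y, addhom (chi N y).
Hypothesis chi_lc : forall N y, lc (chi N y).
Hypothesis chi_red : forall N y x, redp (chi N y x) = chi0 y x.
Hypothesis chi_indep : forall (ys : seq Y) (c : Y -> nat), uniq ys ->
  (forall x, \sum_(y <- ys) chi0 y x *+ c y = 0) -> forall y, y \in ys -> (p %| c y)%N.
Hypothesis chi_span : forall psi : F -> 'Z_p, addhom psi -> lc psi ->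
  exists (ys : seq Y) (c : Y -> nat), forall x, psi x = \sum_(y <- ys) chi0 y x *+ c y.
Variables (Ga : finGroupType) (actF : Ga -> F -> F) (yact : Ga -> Y -> Y).
Hypothesis pGa : (p.-group [set: Ga]%SET)%g.
Hypothesis actFM : forall a, {morph actF a : x y / (x * y)%g}.
Hypothesis actFc : forall a, continuous (actF a).
Hypothesis actF1 : forall x, actF 1%g x = x.
Hypothesis actFA : forall a b x, actF (a * b)%g x = actF a (actF b x).
Hypothesis yact1 : forall y, yact 1%g y = y.
Hypothesis yactA : forall a b y, yact (a * b)%g y = yact a (yact b y).
Hypothesis chi_act : forall N a y x, chi N (yact a y) (actF a x) = chi N y x.

Local Notation R0 := 'Z_(p ^ 1).

Let redp_0 (r : R0) : redp r = r. Proof. exact: natr_Zp. Qed.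

Let up N (r : R0) : 'Z_(p ^ N.+1) := (nat_of_ord r)%:R.

Let redp_up N r : redp (up N r) = r.
Proof. by rewrite redp_nat // natr_Zp. Qed.

Let redp_conv N (f g : seq Y -> 'Z_(p ^ N.+1)) w :
  redp (conv f g w) = conv (fun v => redp (f v) : R0) (fun v => redp (g v) : R0) w.
Proof.
rewrite /conv redpD // redpM // redp_sum //; congr (_ + _); apply: eq_bigr => s _.
by rewrite redpM.
Qed.

Lemma comul_redp N n m : comul (chi N) n m -> comul (chi 0) n (fun w x => redp (m w x) : R0).
Proof.
move=> [m1 my mM]; split=> [x|y x|w sw]; first by rewrite m1 redp1.
  by rewrite my chi_red -(chi_red 0) redp_0.
split; first exact: (lc_comp (@redp p N) (mM w sw).1).
by move=> x h; rewrite (mM w sw).2 redp_conv.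
Qed.

Let dual N := dual_elements pp chiM chi_red chi_indep N.
Let spanN N := chi_spanN pp chiM chi_lc chi_red chi_span (N := N).

Variables (A : {group Ga}) (y0 : Y).
Hypothesis fix_y0 : forall a, a \in A -> yact a y0 = y0.

Lemma modp_functional n : exists (m : seq Y -> F -> R0) (t : seq Y -> R0),
  [/\ comul (chi 0) n.+1 m, (forall y, t [:: y] = (y == y0)%:R) &
    forall a g, a \in A -> PL n.+2 g -> ev n.+1 m t (g \o actF a) = ev n.+1 m t g].
Proof.
have [kap cardA] := p_natP (pgroupS (finset.subsetT A) pGa).
(* The construction loses kap * n of the N+1 powers of p, which leaves invariance modulo p. *)
pose N := (kap * n)%N.
have [m cm] := magnus_exists pp ppF liftF (chiM N) (chi_lc N) n.
have [|t ty ht] := invariant_functional pp ppF (dual N) (@spanN N) cm actFM actFc actFA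
  yact1 yactA (@chi_act N) cardA fix_y0 (leqnn n.+1).
  exact: leqnSn.
have cm0 := comul_redp cm; set m0 : seq Y -> F -> R0 := (fun w x => _) in cm0.
pose t0 w : R0 := redp (t w).
exists m0, t0; split=> // [y|a g aA gP].
  by rewrite /t0 ty (redp_nat N pp).
pose rd (l : seq ('Z_(p ^ N.+1) * seq Y)) : seq (R0 * seq Y) := [seq (redp cw.1, cw.2) | cw <- l].
have rdw l k : wlt k l -> wlt k (rd l) by move=> h cw /mapP [cw' /h lt ->].
have rdc l x : comb m0 (rd l) x = redp (comb m l x).
  by rewrite /comb big_map redp_sum //; apply: eq_bigr => cw _; rewrite redpM.
have rde l : ell t0 (rd l) = redp (ell t l).
  by rewrite /ell big_map redp_sum //; apply: eq_bigr => cw _; rewrite redpM.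
have key g' G' : PL n.+2 G' -> (forall x, g' x = redp (G' x)) ->
    ev n.+1 m0 t0 g' = redp (ev n.+1 m t G').
  move=> /(PL_span pp ppF (dual N) (@spanN N) cm (leqnn _)) [l wl ->] e.
  rewrite (evE pp (dual N) cm t wl (frefl _)) -rde.
  apply: (evE pp (dual 0) cm0); first exact: rdw.
  by move=> x; rewrite e rdc.
have [l wl eg] := PL_span pp ppF (dual 0) (@spanN 0) cm0 (leqnn _) gP.
(* A lift of g modulo p^(N+1) that is still polynomial: lift its coefficients on the Magnus
   functions. *)
pose G := comb m [seq (up N cw.1, cw.2) | cw <- l].
have wlG : wlt n.+2 [seq (up N cw.1, cw.2) | cw <- l] by move=> cw /mapP [cw' /wl h ->].
have GP : PL n.+2 G by exact: (PL_comb cm).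
have gG x : g x = redp (G x).
  rewrite eg /G /comb big_map redp_sum //; apply: eq_bigr => cw _.
  by rewrite redpM //= redp_up.
rewrite (key g G) // (key _ (G \o actF a)) => [|| x]; last by rewrite /= gG.
  apply/eqP; rewrite -subr_eq0 -redpN // -redpD //; apply/eqP/(redp_eq0 pp).
  by apply: pdv_le (ht a G aA GP); rewrite /N; lia.
exact: PL_pull.
Qed.

Lemma approx_fixed W : onormal W -> (forall a x, W x -> W (actF a x)) ->
  exists f, (forall a, a \in A -> W (f^-1 * actF a f)%g) /\
    forall y, (forall a, a \in A -> yact a y = y) -> (forall x, W x -> chi0 y x = 0) ->
      chi0 y f = (y == y0)%:R.
Proof.
move=> oW sW; have [tq [q [qM qS qP pQ]]] := pro_p_quotient pp ppF oW.
have lq : lc q := lc_of_quotient oW qP.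
have /choice [r rK] := qS.
set Q := fcar tq in q qM qS qP pQ lq r rK *.
pose V := {ffun Q -> R0}.
pose tr (h : Q) (f : V) : V := [ffun z => f (z * h)%g].
have Zp0 (v : R0) : v *+ p = 0 by rewrite -mulr_natr char_Zp ?mulr0 ?prime_gt1.
(* A degree bound for functions Q -> F_p. It is independent of the precision, which
   [modp_functional] chooses afterwards. *)
have [K hK] : exists K, forall v, soc tr K v.
  apply: (p_group_nilpotent pp pQ (N := 0)).
  - by move=> f; apply/ffunP => z; rewrite ffunE mulg1.
  - by move=> g h f; apply/ffunP => z; rewrite !ffunE mulgA.
  - by move=> g f f'; apply/ffunP => z; rewrite !ffunE.
  - by move=> f; apply/ffunP => z; rewrite ffunMnE ffunE; exact: Zp0.
have socP k (f : V) : soc tr k f -> poly_lt k (fun x => f (q x) : R0).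
  elim: k f => [|k IHk] f /=; first by move=> -> x; rewrite ffunE.
  move=> hf h; have -> : shift h (fun x => f (q x) : R0) = (fun x => (tr (q h) f - f) (q x)).
    by apply/funext => x; rewrite /shift !ffunE qM.
  exact: IHk.
have [m [t [cm ty ht]]] := modp_functional K.
have PLf (f : V) : PL K.+2 (fun x => f (q x) : R0).
  split; first exact: (lc_comp (fun z => f z)).
  by apply: poly_lt_le (socP K f (hK f)); lia.
pose dl (z : Q) : V := [ffun u => (u == z)%:R].
pose c (z : Q) := ev K.+1 m t (fun x => dl z (q x) : R0).
pose aq a z := q (actF a (r z)).
have aqE a x : q (actF a x) = aq a (q x).
  by apply/qP; rewrite -morphV_grp // -actFM; apply: sW; apply/qP; rewrite rK.
have aq1 z : aq 1%g z = z by rewrite /aq actF1 rK.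
have aqA a b z : aq (a * b)%g z = aq a (aq b z) by rewrite {1}/aq actFA aqE.
have cinv a z : a \in A -> c (aq a z) = c z.
  move=> aA; rewrite /c -(ht a) //; congr ev; apply/funext => x /=.
  by rewrite !ffunE aqE (inj_eq (gact_inj aq1 aqA (g:=a))).
have fE (f : V) : ev K.+1 m t (fun x => f (q x) : R0) = \sum_z f z * c z.
  rewrite -(ev_sum pp ppF (dual 0) (@spanN 0) cm t (s := index_enum Q) (fun z => f z)
     (G := fun z x => dl z (q x))) //.
  congr ev; apply/funext => x; rewrite (bigD1 (q x)) //= ffunE eqxx mulr1 big1 ?addr0 //.
  by move=> z ne; rewrite ffunE eq_sym (negPf ne) mulr0.
pose fx z := [forall a in A, aq a z == z].
(* Every factor has a fixed image in Q, so the product is fixed modulo W whatever its order. *)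
pose f := (\prod_(z <- index_enum Q | fx z) r z ^+ nat_of_ord (c z))%g.
exists f; split=> [a aA|y fy Wy].
  apply/qP; rewrite /f.
  have qfM : {morph (q \o actF a) : x y / (x * y)%g} by move=> x y /=; rewrite actFM qM.
  rewrite (big_morph q qM (morph1_grp qM)) -[RHS]/((q \o actF a) _).
  rewrite (big_morph _ qfM (morph1_grp qfM)); apply: eq_bigr => z /forall_inP fz /=.
  have qX x k : q (x ^+ k)%g = (q x ^+ k)%g.
    by elim: k => [|k IHk]; rewrite ?expg0 ?(morph1_grp qM) // !expgS qM IHk.
  have aX x k : actF a (x ^+ k)%g = (actF a x ^+ k)%g.
    elim: k => [|k IHk]; last by rewrite !expgS actFM IHk.
    by rewrite !expg0; exact: morph1_grp (actFM a).
  rewrite qX aX qX aqE rK (eqP (fz a aA)) //.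
have chy x : chi 0 y x = [ffun z => chi 0 y (r z) : R0] (q x).
  have h : chi0 y ((r (q x))^-1 * x)%g = 0 by apply: Wy; apply/qP; rewrite rK.
  rewrite ffunE -{1}(mulKVg (r (q x)) x) chiM -[X in _ + X]redp_0 chi_red h addr0 //.
have e1 : ev K.+1 m t (m [:: y]) = (y == y0)%:R by rewrite (ev_m pp (dual 0) cm).
rewrite -e1; have [_ my _] := cm.
have -> : m [:: y] = (fun x => [ffun z => chi 0 y (r z) : R0] (q x)).
  by apply/funext => x; rewrite my chy.
have chF a z : a \in A -> (chi 0 y (r (aq a z)) : R0) = chi 0 y (r z).
  move=> aA; have := chy (actF a (r z)); rewrite ffunE aqE rK => <-.
  by rewrite -{1}(fy a aA) chi_act.
rewrite fE; transitivity (\sum_(z <- index_enum Q) (chi 0 y (r z) : R0) * c z); last first.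
  by apply: eq_bigr => z _; rewrite ffunE.
(* The points z that A moves, absent from f, contribute nothing: the summand is constant on
   orbits. *)
rewrite (sum_fix aq1 aqA pp (pgroupS (finset.subsetT A) pGa) Zp0 (index_enum_uniq _)); last first.
- by move=> a z aA _; rewrite chF // cinv.
- by move=> a z _ _; rewrite mem_index_enum.
rewrite /f (addhom_prod (chi0M pp chiM chi_red y)); apply: eq_bigr => z _.
rewrite (addhomX (chi0M pp chiM chi_red y)) -(chi_red 0) redp_0 -mulr_natr natr_Zp //.
Qed.

(** The approximate solutions for stable W form a directed family of nonempty closed sets. A common
    point is exact, because the stable W meet in 1 and each [chi0 y] vanishes on one of them. *)
Lemma fixed_dual : exists f, (forall a, a \in A -> actF a f = f) /\
  forall y, (forall a, a \in A -> yact a y = y) -> chi0 y f = (y == y0)%:R.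
Proof.
have [cF hF _] := ppF.1.
pose I := {W : set F | onormal W /\ forall a x, W x -> W (actF a x)}.
pose C (i : I) : set F := [set f | (forall a, a \in A -> (sval i) (f^-1 * actF a f)%g) /\
  forall y, (forall a, a \in A -> yact a y = y) -> (forall x, (sval i) x -> chi0 y x = 0) ->
    chi0 y f = (y == y0)%:R].
have chi0_lc y : lc (chi0 y).
  by rewrite (_ : chi0 y = @redp p 0 \o chi 0 y); [exact: lc_comp|apply/funext => x /=; rewrite chi_red].
have actV a x : actF a x^-1%g = (actF a x)^-1%g := morphV_grp (actFM a) x.
have [|i|[W [oW sW]]|[W [oW sW]] [W' [oW' sW']]|f hf] := @compact_directed F I C _ cF.
- by exists setT; split=> //; exact: onormalT.
- have -> : C i = (\bigcap_(a in [set a | a \in A]) [set f | (sval i) (f^-1 * actF a f)%g]) `&`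
     \bigcap_(y in [set y | (forall a, a \in A -> yact a y = y) /\
        (forall x, (sval i) x -> chi0 y x = 0)]) (chi0 y @^-1` [set ((y == y0)%:R : 'Z_p)]).
    apply/seteqP; split=> f [h1 h2]; split=> // y; first by move=> [fy Wy]; exact: h2.
    by move=> fy Wy; exact: (h2 y (conj fy Wy)).
  apply: closedI; apply: closed_bigI => a _; last exact: lc_preimage_closed.
  rewrite -/((fun f => f^-1 * actF a f)%g @^-1` (sval i)); apply: preimage_closed.
    by move=> f _; apply: mulg_cts; [apply: invg_cts => x; exact: cvg_id|exact: actFc].
  by apply: onormal_closed; exact: (svalP i).1.
- by have [f hf] := approx_fixed oW sW; exists f.
- have hW : onormal (W `&` W') /\ forall a x, (W `&` W') x -> (W `&` W') (actF a x).
    by split; [exact: onormalI|move=> a x [Wx W'x]; split; [exact: sW|exact: sW']].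
  exists (exist (fun W : set F => onormal W /\ forall a x, W x -> W (actF a x)) _ hW) => f [h1 h2]; split; split=> /=.
  + by move=> a /h1 [].
  + by move=> y fy Wy; apply: h2 => // x [Wx _]; exact: Wy.
  + by move=> a /h1 [].
  + by move=> y fy Wy; apply: h2 => // x [_ Wx]; exact: Wy.
exists f; split=> [a aA|y fy].
  suff : (f^-1 * actF a f)%g = 1%g by move=> /(congr1 (fun x => f * x)%g); rewrite mulKVg mulg1.
  apply: (onormal_separates ppF.1) => W oW.
  have [W' [oW' sW' W'W]] := stable_core actFM actFc actF1 actFA oW.
  by apply: W'W; exact: ((hf (exist _ W' (conj oW' sW'))).1 a aA).
have [W [oW hW]] := chi0_lc y.
have [W' [oW' sW' W'W]] := stable_core actFM actFc actF1 actFA oW.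
apply: ((hf (exist _ W' (conj oW' sW'))).2 y fy) => x /W'W Wx.
by rewrite -[x]mul1g hW // (addhom1 (chi0M pp chiM chi_red y)).
Qed.

End ModP.

(** * Convergent equivariant sections *)

Local Close Scope ring_scope.
Local Open Scope group_scope.

Section ConvergentSection.
Variables (F : topGroupType) (J : eqType).
Hypothesis pF : profinite_space F.
Implicit Types (R : J -> set F) (S U : set F).

(** One subgroup S for all y: this uniformity is what preserves convergence when a chain is
    intersected. *)
Definition cosets_of S R := [/\ is_subgroup S, closed S, (forall y, exists f, R y f) &
  forall y f, R y f -> forall g, R y g <-> S (f^-1 * g)].

Definition convergent R := forall U, onormal U ->
  exists ys : seq J, forall y, y \notin ys -> exists2 f, R y f & U f.

Definition good R := (exists S, cosets_of S R) /\ convergent R.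

Let cF : compact [set: F]. Proof. by case: pF. Qed.

Lemma closed_translate S (g : F) : closed S -> closed [set f | S (g^-1 * f)].
Proof.
move=> cS; rewrite -/((fun f => g^-1 * f) @^-1` S); apply: preimage_closed => // f _.
exact: mull_cts.
Qed.

(** By compactness some [S R] lies in U [S0], where [S0] is the intersection. A point of [R y] in U
    is then moved into the intersection of the cosets without leaving U. The index y0 serves to
    recover the subgroups from the cosets. *)
Lemma good_chain (K : set (J -> set F)) (y0 : J) : K !=set0 -> (forall R, K R -> good R) ->
  (forall R R', K R -> K R' -> (forall y, R y `<=` R' y) \/ (forall y, R' y `<=` R y)) ->
  good (fun y => \bigcap_(R in K) R y).
Proof.
move=> [R0 KR0] gK tK.
have /choice [S SP] : forall R, exists S, K R -> cosets_of S R.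
  move=> R; have [KR|nKR] := pselect (K R); last by exists set0.
  by have [[S h] _] := gK R KR; exists S.
have dir (R R' : {R | K R}) : exists R'' : {R | K R},
    (forall y, sval R'' y `<=` sval R y `&` sval R' y).
  case: R R' => R KR [R' KR']; have [h|h] := tK R R' KR KR'.
    by exists (exist _ R KR) => y f Rf; split=> //; exact: h.
  by exists (exist _ R' KR') => y f Rf; split=> //; exact: h.
have Rcl R y : K R -> closed (R y).
  move=> /SP [_ cS ne co]; have [f Rf] := ne y.
  have -> : R y = [set g | S R (f^-1 * g)] by apply/seteqP; split=> g /(co y f Rf).
  exact: closed_translate.
have ne y : exists f, forall R, K R -> R y f.
  have [i|i|i j|f hf] := @compact_directed F {R | K R} (fun i => sval i y) (exist _ R0 KR0) cF.
  - exact: Rcl (svalP i).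
  - by have [_ _ h _] := SP _ (svalP i); exact: h.
  - by have [k h] := dir i j; exists k; exact: h.
  - by exists f => R KR; exact: (hf (exist _ R KR)).
pose S0 := \bigcap_(R in K) S R.
have co y f : (forall R, K R -> R y f) -> forall g, (forall R, K R -> R y g) <-> S0 (f^-1 * g).
  move=> hf g; split=> h R KR; have [_ _ _ co] := SP R KR; first by apply/(co y f (hf R KR)); exact: h.
  by apply/(co y f (hf R KR)); exact: h.
have sS0 : is_subgroup S0.
  split=> [R /SP [[]]//|x y hx hy R KR|x hx R KR].
    by have [[_ h _] _ _ _] := SP R KR; apply: h; [exact: hx|exact: hy].
  by have [[_ _ h] _ _ _] := SP R KR; apply: h; exact: hx.
split.
  exists S0; split=> //; first by apply: closed_bigI => R /SP [].
move=> U oU; have nU := oU.1.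
have [R [KR SRU]] : exists R, K R /\ forall s, S R s -> exists2 t, S0 t & U (s * t^-1).
  apply: contrapT => nR.
  pose D (R : {R | K R}) := [set s | S (sval R) s /\ ~ exists2 t, S0 t & U (s * t^-1)].
  have [i|[R KR]|i j|s hs] := @compact_directed F {R | K R} D (exist _ R0 KR0) cF.
  - apply: closedI; first by have [] := SP _ (svalP i).
    apply: open_closedC.
    have -> : (fun s => exists2 t, S0 t & U (s * t^-1)) = \bigcup_(t in S0) ((fun s => s * t^-1) @^-1` U).
      by apply/seteqP; split=> s [t St Us]; exists t.
    apply: bigcup_open => t _; apply: open_comp; last by case: oU.
    by move=> x _; exact: mulr_cts.
  - apply: contrapT => h; apply: nR; exists R; split=> // s Ss.
    by apply: contrapT => ns; apply: h; exists s.
  - have [k h] := dir i j; exists k => s [Ss ns].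
    have [f Rf] : exists f, sval k y0 f by have [_ _ ne' _] := SP _ (svalP k).
    have Rfs : sval k y0 (f * s).
      by have [_ _ _ c] := SP _ (svalP k); apply/(c y0 f Rf); rewrite mulKg.
    have [h1 h2] := h y0 f Rf; have [h3 h4] := h y0 _ Rfs.
    split; split=> //.
      by have [_ _ _ c] := SP _ (svalP i); move/(c y0 f h1): h3; rewrite mulKg.
    by have [_ _ _ c] := SP _ (svalP j); move/(c y0 f h2): h4; rewrite mulKg.
  - have [_ ns] := hs (exist _ R0 KR0); apply: ns; exists s.
      by move=> R KR; have [] := hs (exist _ R KR).
    by rewrite mulgV; exact: nsub1.
have [ys hys] := (gK R KR).2 U oU; exists ys => y /hys [f Rf Uf].
have [r hr] := ne y.
have [_ _ _ c] := SP R KR.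
have /(c y f Rf)/SRU [t St Ut] := hr R KR.
exists (r * t^-1).
  apply/(co y r hr); rewrite mulKg; by case: sS0 => _ _; apply.
have -> : r * t^-1 = f * (f^-1 * r * t^-1) by rewrite !mulgA mulgV mul1g.
exact: nsubM.
Qed.

Lemma good_refine R U : good R -> onormal U ->
  exists R', [/\ good R', forall y, R' y `<=` R y & forall y f g, R' y f -> R' y g -> U (f^-1 * g)].
Proof.
move=> [[S [sS cS ne co]] cv] oU; have nU := oU.1; have [S1 SM SV] := sS.
(* The representative is taken in U whenever possible; otherwise cutting down to a coset of the
   intersection of S and U could destroy convergence. *)
have /choice [r rP] : forall y, exists f, R y f /\ ((exists2 g, R y g & U g) -> U f).
  move=> y; have [[g Rg Ug]|h] := pselect (exists2 g, R y g & U g); first by exists g.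
  by have [f Rf] := ne y; exists f.
pose R' y : set F := [set f | S ((r y)^-1 * f) /\ U ((r y)^-1 * f)].
exists R'; split; last first.
- move=> y f g [_ Uf] [_ Ug]; have := nsubM nU (nsubV nU Uf) Ug.
  by rewrite invgM invgK -mulgA mulKVg.
- by move=> y f [Sf _]; apply/(co y _ (rP y).1).
split.
  exists (S `&` U); split.
  - split; first by split=> //; exact: nsub1.
      by move=> x y [? ?] [? ?]; split; [exact: SM|exact: nsubM].
    by move=> x [? ?]; split; [exact: SV|exact: nsubV].
  - by apply: closedI => //; exact: onormal_closed.
  - by move=> y; exists (r y); rewrite /R' /= mulVg; split=> //; exact: nsub1.
  - move=> y f [Sf Uf] g; have e : (r y)^-1 * g = (r y)^-1 * f * (f^-1 * g) by rewrite -mulgA mulKVg.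
    have e' : f^-1 * g = ((r y)^-1 * f)^-1 * ((r y)^-1 * g) by rewrite invgM invgK -mulgA mulKVg.
    split=> -[Sg Ug].
      by split; rewrite e'; [apply: SM => //; exact: SV|apply: nsubM => //; exact: nsubV].
    by split; rewrite e; [exact: SM|exact: nsubM].
move=> V oV; have [ys hys] := cv _ (onormalI oU oV).
exists ys => y /hys [f Rf [Uf Vf]]; exists f => //; split.
  by apply/(co y _ (rP y).1).
by apply: nsubM => //; apply: nsubV => //; apply: (rP y).2; exists f.
Qed.

(** Zorn's lemma on the set X of removed pairs. By [good_refine] a minimal good family has every
    member inside a single coset of each U, so any choice from it converges. *)
Lemma convergent_section R : good R ->
  exists x : J -> F, (forall y, R y (x y)) /\ forall U, onormal U ->
    exists ys : seq J, forall y, y \notin ys -> U (x y).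
Proof.
move=> gR; have [[y0 _]|nJ] := pselect ([set: J] !=set0); last first.
  by exists (fun=> 1); split=> [y|U _]; [case: nJ; exists y|exists [::] => y _; case: nJ; exists y].
pose res (X : set (J * F)) y : set F := [set f | R y f /\ ~ X (y, f)].
have [K KP tK|X [gX maxX]] := @Zorn_bigcup (J * F)%type [set X | good (res X)].
  have [[X0 KX0]|K0] := pselect (K !=set0); last first.
    have -> : \bigcup_(X in K) X = set0 by apply/seteqP; split=> // z [X KX]; case: K0; exists X.
    rewrite /=; suff -> : res set0 = R by [].
    by apply/funext => y; apply/seteqP; split=> [f []//|f Rf]; split.
  rewrite /=.
  suff -> : good (res (\bigcup_(X in K) X)) = good (fun y => \bigcap_(Q in [set res X | X in K]) Q y).
    apply: good_chain => //; first by exists (res X0), X0.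
      by move=> _ [X KX <-]; exact: KP.
    move=> _ _ [X KX <-] [X' KX' <-]; have [h|h] := tK X X' KX KX'.
      by right=> y f [Rf nf]; split=> // Xf; apply: nf; exact: h.
    by left=> y f [Rf nf]; split=> // Xf; apply: nf; exact: h.
  congr good; apply/funext => y; apply/seteqP; split=> [f [Rf nf] _ [X KX <-]|f hf].
    by split=> // Xf; apply: nf; exists X.
  split; first by have [] : res X0 y f by apply: hf; exists X0.
  move=> [X KX Xf]; have [_] : res X y f by apply: hf; exists X.
  exact.
have small U : onormal U -> forall y f g, res X y f -> res X y g -> U (f^-1 * g).
  move=> oU y f g hf hg; have [R' [gR' R'X hR']] := good_refine gX oU.
  pose X' : set (J * F) := [set z | ~ R' z.1 z.2].
  have eR' : res X' = R'.
    apply/funext => z; apply/seteqP; split=> [h [_ /contrapT]//|h Rh].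
    by split; [exact: (R'X z h Rh).1|exact].
  have XX' : X `<=` X' by move=> [z h] Xh R'h; have [_] := R'X z h R'h.
  have X'X : X' `<=` X.
    apply: contrapT => n; apply: (maxX X'); last by rewrite /= eR'.
    by split=> // h; apply: n.
  have in' h : res X y h -> R' y h.
    by move=> [_ nX]; apply: contrapT => n; apply: nX; exact: X'X.
  by apply: (hR' y); exact: in'.
have [[S [_ _ ne _]] cv] := gX.
have /choice [x xP] := ne; exists x; split=> [y|U oU]; first by have [] := xP y.
have [ys hys] := cv U oU; exists ys => y /hys [f hf Uf].
have := small U oU y f (x y) hf (xP y) => h.
by rewrite -(mulKVg f (x y)); apply: nsubM => //; case: oU.
Qed.

End ConvergentSection.

Section DualSection.
Variables (p : nat) (F : topGroupType) (J : eqType) (C : set F) (chi : J -> F -> 'Z_p).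
Hypothesis pF : profinite_space F.
Hypotheses (sC : is_subgroup C) (cC : closed C).
Hypotheses (chiM : forall y, addhom (chi y)) (chi_lc : forall y, lc (chi y)).
Hypothesis dualC : forall y, exists f, C f /\ forall y', chi y' f = (y' == y)%:R%R.

(** The elements of C dual to y form a coset of the common kernel N of the chi in C. By compactness
    the common kernel in C of finitely many chi lies in U N, and it contains the elements dual to
    all other y; this gives convergence. *)
Lemma dual_section : exists x : J -> F,
  [/\ forall y, C (x y), forall y y', chi y' (x y) = (y' == y)%:R%R &
    forall U, onormal U -> exists ys : seq J, forall y, y \notin ys -> U (x y)].
Proof.
have [cF _ _] := pF; have [C1 CM CV] := sC.
pose N : set F := C `&` \bigcap_(y in [set: J]) [set f | chi y f = 0%R].
have NP f : N f <-> C f /\ forall y, chi y f = 0%R.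
  by split=> [[Cf h]|[Cf h]]; split=> // y; [exact: h|move=> _; exact: h].
have sN : is_subgroup N.
  split.
  - by apply/NP; split=> // y; exact: addhom1.
  - move=> f g /NP [Cf hf] /NP [Cg hg]; apply/NP; split; first exact: CM.
    by move=> y; rewrite chiM hf hg addr0.
  - move=> f /NP [Cf hf]; apply/NP; split; first exact: CV.
    by move=> y; rewrite addhomV // hf oppr0.
pose R y : set F := [set f | C f /\ forall y', chi y' f = (y' == y)%:R%R].
suff gR : good R.
  have [x [xR xU]] := convergent_section pF gR; exists x; split=> // y; first by have [] := xR y.
  by have [_ h] := xR y.
split.
  exists N; split=> //.
  - apply: closedI => //; apply: closed_bigI => y _.
    exact: (@lc_preimage_closed _ _ _ [set 0%R] (chi_lc y)).
  - move=> y f [Cf hf] g; rewrite NP; split=> -[Cg hg]; split.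
    + by apply: CM => //; exact: CV.
    + by move=> y'; rewrite chiM addhomV // hf hg addNr.
    + by rewrite -(mulKVg f g); exact: CM.
    + by move=> y'; rewrite -(mulKVg f g) chiM hg addr0 hf.
move=> U oU; have nU := oU.1.
pose UN := \bigcup_(n in N) ((fun f => f * n^-1) @^-1` U).
have oUN : open UN.
  apply: bigcup_open => n _; apply: open_comp; last by case: oU.
  by move=> x _; exact: mulr_cts.
pose D (ys : seq J) : set F := (C `&` ~` UN) `&` \bigcap_(y in [set y | y \in ys]) [set f | chi y f = 0%R].
have [ys Dys] : exists ys, forall f, ~ D ys f.
  apply: contrapT => nD.
  have [ys|ys|ys zs|f hf] := @compact_directed F (seq J) D [::] cF.
  - apply: closedI; first by apply: closedI => //; exact: open_closedC.
    by apply: closed_bigI => y _; exact: (@lc_preimage_closed _ _ _ [set 0%R] (chi_lc y)).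
  - by apply: contrapT => h; apply: nD; exists ys => f Df; apply: h; exists f.
  - exists (ys ++ zs) => f [h1 h2]; split; split=> // y /= hy; apply: h2; rewrite /= mem_cat hy ?orbT //.
  have [[Cf nUN] _] := hf [::]; apply: nUN; exists f; last by rewrite /= mulgV; exact: nsub1.
  apply/NP; split=> // y; have [_ h] := hf [:: y]; apply: h; by rewrite /= inE.
exists ys => y ny; have [f [Cf hf]] := dualC y.
have [n Nn Un] : UN f.
  apply: contrapT => nUN; apply: (Dys f); split=> // y' /= y'ys.
  by rewrite hf; case: eqP => // e; rewrite e (negPf ny) in y'ys.
have [Cn hn] := iffLR (NP n) Nn; exists (f * n^-1) => //; split; first by apply: CM => //; exact: CV.
by move=> y'; rewrite chiM addhomV // hn subr0 hf.
Qed.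

End DualSection.

Local Close Scope group_scope.
Local Open Scope ring_scope.

(** * Equivariant dual families and unipotence of restriction *)

Section EquivariantBasis.
Variables (p : nat) (F : topGroupType) (Y : eqType).
Hypotheses (pp : prime p) (ppF : pro_p_group p F).
Variable chi0 : Y -> F -> 'Z_p.
Hypothesis chi0M : forall y, addhom (chi0 y).
Hypothesis chi0_lc : forall y, lc (chi0 y).
Hypothesis chi_span : forall psi : F -> 'Z_p, addhom psi -> lc psi ->
  exists (ys : seq Y) (c : Y -> nat), forall x, psi x = \sum_(y <- ys) chi0 y x *+ c y.
Variables (Ga : finGroupType) (actF : Ga -> F -> F) (yact : Ga -> Y -> Y).
Hypothesis pGa : (p.-group [set: Ga]%SET)%g.
Hypothesis actFM : forall a, {morph actF a : x y / (x * y)%g}.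
Hypothesis actFc : forall a, continuous (actF a).
Hypothesis actF1 : forall x, actF 1%g x = x.
Hypothesis actFA : forall a b x, actF (a * b)%g x = actF a (actF b x).
Hypothesis yact1 : forall y, yact 1%g y = y.
Hypothesis yactA : forall a b y, yact (a * b)%g y = yact a (yact b y).
Hypothesis chi_act : forall a y x, chi0 (yact a y) (actF a x) = chi0 y x.

Definition fixedby (A : {set Ga}) y := [forall a in A, yact a y == y].

Hypothesis fixed_dual : forall (A : {group Ga}) y0, fixedby A y0 ->
  exists f, (forall a, a \in A -> actF a f = f) /\
    forall y, fixedby A y -> chi0 y f = (y == y0)%:R.

Local Notation GA := [set: Ga]%G.
Local Notation St y := (stab yact GA y).

Lemma section_fixed (A : {group Ga}) : exists x : Y -> F,
  [/\ forall y a, a \in A -> actF a (x y) = x y,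
      forall y y', fixedby A y -> fixedby A y' -> chi0 y' (x y) = (y' == y)%:R &
      forall U, onormal U -> exists ys : seq Y, forall y, y \notin ys -> U (x y)].
Proof.
pose J := {y : Y | fixedby A y}.
pose C : set F := [set f | forall a, a \in A -> actF a f = f].
have [cF hF _] := ppF.1.
have [|||||x [xC xd xU]] := @dual_section p F J C (fun y => chi0 (val y)) ppF.1.
- split.
  + by move=> a _; exact: morph1_grp (actFM a).
  + by move=> f g hf hg a aA; rewrite actFM hf ?hg.
  + by move=> f hf a aA; rewrite (morphV_grp (actFM a)) hf.
- have -> : C = \bigcap_(a in [set a | a \in A]) [set f | (f^-1 * actF a f)%g = 1%g].
    apply/seteqP; split=> f h a aA; first by rewrite /= h ?mulVg.
    by have /= e := h a aA; apply: (mulgI f^-1%g); rewrite e mulVg.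
  apply: closed_bigI => a _; rewrite -/((fun f => f^-1 * actF a f)%g @^-1` [set 1%g]).
  apply: preimage_closed; last by apply: accessible_closed_set1; exact: hausdorff_accessible.
  by move=> f _; apply: mulg_cts; [apply: invg_cts => z; exact: cvg_id|exact: actFc].
- by move=> y; exact: chi0M.
- by move=> y; exact: chi0_lc.
- move=> [y0 fy0]; have [f [hf hd]] := fixed_dual fy0; exists f; split=> // -[y fy] /=.
  by rewrite hd // -val_eqE.
exists (fun y => if insub y is Some j then x j else 1%g); split.
- move=> y a aA; case: insubP => [j _ _|_]; first exact: xC.
  exact: morph1_grp (actFM a).
- move=> y y' fy fy'; rewrite (insubT (fixedby A) fy).
  by have := xd (Sub y fy) (Sub y' fy'); rewrite -val_eqE.
- move=> U oU; have [js hj] := xU U oU; exists (map val js) => y ny.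
  case: insubP => [j fy e|_]; last by apply: nsub1; case: oU.
  by apply: hj; apply: contra ny => h; rewrite -e map_f.
Qed.

(** On an orbit representative take the element fixed by its stabilizer, then transport it along the
    orbit. Convergence survives because only finitely many subgroups and translations occur. *)
Lemma equivariant_section : exists x : Y -> F,
  [/\ forall a y, actF a (x y) = x (yact a y),
      forall y y', (forall a, yact a y = y -> yact a y' = y') -> chi0 y' (x y) = (y' == y)%:R &
      forall U, onormal U -> exists ys : seq Y, forall y, y \notin ys -> U (x y)].
Proof.
have /choice [x0 x0P] := section_fixed.
have [[yd _]|nY] := pselect ([set: Y] !=set0); last first.
  by exists (fun=> 1%g); split=> [a y|y|U _]; try (by case: nY; exists y); exists [::] => y; case: nY; exists y.
have /choice [f fP] : forall S : set Y, exists v, S !=set0 -> S v.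
  by move=> S; have [[v Sv]|nS] := pselect (S !=set0); [exists v|exists yd].
pose rep y := f [set v | v \in orb yact GA y].
have repA a y : rep (yact a y) = rep y.
  rewrite /rep; congr f; have h : yact a y \in orb yact GA y.
    by apply/orbP; exists a => //; exact: finset.in_setT.
  apply/seteqP; split=> v /= hv; first exact: (orb_trans yactA h hv).
  exact: (orb_trans yactA (orb_sym yact1 yactA h) hv).
have repO y : rep y \in orb yact GA y.
  by apply: (fP [set v | v \in orb yact GA y]); exists y; exact: (orb_refl yact1).
have /choice [g gP] : forall y, exists a, y = yact a (rep y).
  by move=> y; have /orbP [a _ ->] := repO y; exists a^-1%g; rewrite -yactA mulVg yact1.
pose St y := stab_group yact1 yactA GA y.
have StP a y : (a \in St y) = (yact a y == y) by rewrite inE finset.in_setT.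
have fSt y : fixedby (St y) y by apply/forall_inP => a; rewrite StP.
pose xr y := x0 (St (rep y)) (rep y).
exists (fun y => actF (g y) (xr y)); split.
- move=> a y; rewrite /xr repA -actFA.
  have -> : (a * g y = g (yact a y) * ((g (yact a y))^-1 * (a * g y)))%g by rewrite mulKVg.
  rewrite actFA; congr actF; have [h _ _] := x0P (St (rep y)); apply: h; rewrite StP.
  have e := gP (yact a y); rewrite repA in e.
  rewrite yactA; apply/eqP; rewrite yactA -gP {2}e -yactA mulVg yact1 //.
- move=> y y' h.
  have -> : chi0 y' (actF (g y) (xr y)) = chi0 (yact (g y)^-1%g y') (xr y).
    by rewrite -{1}(yact1 y') -(mulgV (g y)) yactA chi_act.
  have [_ hd _] := x0P (St (rep y)); rewrite hd //.
    congr (nat_of_bool _)%:R; apply/eqP/eqP => [e|->]; first by rewrite (gP y) -e -yactA mulgV yact1.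
    by rewrite {2}(gP y) -yactA mulVg yact1.
  apply/forall_inP => a; rewrite StP => /eqP ha; apply/eqP.
  have e : yact (g y * a * (g y)^-1)%g y = y.
    have e0 : yact (g y)^-1%g y = rep y by rewrite {2}(gP y) -yactA mulVg yact1.
    by rewrite !yactA e0 ha -gP.
  by rewrite -[in RHS](h _ e) -!yactA !mulgA mulVg mul1g.
- move=> U oU; have [U' [oU' sU' U'U]] := stable_core actFM actFc actF1 actFA oU.
  have /choice [yA yAP] : forall A : {group Ga}, exists ys : seq Y, forall y, y \notin ys -> U' (x0 A y).
    by move=> A; have [_ _ h] := x0P A; exact: h.
  exists (flatten [seq orb yact GA v | v <- flatten [seq yA A | A <- enum {: {group Ga}}]]).
  move=> y ny; apply/U'U/sU'; apply: yAP; apply: contra ny => h; apply/flatten_mapP.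
  exists (rep y); last exact: (orb_sym yact1 yactA (repO y)).
  by apply/flatten_mapP; exists (St (rep y)) => //; rewrite mem_enum.
Qed.

Variable x : Y -> F.
Hypothesis x_act : forall a y, actF a (x y) = x (yact a y).
Hypothesis x_dual : forall y y', (forall a, yact a y = y -> yact a y' = y') -> chi0 y' (x y) = (y' == y)%:R.
Hypothesis x_cvg : forall U, onormal U -> exists ys : seq Y, forall y, y \notin ys -> U (x y).

Let V := Y -> 'Z_p.
Let vact (a : Ga) (l : V) : V := fun y => l (yact a^-1%g y).

Let vact1 l : vact 1%g l = l.
Proof. by apply/funext => y; rewrite /vact invg1 yact1. Qed.
Let vactM a b l : vact (a * b)%g l = vact a (vact b l).
Proof. by apply/funext => y; rewrite /vact invMg yactA. Qed.
Let vactD a (l l' : V) : vact a (l + l') = vact a l + vact a l'.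
Proof. by []. Qed.

Let Zp0 (v : 'Z_p) : v *+ p = 0. Proof. by rewrite -mulr_natr char_Zp ?mulr0 ?prime_gt1. Qed.

Definition lam (ys : seq Y) (l : V) : F -> 'Z_p := fun f => \sum_(y <- ys) l y * chi0 y f.

Lemma lam_addhom ys l : addhom (lam ys l).
Proof. by move=> f g; rewrite /lam -big_split; apply: eq_bigr => y _; rewrite chi0M mulrDr. Qed.

Lemma lam_lc ys l : lc (lam ys l).
Proof. by apply: lc_sum => y _; exact: (lc_comp (fun r => l y * r)). Qed.

Lemma lamB ys l l' f : lam ys (l - l') f = lam ys l f - lam ys l' f.
Proof. by rewrite /lam -sumrB; apply: eq_bigr => y _; rewrite -mulrBl. Qed.

Definition stableseq (ys : seq Y) := uniq ys /\ forall a y, y \in ys -> yact a y \in ys.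

Lemma lam_act a ys l f : stableseq ys -> lam ys (vact a l) (actF a f) = lam ys l f.
Proof.
move=> [uys sys]; have pys : perm_eq (map (yact a) ys) ys.
  apply: uniq_perm; rewrite ?(map_inj_uniq (gact_inj yact1 yactA (g:=a))) // => y.
  apply/mapP/idP => [[z zs ->]|ys_y]; first exact: sys.
  by exists (yact a^-1%g y); [exact: sys|rewrite -yactA mulgV yact1].
rewrite /lam -(perm_big _ pys) big_map; apply: eq_bigr => y _.
by rewrite chi_act /vact -yactA mulVg yact1.
Qed.

(** The summands are constant on orbits of the stabilizer of y, so only the z fixed by it count
    modulo p; for these [x_dual] applies. *)
Lemma lam_fixed ys l y : stableseq ys -> (forall z, z \notin ys -> l z = 0) ->
  (forall a, vact a l = l) -> lam ys l (x y) = l y.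
Proof.
move=> [uys sys] l0 fl; pose A := stab_group yact1 yactA GA y.
have AP a : (a \in A) = (yact a y == y) by rewrite inE finset.in_setT.
have pA : (p.-group A)%g := pgroupS (finset.subsetT A) pGa.
have lA a z : l (yact a z) = l z by rewrite -{1}(fl a) /vact -yactA mulVg yact1.
rewrite /lam (sum_fix yact1 yactA pp pA Zp0 uys); last first.
- move=> a z; rewrite AP => /eqP ay _; rewrite lA; congr (_ * _).
  by rewrite -{1}ay -x_act chi_act.
- by move=> a z _; exact: sys.
transitivity (\sum_(z <- ys | fixedby A z) (if z == y then l y else 0)).
  apply: eq_bigr => z /forall_inP fz; rewrite x_dual.
    by case: eqP => [->|]; rewrite ?mulr1 ?mulr0.
  by move=> a ay; apply/eqP/fz; rewrite AP ay.
rewrite -big_mkcondr /=; have [yys|nys] := boolP (y \in ys).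
  rewrite (eq_bigl (pred1 y)) => [|z /=].
    by rewrite -big_filter filter_pred1_uniq // big_seq1.
  case: eqP => [->|]; last by rewrite andbF.
  by rewrite andbT; apply/forall_inP => a; rewrite AP.
rewrite l0 // big1_seq // => z /andP [_ zys].
Qed.

(** Restriction to x is equivariant and, by [lam_fixed], the identity on invariants. So restriction
    minus the identity lowers the socle degree. *)
Lemma lam_soc k ys l : stableseq ys -> (forall z, z \notin ys -> l z = 0) ->
  soc vact k.+1 l -> soc vact k (fun y => lam ys l (x y) - l y : 'Z_p).
Proof.
move=> hys; elim: k l => [|k IHk] l l0 hl.
  apply/funext => y; rewrite lam_fixed ?subrr // => a; apply/eqP; rewrite -subr_eq0.
  by apply/eqP; exact: hl.
move=> a; have := IHk (vact a l - l) _ (hl a).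
have -> : (fun y => lam ys (vact a l - l) (x y) - (vact a l - l) y : 'Z_p) =
    vact a (fun y => lam ys l (x y) - l y) - (fun y => lam ys l (x y) - l y).
  apply/funext => y; rewrite lamB -[(vact a _ - _) y]/(vact a _ y - _).
  rewrite -[in lam ys (vact a l) (x y)](yact1 y) -(mulgV a) yactA -x_act lam_act //.
  rewrite -[RHS]/(lam ys l (x (yact a^-1%g y)) - l (yact a^-1%g y) - (lam ys l (x y) - l y)) /vact.
  by ring.
apply=> z nz; rewrite -[(_ - _) z]/(vact a l z - l z) /vact !l0 ?subrr //.
by apply: contra nz => h; have := hys.2 a _ h; rewrite -yactA mulgV yact1.
Qed.

Let Vp (v : V) : v *+ (p ^ 1) = 0.
Proof. by apply/funext => y; rewrite natmulfctE; exact: Zp0. Qed.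

Let soc_all := p_group_nilpotent (N := 0) pp pGa vact1 vactM vactD Vp.

Lemma stable_hull (ys : seq Y) : exists2 zs, stableseq zs & {subset ys <= zs}.
Proof.
exists (undup (flatten [seq orb yact GA y | y <- ys])).
  split=> [|a y]; first exact: undup_uniq.
  rewrite !mem_undup => /flatten_mapP [z zs hz]; apply/flatten_mapP; exists z => //.
  apply: (orb_trans yactA hz); apply/orbP; exists a => //; exact: finset.in_setT.
by move=> y yys; rewrite mem_undup; apply/flatten_mapP; exists y => //; exact: (orb_refl yact1).
Qed.

(** If psi vanishes on x, the error in [lam_soc] is -l, so l descends through the socle filtration
    to 0. *)
Lemma hom_inj psi : addhom psi -> lc psi -> (forall y, psi (x y) = 0 :> 'Z_p) -> forall f, psi f = 0.
Proof.
move=> hM hl h0; have [ys0 [c hc]] := chi_span hM hl; have [ys sys sub] := stable_hull ys0.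
pose l y : 'Z_p := \sum_(z <- ys0 | z == y) (c z)%:R.
have l0 z : z \notin ys -> l z = 0.
  move=> nz; rewrite /l big1_seq // => z' /andP [/eqP -> /sub h]; by rewrite h in nz.
have psiE f : psi f = lam ys l f.
  rewrite hc /lam; transitivity (\sum_(y <- ys) \sum_(z <- ys0 | z == y) (c z)%:R * chi0 z f).
    rewrite (exchange_big_dep xpredT) //= big_seq [RHS]big_seq; apply: eq_bigr => z zys.
    rewrite (eq_bigl (fun y => y == z)); last by move=> y; rewrite eq_sym.
    by rewrite -big_filter filter_pred1_uniq ?sub ?sys.1 // big_seq1 mulr_natl.
  by apply: eq_bigr => y _; rewrite /l mulr_suml; apply: eq_bigr => z /eqP ->.
suff l00 : l = 0 by move=> f; rewrite psiE /lam big1 // => y _; rewrite l00 mul0r.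
have [K hK] := soc_all.
suff h k : soc vact k l -> l = 0 by exact: h (hK l).
elim: k => [//|k IHk] /(lam_soc sys l0); rewrite (_ : (fun y => _) = - l).
  move=> h; apply: IHk; rewrite -(opprK l); apply: (socN vactD) => //.
by apply/funext => y; rewrite -psiE h0 sub0r.
Qed.

(** [lam zs l] solves the problem up to an error of smaller socle degree, which is corrected by
    induction. The error has finite support because x converges to 1. *)
Lemma hom_surj (l : V) (ys : seq Y) : (forall z, z \notin ys -> l z = 0) ->
  exists psi : F -> 'Z_p, [/\ addhom psi, lc psi & forall y, psi (x y) = l y].
Proof.
have [K hK] := soc_all; have : soc vact K l := hK l.
elim: K l ys {hK} => [|k IHk] l ys.
  by move=> /= -> _; exists (fun=> 0); split=> //; [move=> f g; rewrite addr0|exact: lc_cst].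
move=> hl l0; have [zs szs sub] := stable_hull ys.
have l0z z : z \notin zs -> l z = 0 by move=> nz; apply: l0; apply: contra nz; exact: sub.
have h := lam_soc szs l0z hl; set l' := (fun y => _) in h.
have [us hus] : exists us : seq Y, forall y, y \notin us -> lam zs l (x y) = 0.
  have [W [oW hW]] := lam_lc zs l; have [us hus] := x_cvg oW; exists us => y /hus Wx.
  by rewrite -[x y]mul1g hW // (addhom1 (@lam_addhom zs l)).
have [|psi [pM pl pe]] := IHk l' (zs ++ us) h.
  by move=> z; rewrite mem_cat => /norP [h1 h2]; rewrite /l' hus // l0z // subrr.
exists (fun f => lam zs l f - psi f); split.
- by apply: addhomB => //; exact: lam_addhom.
- by apply: (@lc_op _ _ _ _ (fun a b => a - b)) => //; exact: lam_lc.
- by move=> y; rewrite pe /l' opprB addrC subrK.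
Qed.

End EquivariantBasis.

Local Close Scope ring_scope.
Local Open Scope group_scope.

Lemma central_extension (p : nat) (L : finGroupType) : prime p ->
  p.-group [set: L]%SET -> (1 < #|L|)%N ->
  exists (M : finGroupType) (pi : L -> M) (z : 'Z_p -> L),
  [/\ [/\ {morph pi : x y / x * y}, forall y, exists x, pi x = y,
      p.-group [set: M]%SET & (#|M| < #|L|)%N],
      forall r s, z (r + s)%R = z r * z s, injective z, forall r u, z r * u = u * z r &
      forall u v, pi u = pi v -> exists r, v = u * z r].
Proof.
move=> pp pL L1; have p1 := prime_gt1 pp.
have ntL : [set: L]%G :!=: 1 by rewrite -cardG_gt1 cardsT.
have ntZ : 'Z([set: L]%G) != 1 by rewrite center_nil_eq1 // (pgroup_nil pL).
have pZ : p.-group 'Z([set: L]%G) := pgroupS (center_sub _) pL.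
have [_ pdZ _] := pgroup_pdiv pZ ntZ.
have [x Zx ox] := Cauchy pp pdZ.
have xC u : x * u = u * x.
  by move/centerP: Zx => [_ h]; exact: h (finset.in_setT u).
have nX : <[x]> <| [set: L]%G by apply: sub_center_normal; rewrite cycle_subG.
have NT u : u \in 'N(<[x]>) by case/andP: nX => _ /fintype.subsetP; apply; exact: finset.in_setT.
have eT : [set: coset_of (<[x]>)]%SET = ([set: L]%G / <[x]>).
  apply/setP => b; rewrite finset.in_setT; apply/esym; have [u Nu ->] := cosetP b.
  by apply: mem_quotient; exact: finset.in_setT.
exists (coset_of <[x]>), (coset <[x]>), (fun r => x ^+ nat_of_ord r).
split.
- split.
  + by move=> u v; exact: morphM.
  + by move=> b; have [u Nu ->] := cosetP b; exists u.
  + by rewrite eT; exact: quotient_pgroup.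
  + rewrite -!cardsT eT; apply: ltn_quotient; last exact: finset.subsetT.
    by rewrite -cardG_gt1 -orderE ox.
- move=> r s; rewrite -expgD -[in RHS]expg_mod_order ox.
  by congr (x ^+ _); rewrite /= [X in _ %% X]Zp_cast.
- move=> r s /eqP; rewrite eq_expg_mod_order ox => /eqP h; apply/val_inj => /=.
  have lt (t : 'Z_p) : (t < p)%N by have := ltn_ord t; rewrite [X in (_ < X)%N -> _]Zp_cast.
  by move: h; rewrite !modn_small.
- move=> r u; apply: commute_sym; apply: commuteX; exact: commute_sym (xC u).
- move=> u v e; have [z /cycleP [i ->] ->] := kercoset_rcoset (NT v) (NT u) (esym e).
  exists i%:R%R; rewrite Zp_nat /= [X in _ %% X]Zp_cast // -[in RHS]ox expg_mod_order.
  by apply: commute_sym; apply: commuteX; exact: commute_sym (xC u).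
Qed.

(** * Extension of maps on the basis to finite p-groups *)

Section FinitePGroups.
Variables (p : nat) (F : topGroupType) (Y : eqType).
Hypothesis pp : prime p.
Hypothesis liftF : forall (E Q : finGroupType) (f : E -> Q) (q : F -> Q),
  {morph f : x y / x * y} -> (forall y, exists x, f x = y) ->
  p.-group [set: E]%SET -> p.-group [set: Q]%SET ->
  {morph q : x y / x * y} -> lc q ->
  exists e : F -> E, [/\ {morph e : x y / x * y}, lc e & forall x, f (e x) = q x].
Variable x : Y -> F.
Hypothesis x_cvg : forall U, onormal U -> exists ys : seq Y, forall y, y \notin ys -> U (x y).
Hypothesis hom_inj : forall psi : F -> 'Z_p, addhom psi -> lc psi ->
  (forall y, psi (x y) = 0%R) -> forall f, psi f = 0%R.
Hypothesis hom_surj : forall (l : Y -> 'Z_p) (ys : seq Y), (forall z, z \notin ys -> l z = 0%R) ->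
  exists psi : F -> 'Z_p, [/\ addhom psi, lc psi & forall y, psi (x y) = l y].

Let card1 (L : finGroupType) (u v : L) : ~~ (1 < #|L|)%N -> u = v.
Proof.
rewrite -leqNgt => h; apply/eqP; apply: contraLR h => ne; rewrite -ltnNge.
by apply: leq_trans (max_card (pred2 u v)); rewrite card2 ne.
Qed.

(** Modulo a central subgroup of order p the two maps agree by induction, so they differ by a
    homomorphism to Z/p that vanishes on x. *)
Lemma basis_uniq (L : finGroupType) (g g' : F -> L) : p.-group [set: L]%SET ->
  {morph g : x y / x * y} -> {morph g' : x y / x * y} -> lc g -> lc g' ->
  (forall y, g (x y) = g' (x y)) -> forall f, g f = g' f.
Proof.
move: {2}#|L| (leqnn #|L|) => n; elim: n L g g' => [|n IHn] L g g' Ln pL gM gM' lg lg' gx f.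
  by apply: card1; rewrite -leqNgt; apply: leq_trans Ln _.
have [L1|nL1] := boolP (1 < #|L|)%N; last exact: card1.
have [M [pi [z [[piM piS pM ML] zD zI zC zP]]]] := central_extension pp pL L1.
have h f' : exists r, g' f' = g f' * z r.
  apply: zP; apply: (IHn M (pi \o g) (pi \o g')) => //.
  - by rewrite -ltnS; exact: leq_trans ML Ln.
  - by move=> u v /=; rewrite gM piM.
  - by move=> u v /=; rewrite gM' piM.
  - exact: lc_comp.
  - exact: lc_comp.
  - by move=> y /=; rewrite gx.
have {h}/choice [psi hpsi] := h.
have z0 : z 0%R = 1 by apply: (mulgI (z 0%R)); rewrite -zD addr0 mulg1.
rewrite hpsi hom_inj ?z0 ?mulg1 //.
- move=> u v; apply: zI; apply: (mulgI (g (u * v))); rewrite -hpsi gM' !hpsi gM zD.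
  by rewrite -!mulgA; congr (_ * _); rewrite !mulgA zC.
- have [W [oW hW]] := lc_pair lg lg'; exists W; split=> // u w Ww.
  apply: zI; apply: (mulgI (g (u * w))); rewrite -hpsi.
  by have [-> ->] := hW u w Ww; rewrite -hpsi.
- by move=> y; apply: zI; apply: (mulgI (g (x y))); rewrite -hpsi z0 mulg1 gx.
Qed.

(** Lift the map found for a central quotient by freeness. Its error on x takes central values and
    is trivial almost everywhere, so [hom_surj] provides a homomorphism that corrects it. *)
Lemma basis_exists (L : finGroupType) (l : Y -> L) (ys : seq Y) : p.-group [set: L]%SET ->
  (forall y, y \notin ys -> l y = 1) ->
  exists g : F -> L, [/\ {morph g : x y / x * y}, lc g & forall y, g (x y) = l y].
Proof.
move: {2}#|L| (leqnn #|L|) => n; elim: n L l => [|n IHn] L l Ln pL l1.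
  exists (fun=> 1); split=> [u v|| y]; [by rewrite mulg1|exact: lc_cst|].
  by apply: card1; rewrite -leqNgt; apply: leq_trans Ln _.
have [L1|nL1] := boolP (1 < #|L|)%N; last first.
  exists (fun=> 1); split=> [u v|| y]; [by rewrite mulg1|exact: lc_cst|exact: card1].
have [M [pi [z [[piM piS pM ML] zD zI zC zP]]]] := central_extension pp pL L1.
have z0 : z 0%R = 1 by apply: (mulgI (z 0%R)); rewrite -zD addr0 mulg1.
have [|||g0 [g0M lg0 g0x]] := IHn M (pi \o l) => //.
- by rewrite -ltnS; exact: leq_trans ML Ln.
- by move=> y ny /=; rewrite l1 // (morph1_grp piM).
have [e [eM le pe]] := liftF piM piS pL pM g0M lg0.
have /choice [r hr] : forall y, exists r, l y = e (x y) * z r.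
  by move=> y; apply: zP; rewrite pe g0x.
have [W [oW hW]] := le; have [us hus] := x_cvg oW.
have [|psi [pM' pl px]] := hom_surj (l := r) (ys := ys ++ us).
  move=> y; rewrite mem_cat => /norP [h1 h2]; apply: zI; rewrite z0.
  have := hr y; rewrite l1 // -[x y]mul1g hW; last exact: hus.
  by rewrite (morph1_grp eM) mul1g.
exists (fun f => e f * z (psi f)); split.
- move=> u v; rewrite eM pM' zD -!mulgA; congr (_ * _); by rewrite !mulgA zC.
- exact: (lc_op (fun a b => a * z b) le pl).
- by move=> y; rewrite px -hr.
Qed.

End FinitePGroups.

(** * Characters of Z_p[[X, pt]] *)

Local Close Scope group_scope.
Local Open Scope ring_scope.

Section LocallyConstantSpace.
Variable X : topologicalType.

Definition lcs (T : Type) (g : X -> T) := forall x, nbhs x [set y | g y = g x].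

Lemma lcs_cst T (t : T) : lcs (fun=> t).
Proof. by move=> x; apply: filterS filterT. Qed.

Lemma lcs_comp T T' (f : T -> T') g : lcs g -> lcs (f \o g).
Proof. by move=> h x; apply: filterS (h x) => y /= ->. Qed.

Lemma lcs_op T T' T'' (op : T -> T' -> T'') f g : lcs f -> lcs g -> lcs (fun x => op (f x) (g x)).
Proof. by move=> hf hg x; apply: filterS2 (hf x) (hg x) => y /= -> ->. Qed.

Lemma lcs_ffun (I : finType) T (f : I -> X -> T) : (forall i, lcs (f i)) ->
  lcs (fun x => [ffun i => f i x]).
Proof.
move=> h x; have h' : nbhs x (fun y => forall i, f i y = f i x).
  by apply: filter_forall => i; exact: h.
apply: filterS h' => y hy /=; by apply/ffunP => i; rewrite !ffunE hy.
Qed.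

Lemma lcs_sum (I : Type) (V : nmodType) (s : seq I) (g : I -> X -> V) :
  (forall i, lcs (g i)) -> lcs (fun x => \sum_(i <- s) g i x).
Proof.
move=> h; elim: s => [|i s IHs] x.
  by apply: filterS filterT => y _ /=; rewrite !big_nil.
by apply: filterS2 (h i x) (IHs x) => y /= e1 e2; rewrite !big_cons e1 e2.
Qed.

Lemma lcs_open T (g : X -> T) (B : set T) : lcs g -> open (g @^-1` B).
Proof. by move=> lg; rewrite openE => x Bx; apply: filterS (lg x) => y /= ->. Qed.

Lemma lcs_closed T (g : X -> T) (B : set T) : lcs g -> closed (g @^-1` B).
Proof. by move=> lg; rewrite -(setCK (_ @^-1` _)); apply: open_closedC; exact: (@lcs_open _ _ (~` B)). Qed.

Lemma lcs_precomp (X' : topologicalType) (a : X' -> X) T (g : X -> T) :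
  continuous a -> lcs g -> forall x, nbhs x [set y | g (a y) = g (a x)].
Proof. by move=> ca hg x; exact: (ca x _ (hg (a x))). Qed.

Lemma cts_lcs (T : choiceType) (g : X -> T) : continuous (g : X -> discrete_topology T) -> lcs g.
Proof. by move=> cg x; apply: (cg x [set g x]); exact: discrete_set1. Qed.

Lemma lcs_cts (T : choiceType) (g : X -> T) : lcs g -> continuous (g : X -> discrete_topology T).
Proof. by move=> h x B /nbhs_singleton Bx; apply: filterS (h x) => y /= ->. Qed.

Variable pt : X.

Lemma finQuotient_of (T : finType) (g : X -> T) : lcs g ->
  exists (q : finQuotient pt) (r : 'I_(fq_size q).+1 -> T), forall x, r (q x) = g x.
Proof.
move=> lg; pose im := [seq t <- enum T | `[< exists x, g x = t >] && (t != g pt)].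
(* The value at pt comes first, so that the base point is numbered 0. *)
pose e := g pt :: im; have ue : uniq e by rewrite /= mem_filter eqxx andbF filter_uniq ?enum_uniq.
have ge x : g x \in e.
  rewrite inE mem_filter mem_enum andbT; case: eqP => //= _; rewrite andbT.
  by apply/asboolP; exists x.
pose q x : 'I_(size im).+1 := inord (index (g x) e).
have qE x : q x = index (g x) e :> nat by rewrite inordK // index_mem.
have lq : lcs q by exact: (lcs_comp (fun t => inord (index t e))).
have sq y : exists x, q x = y.
  have : nth (g pt) e y \in e by rewrite mem_nth.
  rewrite inE => /orP [/eqP h|].
    by exists pt; apply/val_inj; rewrite [LHS]qE -h index_uniq.
  rewrite mem_filter => /andP [/andP [/asboolP [x hx] _] _]; exists x; apply/val_inj.
  by rewrite [LHS]qE hx index_uniq.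
have q0 : q pt = ord0 by apply/val_inj; rewrite [LHS]qE /= eqxx.
exists (FinQuotient (lcs_cts lq) sq q0), (fun y => nth (g pt) e y) => x /=.
by rewrite qE nth_index.
Qed.

Lemma finQuotient_refine (q q' : finQuotient pt) :
  exists (r : finQuotient pt) (r1 : 'I_(fq_size r).+1 -> 'I_(fq_size q).+1)
     (r2 : 'I_(fq_size r).+1 -> 'I_(fq_size q').+1),
    (forall x, r1 (r x) = q x) /\ (forall x, r2 (r x) = q' x).
Proof.
have lq := cts_lcs (@fq_continuous _ _ q); have lq' := cts_lcs (@fq_continuous _ _ q').
have [r [s hs]] := finQuotient_of (lcs_op pair lq lq').
by exists r, (fst \o s), (snd \o s); split=> x /=; rewrite hs.
Qed.

End LocallyConstantSpace.

Lemma coord_continuous (I : Type) (K : I -> topologicalType) (i : I) :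
  continuous (fun f : prod_topology K => f i).
Proof. exact: (@proj_continuous {classic I} K i). Qed.

Section Zpx.
Variables (p : nat) (X : topologicalType) (pt : X).
Hypothesis pp : prime p.
Implicit Types (q : finQuotient pt) (c : zpx p pt).

Lemma padic_coef_sum (I : Type) (s : seq I) (P : pred I) (f : I -> padic p) k :
  padic_coef (\sum_(i <- s | P i) f i) k = \sum_(i <- s | P i) padic_coef (f i) k.
Proof. by elim/big_rec2: _ => // i u v _ <-. Qed.

Definition zc c q z N : 'Z_(p ^ N.+1) := padic_coef (zpx_coef c q z) N.
Arguments zc c q z N : clear implicits.

Lemma zcD c c' q z N : zc (c + c') q z N = zc c q z N + zc c' q z N. Proof. by []. Qed.
Lemma zcN c q z N : zc (- c) q z N = - zc c q z N. Proof. by []. Qed.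
Lemma zc_sum (I : Type) (s : seq I) (P : pred I) (f : I -> zpx p pt) q z N :
  zc (\sum_(i <- s | P i) f i) q z N = \sum_(i <- s | P i) zc (f i) q z N.
Proof. by elim/big_rec2: _ => // i u v _ <-. Qed.
Lemma zcMn c n q z N : zc (c *+ n) q z N = zc c q z N *+ n.
Proof. by elim: n => // n IHn; rewrite !mulrS zcD IHn. Qed.
Lemma zc_ord0 c q N : zc c q ord0 N = 0.
Proof. by rewrite /zc zpx_coef0. Qed.

Lemma zc_compat c q q' (r : 'I_(fq_size q).+1 -> 'I_(fq_size q').+1) N :
  (forall x, r (q x) = q' x) -> forall y, y != ord0 ->
  zc c q' y N = \sum_(z | r z == y) zc c q z N.
Proof. by move=> h y y0; rewrite /zc (zpx_coef_compat c h y0) padic_coef_sum. Qed.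

Lemma zc_continuous q z N : continuous ((fun c => zc c q z N) : zpx p pt -> discrete_topology 'Z_(p ^ N.+1)).
Proof.
have cv (T : topologicalType) (A : set T) : continuous (val : set_type A -> T) by exact: initial_continuous.
move=> c; rewrite /zc /padic_coef /zpx_coef.
pose f1 (c : zpx p pt) : zpx_family p pt := val c.
pose f2 (d : zpx_family p pt) : prod_topology (fun _ : 'I_(fq_size q).+1 => padic p) := d q.
pose f3 (d : prod_topology (fun _ : 'I_(fq_size q).+1 => padic p)) : padic p := d z.
pose f4 (d : padic p) : padic_seq p := val d.
pose f5 (d : padic_seq p) : discrete_topology 'Z_(p ^ N.+1) := d N.
have c1 : continuous f1 by exact: cv.
have c2 : continuous f2 by exact: coord_continuous.
have c3 : continuous f3 by exact: coord_continuous.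
have c4 : continuous f4 by exact: cv.
have c5 : continuous f5 by exact: coord_continuous.
rewrite -[X in continuous_at _ X]/(f5 \o (f4 \o (f3 \o (f2 \o f1)))).
apply: continuous_comp; last exact: c5.
apply: continuous_comp; last exact: c4.
apply: continuous_comp; last exact: c3.
by apply: continuous_comp; [exact: c1|exact: c2].
Qed.

Lemma zc_lcs q z N : lcs (fun c => zc c q z N).
Proof. exact/cts_lcs/zc_continuous. Qed.

Lemma zc_eq0_le c q z j k : (j <= k)%N -> zc c q z k = 0 -> zc c q z j = 0.
Proof.
move=> /subnK <-; elim: (k - j)%N => // i IHi; rewrite addSn /zc => h; apply: IHi.
by rewrite /zc -padic_coefP h inZp0.
Qed.

(** The kernel of the projection to the free module over Z/p^(k+1) on the pointed finite quotient
    q. *)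
Definition zball q k : set (zpx p pt) := [set c | forall z, zc c q z k = 0].

Lemma zball_refine q k q' k' : exists r j, zball r j `<=` zball q k `&` zball q' k'.
Proof.
have [r [r1 [r2 [h1 h2]]]] := finQuotient_refine q q'; exists r, (maxn k k') => c hc.
split=> z; have [->|z0] := eqVneq z ord0; rewrite ?zc_ord0 //.
  rewrite (zc_compat c k h1 z0) big1 // => y _; apply: zc_eq0_le (hc y); exact: leq_maxl.
rewrite (zc_compat c k' h2 z0) big1 // => y _; apply: zc_eq0_le (hc y); exact: leq_maxr.
Qed.

Lemma finQuotient0 : finQuotient pt.
Proof.
apply: (@FinQuotient X pt 0 (fun=> ord0)) => //; first by apply: lcs_cts; exact: lcs_cst.
by move=> y; exists pt; rewrite [y]ord1.
Qed.

Lemma padic_one_subproof k : inZp (nat_of_ord (1 : 'Z_(p ^ k.+2))) = 1 :> 'Z_(p ^ k.+1).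
Proof.
have h j : (1 < p ^ j.+1)%N by rewrite -(exp1n j.+1) ltn_exp2r // prime_gt1.
apply/val_inj; rewrite /= [X in (1 %% X %% _)%N]Zp_cast // [X in (1 %% _ %% X)%N]Zp_cast //.
Qed.

Definition padic_one : padic p := padic_of_seq padic_one_subproof.

Lemma delta_subproof (x : X) :
  zpx_limit (fun q z => if (z == q x) && (z != ord0) then padic_one else 0).
Proof.
split=> [q|q q' r hr y y0]; first by rewrite eqxx andbF.
have r0 : r ord0 = ord0 by rewrite -(fq_pt q) hr fq_pt.
rewrite y0 andbT -big_mkcondr /=; case: eqP => [e|ne].
  rewrite (eq_bigl (pred1 (q x))); first by rewrite big_pred1_eq.
  move=> z /=; apply/and3P/eqP => [[_ /eqP //]|->]; rewrite hr e !eqxx; split=> //.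
  by apply: contra y0 => /eqP h; rewrite e -hr h r0.
by rewrite big1 // => z /and3P [/eqP e /eqP ez _]; case: ne; rewrite -e ez hr.
Qed.

(** The canonical map from X, sending pt to 0. *)
Definition delta (x : X) : zpx p pt := zpx_of_family (delta_subproof x).

Lemma zc_delta x q z N : zc (delta x) q z N = ((z == q x) && (z != ord0))%:R.
Proof. by rewrite /zc /zpx_coef /=; case: ifP. Qed.

(* The extension to Z_p[[X, pt]] of f o q, for f on the finite quotient q. *)
Definition pairing N q (f : 'I_(fq_size q).+1 -> 'Z_(p ^ N.+1)) c : 'Z_(p ^ N.+1) :=
  \sum_z f z * zc c q z N.
Arguments pairing : clear implicits.

Lemma pairingD N q f c c' : pairing N q f (c + c') = pairing N q f c + pairing N q f c'.
Proof. by rewrite /pairing -big_split; apply: eq_bigr => z _; rewrite zcD mulrDr. Qed.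

Lemma pairing_delta N q f x : f ord0 = 0 -> pairing N q f (delta x) = f (q x).
Proof.
move=> f0; rewrite /pairing (bigD1 (q x)) //= zc_delta eqxx big1 ?addr0.
  by case: eqP => [->|]; rewrite ?f0 ?mul0r ?mulr1.
by move=> z ne; rewrite zc_delta (negPf ne) mulr0.
Qed.

Lemma pairing_zball N q f c : zball q N c -> pairing N q f c = 0.
Proof. by move=> h; rewrite /pairing big1 // => z _; rewrite h mulr0. Qed.

Lemma zball_dense c q k : exists s : seq (X * nat), zball q k (c - \sum_(xn <- s) delta xn.1 *+ xn.2).
Proof.
have /choice [x xP] := @fq_surj _ _ q.
exists [seq (x z, nat_of_ord (zc c q z k)) | z <- index_enum 'I_(fq_size q).+1] => w.
rewrite zcD zcN zc_sum big_map; apply/eqP; rewrite subr_eq0; apply/eqP.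
have [->|w0] := eqVneq w ord0.
  by rewrite zc_ord0 big1 // => z _; rewrite zcMn zc_ord0 mul0rn.
rewrite (bigD1 w) //= zcMn zc_delta xP eqxx w0 natr_Zp big1 ?addr0 // => z ne.
by rewrite zcMn zc_delta xP eq_sym (negPf ne) mul0rn.
Qed.

Lemma zball_hom_eq N (u v : zpx p pt -> 'Z_(p ^ N.+1)) :
  {morph u : a b / a + b} -> {morph v : a b / a + b} ->
  (exists q k, forall c, zball q k c -> u c = 0) -> (exists q k, forall c, zball q k c -> v c = 0) ->
  (forall x, u (delta x) = v (delta x)) -> forall c, u c = v c.
Proof.
move=> uD vD [q [k hu]] [q' [k' hv]] e c.
have aux (w : zpx p pt -> 'Z_(p ^ N.+1)) : {morph w : a b / a + b} ->
    forall s : seq (X * nat), w (\sum_(xn <- s) delta xn.1 *+ xn.2) = \sum_(xn <- s) w (delta xn.1) *+ xn.2.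
  move=> wD s; have w0 : w 0 = 0 by apply: (addrI (w 0)); rewrite -wD !addr0.
  rewrite (big_morph w wD w0); apply: eq_bigr => xn _.
  by elim: xn.2 => [|n IHn]; rewrite ?mulr0n // !mulrS wD IHn.
have [r [j hr]] := zball_refine q k q' k'; have [s hs] := zball_dense c r j.
have [h1 h2] := hr _ hs; rewrite -(subrK (\sum_(xn <- s) delta xn.1 *+ xn.2) c).
rewrite uD vD hu // hv // !add0r !aux //; by apply: eq_bigr => xn _; rewrite e.
Qed.

End Zpx.

Arguments zc {p X pt} c q z N.

Section Zhom.
Variables (p : nat) (X : topologicalType) (pt : X).
Hypothesis pp : prime p.
Implicit Types (c : zpx p pt).

Definition zhom N (u : zpx p pt -> 'Z_(p ^ N.+1)) :=
  [/\ {morph u : a b / a + b}, (exists q k, forall c, zball q k c -> u c = 0) & lcs u].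

Definition pointed N (phi : X -> 'Z_(p ^ N.+1)) := lcs phi /\ phi pt = 0.

Let de x : zpx p pt := delta pt pp x.

(** With [zhom_eq] and [zhom_pointed] this identifies the continuous homomorphisms to Z/p^(N+1) with
    the pointed locally constant functions on X. *)
Lemma zhom_exists N phi : pointed (N:=N) phi -> exists2 u, zhom u & forall x, u (de x) = phi x.
Proof.
move=> [lphi p0]; have [q [f hf]] := finQuotient_of pt lphi.
have f0 : f ord0 = 0 by rewrite -(fq_pt q) hf.
exists (@pairing _ _ _ N q f); last by move=> x; rewrite pairing_delta.
split; first exact: pairingD.
- by exists q, N => c; exact: pairing_zball.
- apply: lcs_sum => z; exact: (lcs_comp (fun r => f z * r) (zc_lcs z N)).
Qed.

Lemma zhom_eq N (u v : zpx p pt -> 'Z_(p ^ N.+1)) : zhom u -> zhom v ->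
  (forall x, u (de x) = v (de x)) -> forall c, u c = v c.
Proof. by move=> [uD ub _] [vD vb _]; exact: zball_hom_eq. Qed.

Lemma zhom_pointed N (u : zpx p pt -> 'Z_(p ^ N.+1)) :
  {morph u : a b / a + b} -> (exists q k, forall c, zball q k c -> u c = 0) ->
  pointed (u \o de).
Proof.
move=> uD [q [k hu]].
have u0 : u 0 = 0 by apply: (addrI (u 0)); rewrite -uD !addr0.
have uN c : u (- c) = - u c by apply: (addrI (u c)); rewrite -uD !subrr.
have e x y : q y = q x -> u (de y) = u (de x).
  move=> h; apply/eqP; rewrite -subr_eq0 -uN -uD; apply/eqP/hu => z.
  by rewrite zcD zcN !zc_delta h subrr.
split=> [x|].
  by apply: filterS (cts_lcs (@fq_continuous _ _ q) x) => y /= /e.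
by apply: hu => z; rewrite zc_delta fq_pt; case: eqP.
Qed.

End Zhom.

Section CharacterBasis.
Variables (p : nat) (F : topGroupType) (X : topologicalType) (pt : X).
Hypotheses (pp : prime p) (ppF : pro_p_group p F).
Variable Tm : F -> zpx p pt.
Hypothesis TmD : forall f g, Tm (f * g)%g = Tm f + Tm g.
Hypothesis Tm_cts : continuous Tm.
Hypothesis Tm_surj : forall c, exists f, Tm f = c.
Hypothesis Tm_ker : forall psi : F -> 'Z_p, addhom psi -> lc psi ->
  forall f, Tm f = 0 -> psi f = 0.
Variables (H : topGroupType) (act : pointedAction H pt).
Variables (Ga : finGroupType) (e : Ga -> H) (actF : Ga -> F -> F).
Hypothesis pGa : (p.-group [set: Ga]%SET)%g.
Hypothesis eM : {morph e : a b / (a * b)%g}.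
Hypothesis Tm_act : forall a f, Tm (actF a f) = zpx_act act (e a) (Tm f).

Local Notation V := (X -> 'Z_p).
Local Notation zhom0 := (@zhom p X pt 0).
Let de x : zpx p pt := delta pt pp x.
Let pact a x := act (e a) x.

Let pact1 x : pact 1%g x = x.
Proof. by rewrite /pact (morph1_grp eM) pa_1. Qed.
Let pactM a b x : pact (a * b)%g x = pact a (pact b x).
Proof. by rewrite /pact eM pa_M. Qed.
Let pact_pt a : pact a pt = pt. Proof. exact: pa_pt. Qed.
Let pactK a x : pact a^-1%g (pact a x) = x. Proof. by rewrite -pactM mulVg. Qed.

Let pact_cts a : continuous (pact a).
Proof.
move=> x; apply: (@continuous_comp _ _ _ (fun x => (e a, x)) (fun hx => act hx.1 hx.2)).
  by exact: (cvg_pair (cvg_cst _) (@cvg_id _ _)).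
exact: pa_continuous.
Qed.

Let zpx_act_delta a x : zpx_act act (e a) (de x) = de (pact a x).
Proof. by apply: zpx_eq => q y. Qed.

Lemma zhom_act N a (u : zpx p pt -> 'Z_(p ^ N.+1)) : zhom u -> zhom (u \o zpx_act (p:=p) act (e a)).
Proof.
move=> hu; have [uD [q [k ub]] ul] := hu.
have aD : {morph zpx_act (p:=p) act (e a) : c d / c + d} by move=> c d; apply: zpx_eq.
have h1 : {morph u \o zpx_act (p:=p) act (e a) : c d / c + d} by move=> c d /=; rewrite aD uD.
have h2 : exists q k, forall c, zball q k c -> (u \o zpx_act (p:=p) act (e a)) c = 0.
  by exists (fq_act act (e a) q), k => c hc; apply: ub => z; exact: hc.
have [v hv vd] := zhom_exists pp (zhom_pointed pp h1 h2).
split=> //; have [vD vb vl] := hv.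
have -> : u \o zpx_act (p:=p) act (e a) = v by apply/funext; apply: (@zball_hom_eq p X pt pp N _ v h1 vD h2 vb) => x; rewrite vd.
exact: vl.
Qed.

Lemma hom_of_zhom N (u : zpx p pt -> 'Z_(p ^ N.+1)) : zhom u -> addhom (u \o Tm) /\ lc (u \o Tm).
Proof.
move=> [uD _ ul]; split; first by move=> f g /=; rewrite TmD uD.
by apply: (cts_lc ppF.1); apply: lcs_cts => f; exact: (lcs_precomp Tm_cts ul).
Qed.

(** psi factors through [Tm]. The balls meet in 0, so by compactness of F psi already vanishes on
    the preimage of one of them. *)
Lemma zhom_of_hom (psi : F -> 'Z_p) : addhom psi -> lc psi ->
  exists2 u : zpx p pt -> 'Z_(p ^ 1), zhom u & forall f, psi f = u (Tm f).
Proof.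
move=> hM hl; have [cF _ _] := ppF.1.
have Tm1 : Tm 1%g = 0 by apply: (addrI (Tm 1%g)); rewrite -TmD mulg1 addr0.
have TmV f : Tm f^-1%g = - Tm f by apply: (addrI (Tm f)); rewrite -TmD mulgV Tm1 subrr.
have fac f g : Tm f = Tm g -> psi f = psi g.
  move=> h; apply/eqP; rewrite eq_sym -subr_eq0 addrC -(addhomV hM) -hM; apply/eqP.
  by apply: Tm_ker => //; rewrite TmD TmV h addNr.
have [q [k hqk]] : exists q k, forall f, zball q k (Tm f) -> psi f = 0.
  apply: contrapT => nb.
  have [[q k]|[q k]|[q k] [q' k']|f hf] := @compact_directed F (finQuotient pt * nat)%type
    (fun qk => (Tm @^-1` zball qk.1 qk.2) `&` (psi @^-1` ~` [set 0])) (finQuotient0 pt, 0%N) cF.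
  - apply: closedI; last exact: lc_preimage_closed.
    apply: preimage_closed; first by move=> f _; exact: Tm_cts.
    have -> : zball q k = \bigcap_(z in [set: 'I_(fq_size q).+1]) [set c : zpx p pt | zc c q z k = 0].
      by apply/seteqP; split=> c h z; [move=> _; exact: h|exact: (h z Logic.I)].
    apply: closed_bigI => z _; exact: (@lcs_closed _ _ _ [set 0] (zc_lcs z k)).
  - apply: contrapT => h; apply: nb; exists q, k => f Bf; apply: contrapT => n0.
    by apply: h; exists f.
  - have [r [j hr]] := @zball_refine p _ pt q k q' k'; exists (r, j) => f [/hr [? ?] ?].
    by split; split.
  have [_] := hf (finQuotient0 pt, 0%N); apply; apply: Tm_ker => //.
  apply: zpx_eq => q z; apply: padic_eq => k.
  by have [/(_ z) h _] := hf (q, k); exact: h.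
have /choice [s sK] := Tm_surj.
pose u0 c : 'Z_(p ^ 1) := psi (s c).
have uE f : psi f = u0 (Tm f) by apply: fac; rewrite sK.
have uD : {morph u0 : c d / c + d}.
  move=> c d; rewrite /u0 -[RHS](hM (s c) (s d)); apply: fac; by rewrite TmD !sK.
have ub : exists q k, forall c, zball q k c -> u0 c = 0.
  by exists q, k => c hc; apply: hqk; rewrite sK.
have [v hv vd] := zhom_exists pp (zhom_pointed pp uD ub).
exists v => // f; rewrite uE; have [vD vb _] := hv.
exact: (@zball_hom_eq p X pt pp 0 u0 v uD vD ub vb).
Qed.

Let Psi_ex N (phi : X -> 'Z_(p ^ N.+1)) : exists u : zpx p pt -> 'Z_(p ^ N.+1),
  pointed pt phi -> zhom u /\ forall x, u (de x) = phi x.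
Proof.
have [h|nh] := pselect (pointed pt phi); last by exists (fun=> 0) => /nh.
by have [u h1 h2] := zhom_exists pp h; exists u.
Qed.

Let Psi N phi := projT1 (cid (@Psi_ex N phi)).
Let PsiP N phi : pointed pt phi -> zhom (Psi (N:=N) phi) /\ forall x, Psi phi (de x) = phi x.
Proof. exact: (projT2 (cid (@Psi_ex N phi))). Qed.

Let C : set V := [set v | lcs v /\ v pt = 0].
Let vact (a : Ga) (v : V) : V := fun x => v (pact a^-1%g x).

Let vact1 v : vact 1%g v = v.
Proof. by apply/funext => x; rewrite /vact invg1 pact1. Qed.
Let vactM a b v : vact (a * b)%g v = vact a (vact b v).
Proof. by apply/funext => x; rewrite /vact invMg pactM. Qed.
Let vactD a (v w : V) : vact a (v + w) = vact a v + vact a w. Proof. by []. Qed.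
Let vactC a v : C v -> C (vact a v).
Proof.
move=> [lv v0]; split; last by rewrite /vact pact_pt.
by move=> x; exact: (lcs_precomp (@pact_cts a^-1%g) lv).
Qed.

Let pV (v : V) : v *+ p = 0.
Proof.
by apply/funext => x; rewrite natmulfctE -mulr_natr char_Zp ?mulr0 ?prime_gt1.
Qed.

Let gC : addgroup C.
Proof.
split; first by split; [exact: lcs_cst|].
- move=> v w [lv v0] [lw w0]; split; last by rewrite -[(v + w) pt]/(v pt + w pt) v0 w0 addr0.
  exact: (lcs_op (fun a b => a + b) lv lw).
- move=> v [lv v0]; split; last by rewrite -[(- v) pt]/(- v pt) v0 oppr0.
  exact: (lcs_comp (fun a => - a) lv).
Qed.

Let sum_app (I : Type) (s : seq I) (P : pred I) (G : I -> V) x :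
  (\sum_(i <- s | P i) G i) x = \sum_(i <- s | P i) G i x.
Proof. by elim/big_rec2: _ => // i u v _ <-. Qed.

Let mul_app (v : V) n x : (v *+ n) x = v x *+ n.
Proof. by rewrite natmulfctE. Qed.

(** The values of all translates of the v in s define an equivariant map g from X to a finite set.
    The indicator functions of its nonempty fibres, except that of pt, are permuted and span s. *)
Let locC (s : seq V) : (forall v, v \in s -> C v) ->
  exists bs : seq V, [/\ uniq bs, (forall b, b \in bs -> C b),
    (forall g b, b \in bs -> vact g b \in bs),
    (forall c : V -> nat, \sum_(b <- bs) b *+ c b = 0 -> forall b, b \in bs -> (p %| c b)%N) &
    forall v, v \in s -> exists c : V -> nat, v = \sum_(b <- bs) b *+ c b].
Proof.
move=> sC; pose T := {ffun 'I_(size s) * Ga -> 'Z_p}.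
pose g x : T := [ffun ia => vact ia.2 (tnth (in_tuple s) ia.1) x].
have lg : lcs g.
  apply: (@lcs_ffun X _ _ (fun ia x => vact ia.2 (tnth (in_tuple s) ia.1) x)) => ia.
  by have [] := vactC ia.2 (sC _ (mem_tnth ia.1 (in_tuple s))).
pose b (t : T) : V := fun x => (g x == t)%:R.
pose ta a (t : T) : T := [ffun ia => t (ia.1, (a^-1 * ia.2)%g)].
have gta a x : g (pact a x) = ta a (g x).
  apply/ffunP => -[i c]; rewrite !ffunE /= /vact; congr (tnth _ _ _).
  by rewrite -pactM invMg invgK.
have taK a t : ta a^-1%g (ta a t) = t.
  by apply/ffunP => -[i c]; rewrite !ffunE /= invgK mulKg.
pose ts := [seq t <- enum T | `[< exists x, g x = t >] && (t != g pt)].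
have tsP t : reflect ((exists x, g x = t) /\ t <> g pt) (t \in ts).
  rewrite mem_filter mem_enum andbT; apply: (iffP andP) => -[h1 h2]; split.
  - exact/asboolP. - exact/eqP. - exact/asboolP. - exact/eqP.
have ab a t : vact a (b t) = b (ta a t).
  apply/funext => x; rewrite /vact /b gta; congr (nat_of_bool _)%:R.
  by apply/eqP/eqP => [<-|->]; rewrite ?taK // -{1}(invgK a) taK.
have binj : {in ts &, injective b}.
  move=> t t' /tsP [[x hx] _] _ h; have := congr1 (fun v => v x) h; rewrite /b hx eqxx.
  by case: eqP => // _ /eqP; rewrite oner_eq0.
pose bs := [seq b t | t <- ts].
have uts : uniq ts by rewrite filter_uniq // enum_uniq.
have ubs : uniq bs by rewrite map_inj_in_uniq.
exists bs; split=> //.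
- move=> _ /mapP [t /tsP [_ nt] ->]; split; first exact: (lcs_comp (fun u => (u == t)%:R) lg).
  by rewrite /b; case: eqP => // h; case: nt.
- move=> a _ /mapP [t /tsP [[x hx] nt] ->]; rewrite ab; apply/map_f/tsP; split.
    by exists (pact a x); rewrite gta hx.
  move=> h; apply: nt; rewrite -(taK a t) h -gta pact_pt //.
- move=> c h _ /mapP [t tts ->]; have [[x hx] _] := tsP t tts.
  have := congr1 (fun v => v x) h; rewrite sum_app big_map (bigD1_seq t) //=.
  rewrite mul_app {1}/b hx eqxx big1 ?addr0 => [|t' ne].
    by move/eqP; rewrite Zp_natp0.
  by rewrite mul_app {1}/b hx eq_sym (negPf ne) mul0rn.
- move=> v vs; have /tnthP [i ei] : v \in in_tuple s by [].
  pose t0 (w : V) := [pick t | (t \in ts) && (b t == w)].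
  exists (fun w => if t0 w is Some t then nat_of_ord (t (i, 1%g)) else 0%N).
  apply/funext => x; rewrite sum_app big_map.
  transitivity (\sum_(t <- ts) (g x == t)%:R * t (i, 1%g)); last first.
    apply: eq_big_seq => t tts; rewrite mul_app /t0; case: pickP => [t' /andP [t't /eqP e']|/(_ t)].
      by rewrite (binj _ _ t't tts e') -[in RHS]mulr_natr [X in _ = _ * X]natr_Zp.
    by rewrite tts eqxx.
  have vE : v x = g x (i, 1%g) by rewrite ffunE /= vact1 ei.
  have [gts|ngts] := boolP (g x \in ts).
    rewrite (bigD1_seq (g x)) //= eqxx mul1r big1 ?addr0 //.
    by move=> t ne; rewrite eq_sym (negPf ne) mul0r.
  have -> : v x = 0.
    have gp : g x = g pt.
      by apply: contrapT => h; case/negP: ngts; apply/tsP; split=> //; exists x.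
    by have [_ <-] := sC v vs; rewrite vE gp ffunE /= vact1 ei.
  rewrite big1_seq // => t /andP [_ tts]; case: eqP => [ht|]; rewrite ?mul0r //.
  by rewrite ht tts in ngts.
Qed.

(** Y is a permuted basis of the pointed locally constant functions X -> F_p, a discrete set even
    when X is not. *)
Lemma character_basis : exists (Y : eqType) (chi : forall N, Y -> F -> 'Z_(p ^ N.+1))
    (chi0 : Y -> F -> 'Z_p) (yact : Ga -> Y -> Y),
  [/\ (forall N y, addhom (chi N y)) /\ (forall N y, lc (chi N y)),
      forall N y x, redp (chi N y x) = chi0 y x,
      (forall (ys : seq Y) (c : Y -> nat), uniq ys ->
        (forall x, \sum_(y <- ys) chi0 y x *+ c y = 0) -> forall y, y \in ys -> (p %| c y)%N) /\
      (forall psi : F -> 'Z_p, addhom psi -> lc psi ->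
        exists (ys : seq Y) (c : Y -> nat), forall x, psi x = \sum_(y <- ys) chi0 y x *+ c y),
      (forall y, yact 1%g y = y) /\ (forall a b y, yact (a * b)%g y = yact a (yact b y)) &
      forall N a y x, chi N (yact a y) (actF a x) = chi N y x].
Proof.
have [Y0 [Y0C Y0act Y0span Y0ind]] := locally_permutation pp pGa pV vact1 vactM vactD gC vactC locC.
pose Y : eqType := {v : V | v \in Y0}.
have YC (y : Y) : C (val y) by apply: Y0C; exact: set_mem (valP y).
have Yact a (y : Y) : vact a (val y) \in Y0.
  by apply: mem_set; apply: Y0act; exact: set_mem (valP y).
(* Lifting the values of a function by representatives of residues commutes with the action, which
   only permutes the arguments in X. This makes the lifted characters permuted modulo every power of
   p. *)
pose tau N (r : 'Z_p) : 'Z_(p ^ N.+1) := (nat_of_ord r)%:R.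
have redtau N r : redp (tau N r) = r by rewrite redp_nat // natr_Zp.
have ptau N (v : V) : C v -> pointed pt (tau N \o v).
  by move=> [lv v0]; split; [exact: lcs_comp|rewrite /= v0].
pose chi N (y : Y) f := Psi (tau N \o val y) (Tm f).
pose chi0 (y : Y) f : 'Z_p := Psi (N := 0) (val y) (Tm f).
exists Y, chi, chi0, (fun a y => exist _ (vact a (val y)) (Yact a y)); split.
- by split=> N y; have [h _] := PsiP (ptau N _ (YC y)); have [] := hom_of_zhom h.
- move=> N y f; have [[uD [q [k ub]] ul] hd] := PsiP (ptau N _ (YC y)).
  have [hv hd'] := PsiP (N := 0) (YC y).
  have hu : zhom0 (@redp p N \o Psi (tau N \o val y)).
    split; first by move=> c d /=; rewrite uD redpD.
      by exists q, k => c /ub /= ->; rewrite redp0.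
    exact: lcs_comp ul.
  rewrite -[LHS]/((@redp p N \o Psi (tau N \o val y)) (Tm f)).
  by apply: (zhom_eq hu hv) => x /=; rewrite hd hd' /= redtau.
- have lin (s : seq V) (c : V -> nat) : (forall v, v \in s -> C v) -> forall f,
      Psi (N := 0) (\sum_(v <- s) v *+ c v) (Tm f) = \sum_(v <- s) Psi (N := 0) v (Tm f) *+ c v :> 'Z_p.
    move=> sC f; have Cs : C (\sum_(v <- s) v *+ c v).
      by apply: (addgroup_sum gC) => v vs _; exact: (addgroupMn _ gC (sC v vs)).
    have [hu hd] := PsiP (N := 0) Cs; have [uD ub _] := hu.
    pose w (d : zpx p pt) : 'Z_(p ^ 1) := \sum_(v <- s) Psi (N := 0) v d *+ c v.
    have wD : {morph w : d d' / d + d'}.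
      move=> d d'; rewrite /w -big_split; apply: eq_big_seq => v vs.
      by have [[-> _ _] _] := PsiP (N := 0) (sC v vs); rewrite mulrnDl.
    have wb : exists q k, forall d, zball q k d -> w d = 0.
      rewrite /w; elim: (s) sC => [|v s' IHs] sC.
        by exists (finQuotient0 pt), 0%N => d _; rewrite big_nil.
      have [|q [k hqk]] := IHs; first by move=> v' v's; apply: sC; rewrite inE v's orbT.
      have [[_ [q' [k' hqk']] _] _] := PsiP (N := 0) (sC v (mem_head _ _)).
      have [r [j hr]] := @zball_refine p _ pt q k q' k'.
      by exists r, j => d /hr [h1 h2]; rewrite big_cons hqk' // mul0rn add0r hqk.
    rewrite -[RHS]/(w (Tm f)).
    apply: (@zball_hom_eq p X pt pp 0 _ w uD wD ub wb) => x; rewrite hd sum_app /w.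
    apply: eq_big_seq => v vs; rewrite mul_app.
    by have [_ ->] := PsiP (N := 0) (sC v vs).
  split=> [ys c uys h y yys|psi hM hl].
    pose c' (v : V) := if insub v is Some y then c (y : Y) else 0%N.
    have c'E (z : Y) : c' (val z) = c z.
      by rewrite /c' valK.
    have us : uniq (map val ys) by rewrite map_inj_uniq //; exact: val_inj.
    have sY v : v \in map val ys -> Y0 v by move=> /mapP [z _ ->]; exact: set_mem (valP z).
    rewrite -c'E; apply: (Y0ind (map val ys)) => //; last exact: map_f.
    have sC v : v \in map val ys -> C v by move=> /sY /Y0C.
    have Cs : C (\sum_(v <- map val ys) v *+ c' v).
      by apply: (addgroup_sum gC) => v vs _; exact: (addgroupMn _ gC (sC v vs)).
    apply/funext => x; have [_ <-] := PsiP (N := 0) Cs.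
    have [f <-] := Tm_surj (de x); rewrite lin // big_map -[RHS](h f).
    by apply: eq_bigr => z _; rewrite c'E.
  have [u hu uE] := zhom_of_hom hM hl; have [uD ub _] := hu.
  have Cu : C (u \o de) := zhom_pointed pp uD ub.
  have [s [c [us sY es]]] := Y0span _ Cu.
  have sC v : v \in s -> C v by move=> /sY /Y0C.
  exists (pmap insub s), (fun y => c (val y)) => f.
  rewrite uE; have -> : u (Tm f) = Psi (N := 0) (u \o de) (Tm f).
    by have [h1 h2] := PsiP (N := 0) Cu; apply: (zhom_eq hu h1) => x; rewrite h2.
  rewrite es lin // -[in LHS](_ : map val (pmap insub s : seq Y) = s) ?big_map //.
  rewrite (pmap_filter (insubK _)); apply/all_filterP/allP => v vs /=.
  by rewrite insubT //; apply: mem_set; exact: sY.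
- split=> [y|a b y]; apply: val_inj; [exact: vact1|exact: vactM].
- move=> N a y f; rewrite /chi /= Tm_act.
  have [hu hd] := PsiP (ptau N _ (YC (exist _ (vact a (val y)) (Yact a y)))).
  have [hv hd'] := PsiP (ptau N _ (YC y)).
  apply: (zhom_eq (zhom_act a hu) hv) => x.
  by rewrite /= zpx_act_delta hd hd' /= /vact pactK.
Qed.

End CharacterBasis.

(** * Pro-p groups presented by a profinite space *)

Local Close Scope ring_scope.
Local Open Scope group_scope.

Lemma prod_continuous (T : topologicalType) (I : Type) (K : I -> topologicalType)
  (f : T -> prod_topology K) : (forall i, continuous (fun x => f x i)) -> continuous f.
Proof.
move=> h x; apply/cvg_sup => i.
exact: (@continuous_comp_initial (forall i, K i) T (K i) (fun g => g i) f (h i) x).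
Qed.

Lemma set_type_continuous (T X : topologicalType) (A : set X) (f : T -> set_type A) :
  continuous (fun x => val (f x)) -> continuous f.
Proof. exact: continuous_comp_initial. Qed.

Lemma val_continuous (X : topologicalType) (A : set X) : continuous (val : set_type A -> X).
Proof. exact: initial_continuous. Qed.

Lemma set_type_compact (X : topologicalType) (A : set X) :
  compact [set: X] -> closed A -> compact [set: set_type A].
Proof.
move=> cX cA F PF _; pose G : set_system X := val @ F.
have [//|x [_ clx]] := cX G _; first exact: filterT.
have Ax : A x.
  apply: cA => B nB.
  have GA : F (val @^-1` A) by apply: filterS filterT => -[y Ay] _ /=; exact: set_mem.
  by have [y [Ay By]] := clx A B GA nB; exists y.
exists (exist _ x (mem_set Ax)); split=> // B N FB.
rewrite nbhsE => -[U [oU Ux] UN]; have [V oV VU] := oU.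
have GB : F (val @^-1` (val @` B)) by apply: filterS FB => y By /=; exists y.
have nV : nbhs x V.
  by apply: open_nbhs_nbhs; split=> //; move: Ux; rewrite -VU.
have [_ [[y By <-] Vy]] := clx _ _ GB nV; exists y; split=> //; apply: UN.
by rewrite -VU.
Qed.

Lemma ftable_of (Q : finGroupType) : exists (t : ftable) (h : Q -> fcar t),
  [/\ {morph h : x y / x * y}, injective h & forall y, exists x, h x = y].
Proof.
have nW : is_normal_subgroup [set 1 : dgrp Q].
  split; first split=> //=.
  - by move=> x y /= -> ->; rewrite mulg1.
  - by move=> x /= ->; rewrite invg1.
  - by move=> g x /= ->; rewrite mulg1 mulgV.
have [|t [q [qM qS qP _]]] := finite_quotient nW.
  apply: finite_left_cosets; first by case: (dgrp_profinite Q).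
  by split=> //; exact: discrete_open.
exists t, q; split=> // x y /qP /= e; rewrite -(mulKVg x y) -[RHS]/(x * (x^-1 * y)) e mulg1 //.
Qed.

Lemma ftable_pgroup (p : nat) (Q : finGroupType) (t : ftable) (h : Q -> fcar t) :
  injective h -> (forall y, exists x, h x = y) -> p.-group [set: Q]%SET ->
  p.-group [set: fcar t]%SET.
Proof.
move=> hi hs; have /choice [g gK] := hs.
have : bijective h by exists g => // x; apply: hi; rewrite gK.
by rewrite /pgroup !cardsT => /bij_eq_card ->.
Qed.

(* The pro-p group presented by a space of generators S, subject to the relations
   a b = c for (a, b, c) in Rel, realized in the product of all its finite quotients. *)
Section Presented.
Variables (p : nat) (S : topologicalType) (Rel : S -> S -> S -> Prop).

Record pidx := PIdx {
  pi_t : ftable;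
  pi_f :> S -> fcar pi_t;
  pi_p : p.-group [set: fcar pi_t]%SET;
  pi_lcs : lcs pi_f;
  pi_rel : forall a b c, Rel a b c -> pi_f a * pi_f b = pi_f c
}.

Definition pprod : Type := prod_topology (fun j : pidx => discrete_topology (fcar (pi_t j))).
HB.instance Definition _ := Topological.on pprod.

Definition weval (j : pidx) (w : seq (bool * S)) : fcar (pi_t j) :=
  \prod_(s <- w) (if s.1 then j s.2 else (j s.2)^-1).

(** The closure of the subgroup generated by the images of S: on finitely many coordinates u agrees
    with a word. *)
Definition pset : set pprod :=
  [set u | forall js : seq {classic pidx}, exists w, forall j, j \in js -> u j = weval j w].

Definition presented : Type := set_type pset.
HB.instance Definition _ := Topological.on presented.

Definition coord (u : presented) (j : pidx) : fcar (pi_t j) := val u j.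

Lemma coordP (u : presented) (js : seq {classic pidx}) :
  exists w, forall j, j \in js -> coord u j = weval j w.
Proof. exact: (set_mem (valP u)). Qed.

Lemma coord_eq (u v : presented) : (forall j, coord u j = coord v j) -> u = v.
Proof. by move=> h; apply/val_inj/functional_extensionality_dep. Qed.

Definition winv (w : seq (bool * S)) := rev [seq (~~ s.1, s.2) | s <- w].

Lemma weval_cat j w w' : weval j (w ++ w') = weval j w * weval j w'.
Proof. by rewrite /weval big_cat. Qed.

Lemma weval_inv j w : weval j (winv w) = (weval j w)^-1.
Proof.
elim: w => [|[b s] w IHw]; first by rewrite /weval !big_nil invg1.
rewrite /winv map_cons rev_cons -cats1 weval_cat -/(winv w) IHw.
rewrite /weval big_seq1 big_cons invgM /=; congr (_ * _).
by case: b => //=; rewrite invgK.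
Qed.

Definition mk_presented (u : forall j : pidx, fcar (pi_t j)) (h : pset u) : presented :=
  exist _ (u : pprod) (mem_set h).

Lemma presented_mul_subproof (u v : presented) : pset (fun j => coord u j * coord v j).
Proof.
move=> js; have [w hw] := coordP u js; have [w' hw'] := coordP v js.
by exists (w ++ w') => j jjs; rewrite weval_cat -hw // -hw'.
Qed.

Lemma presented_inv_subproof (u : presented) : pset (fun j => (coord u j)^-1).
Proof.
move=> js; have [w hw] := coordP u js.
by exists (winv w) => j jjs; rewrite weval_inv -hw.
Qed.

Lemma presented_one_subproof : pset (fun j => 1).
Proof. by move=> js; exists [::] => j _; rewrite /weval big_nil. Qed.

Definition presented_mul u v : presented := mk_presented (presented_mul_subproof u v).
Definition presented_inv u : presented := mk_presented (presented_inv_subproof u).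
Definition presented_one : presented := mk_presented presented_one_subproof.

Lemma presented_mulA : associative presented_mul.
Proof. by move=> u v w; apply: coord_eq => j; exact: mulgA. Qed.
Lemma presented_mul1 : left_id presented_one presented_mul.
Proof. by move=> u; apply: coord_eq => j; exact: mul1g. Qed.
Lemma presented_1mul : right_id presented_one presented_mul.
Proof. by move=> u; apply: coord_eq => j; exact: mulg1. Qed.
Lemma presented_mulV : left_inverse presented_one presented_inv presented_mul.
Proof. by move=> u; apply: coord_eq => j; exact: mulVg. Qed.
Lemma presented_Vmul : right_inverse presented_one presented_inv presented_mul.
Proof. by move=> u; apply: coord_eq => j; exact: mulgV. Qed.

HB.instance Definition _ := isGroup.Build presented
  presented_mulA presented_mul1 presented_1mul presented_mulV presented_Vmul.

Lemma coord_lcs j : lcs (fun u : presented => coord u j).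
Proof.
apply: cts_lcs => u.
apply: (@continuous_comp _ _ _ (val : presented -> pprod) (fun f : pprod => f j)).
  exact: val_continuous.
exact: (@coord_continuous _ (fun j : pidx => discrete_topology (fcar (pi_t j)))).
Qed.

Lemma presented_continuous (T : topologicalType) (f : T -> presented) :
  (forall j, lcs (fun x => coord (f x) j)) -> continuous f.
Proof.
move=> h; apply: set_type_continuous; apply: prod_continuous => j; exact: (lcs_cts (h j)).
Qed.

Lemma presented_mulg_continuous : continuous (fun uv : presented * presented => uv.1 * uv.2).
Proof.
apply: presented_continuous => j [u v].
exists ([set u' | coord u' j = coord u j], [set v' | coord v' j = coord v j]).
  by split; exact: coord_lcs.
by move=> [u' v'] [/= e1 e2]; rewrite /coord /= -!/(coord _ j) e1 e2.
Qed.

Lemma presented_invg_continuous : continuous (fun u : presented => u^-1).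
Proof. by apply: presented_continuous => j; exact: (lcs_comp (fun x => x^-1) (coord_lcs j)). Qed.

HB.instance Definition _ := Group_isTopGroup.Build presented
  presented_mulg_continuous presented_invg_continuous.

Lemma coordM j : {morph (fun u : presented => coord u j) : u v / u * v}.
Proof. by []. Qed.

Lemma pidx_pair (j1 j2 : pidx) : exists (j3 : pidx) (h1 : fcar (pi_t j3) -> fcar (pi_t j1))
  (h2 : fcar (pi_t j3) -> fcar (pi_t j2)),
  [/\ {morph h1 : x y / x * y}, {morph h2 : x y / x * y},
      (forall s, h1 (j3 s) = j1 s), (forall s, h2 (j3 s) = j2 s) &
      forall x, h1 x = 1 -> h2 x = 1 -> x = 1].
Proof.
have [t [h [hM hI hS]]] := ftable_of (fcar (pi_t j1) * fcar (pi_t j2))%type.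
have /choice [g gK] := hS.
have gM : {morph g : x y / x * y} by move=> x y; apply: hI; rewrite hM !gK.
have pt : p.-group [set: fcar t]%SET.
  apply: (ftable_pgroup hI hS); rewrite /pgroup cardsT card_prod pnatM.
  by rewrite -!cardsT; apply/andP; split; exact: pi_p.
have lf : lcs (fun s => h (j1 s, j2 s)).
  exact: (lcs_op (fun a b => h (a, b)) (@pi_lcs j1) (@pi_lcs j2)).
have rf a b c : Rel a b c -> h (j1 a, j2 a) * h (j1 b, j2 b) = h (j1 c, j2 c).
  by move=> r; rewrite -hM -(pi_rel j1 r) -(pi_rel j2 r).
exists (PIdx pt lf rf), (fst \o g), (snd \o g); split=> [x y|x y|s|s|x] /=.
- by rewrite gM.
- by rewrite gM.
- by have -> : g (h (j1 s, j2 s)) = (j1 s, j2 s) by apply: hI; rewrite gK.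
- by have -> : g (h (j1 s, j2 s)) = (j1 s, j2 s) by apply: hI; rewrite gK.
- move=> h1 h2; rewrite -(gK x) (surjective_pairing (g x)) h1 h2.
  exact: morph1_grp hM.
Qed.

Lemma morph_weval (j j' : pidx) (h : fcar (pi_t j) -> fcar (pi_t j')) w :
  {morph h : x y / x * y} -> (forall s, h (j s) = j' s) -> h (weval j w) = weval j' w.
Proof.
move=> hM hs; rewrite /weval (big_morph h hM (morph1_grp hM)); apply: eq_bigr => -[b s] _ /=.
by case: b; rewrite ?(morphV_grp hM) hs.
Qed.

Lemma coord_morph (u : presented) (j j' : pidx) (h : fcar (pi_t j) -> fcar (pi_t j')) :
  {morph h : x y / x * y} -> (forall s, h (j s) = j' s) -> h (coord u j) = coord u j'.
Proof.
move=> hM hs; have [w hw] := coordP u [:: j; j'].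
by rewrite !hw ?inE ?eqxx ?orbT // (morph_weval w hM hs).
Qed.

Lemma presented_profinite : profinite_space presented.
Proof.
have cPi : compact [set: pprod].
  have := @tychonoff {classic pidx} (fun j => discrete_topology (fcar (pi_t j))) (fun=> setT).
  rewrite (_ : [set f | _] = [set: pprod]); first by apply=> j; apply: finite_compact; exact: finite_finset.
  by apply/seteqP; split.
have hP : hausdorff_space presented.
  move=> u v h; apply: coord_eq => j.
  by have [w [/= <- <-]] := h _ _ (coord_lcs j u) (coord_lcs j v).
split=> //.
  apply: set_type_compact => //.
  have -> : pset = \bigcap_(js in [set: seq {classic pidx}])
      [set u | exists w, forall j, j \in js -> u j = weval j w].
    by apply/seteqP; split=> u h js; [move=> _; exact: h|exact: (h js Logic.I)].
  apply: closed_bigI => js _; rewrite -(setCK [set u | _]); apply: open_closedC.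
  rewrite openE => u nu; rewrite /interior.
  have : nbhs u [set v : pprod | forall j, j \in js -> v j = u j].
    elim: js {nu} => [|j js IHjs]; first by apply: filterS filterT => v _ j.
    have hj : nbhs u [set v : pprod | v j = u j].
      apply: (@coord_continuous _ (fun j : pidx => discrete_topology (fcar (pi_t j))) j u [set u j]).
      exact: discrete_set1.
    apply: filterS2 hj IHjs => v /= h1 h2 i; rewrite inE => /orP [/eqP -> //|]; exact: h2.
  apply: filterS => v hv [w hw]; apply: nu; exists w => j jjs.
  by rewrite -hv // hw.
apply: zero_dimension_totally_disconnected => u v uv.
have [j nj] : exists j, coord u j <> coord v j.
  by apply: contrapT => /forallNP h; case/eqP: uv; apply: coord_eq => j; apply: contrapT; exact: h.
exists ((fun w => coord w j) @^-1` [set coord u j]); split=> //; last by move=> /= e; apply: nj.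
by split; [exact: lcs_open (coord_lcs j)|exact: lcs_closed (coord_lcs j)].
Qed.

(** The kernels of the coordinates are directed by [pidx_pair] and meet in 1; compactness puts one
    of them inside U. *)
Lemma presented_kernel (U : set presented) : nbhs (1 : presented) U ->
  exists j, forall u, coord u j = 1 -> U u.
Proof.
move=> nU; have [V [oV V1] VU] : exists2 V : set presented, open V /\ V 1 & V `<=` U.
  by move: nU; rewrite nbhsE => -[V [oV V1] VU]; exists V.
have [cP _ _] := presented_profinite; apply: contrapT => nj.
have [j0 _] : exists j : pidx, True.
  have [t [h [hM hI hS]]] := ftable_of 'I_1.
  have pt : p.-group [set: fcar t]%SET by apply: (ftable_pgroup hI hS); rewrite /pgroup cardsT card_ord.
  by exists (@PIdx t (fun=> 1) pt (@lcs_cst S _ 1) (fun _ _ _ _ => mulg1 1)).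
have [j|j|j1 j2|u hu] := @compact_directed presented pidx
   (fun j => (fun u => coord u j) @^-1` [set 1] `&` ~` V) j0 cP.
- by apply: closedI; [exact: lcs_closed (coord_lcs j)|exact: open_closedC].
- apply: contrapT => h; apply: nj; exists j => u u1; apply: VU; apply: contrapT => nV.
  by apply: h; exists u.
- have [j3 [h1 [h2 [h1M h2M e1 e2 _]]]] := pidx_pair j1 j2; exists j3 => u [/= u3 nV].
  by split; split=> //=; rewrite -?(coord_morph u h1M e1) -?(coord_morph u h2M e2) u3; exact: morph1_grp.
have u1 : u = 1 by apply: coord_eq => j; have [] := hu j.
by have [_] := hu j0; rewrite u1.
Qed.

Lemma presented_pro_p : pro_p_group p presented.
Proof.
split; first exact: presented_profinite.
move=> U nU oU; have [|j hj] := @presented_kernel U.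
  by apply: open_nbhs_nbhs; split=> //; exact: nsub1.
exact: (index_p_power nU.1 (@coordM j) (@pi_p j) hj).
Qed.

Definition pgen_subproof (s : S) : pset (fun j => j s).
Proof. by move=> js; exists [:: (true, s)] => j _; rewrite /weval big_seq1. Qed.

Definition pgen (s : S) : presented := mk_presented (pgen_subproof s).

Lemma pgen_continuous : continuous pgen.
Proof. by apply: presented_continuous => j; exact: pi_lcs. Qed.

Lemma pgen_rel a b c : Rel a b c -> pgen a * pgen b = pgen c.
Proof. by move=> r; apply: coord_eq => j; exact: pi_rel. Qed.

Record pquot (L : topGroupType) := PQuot {
  pq_t : ftable;
  pq_q :> L -> fcar pq_t;
  pq_M : {morph pq_q : x y / x * y};
  pq_lc : lc pq_q;
  pq_p : p.-group [set: fcar pq_t]%SET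
}.

Section Universal.
Variables (L : topGroupType) (f : S -> L).
Hypotheses (pp : prime p) (ppL : pro_p_group p L) (cf : continuous f).
Hypothesis rf : forall a b c, Rel a b c -> f a * f b = f c.

Lemma pquot_lcs (i : pquot L) : lcs (fun s => i (f s)).
Proof. by move=> s; exact: (lcs_precomp cf (cts_lcs (lc_continuous (@pq_lc _ i)))). Qed.

Lemma pquot_rel (i : pquot L) a b c : Rel a b c -> i (f a) * i (f b) = i (f c).
Proof. by move=> r; rewrite -pq_M (rf r). Qed.

Definition pquot_idx (i : pquot L) : pidx := PIdx (@pq_p _ i) (pquot_lcs i) (pquot_rel i).

Lemma pquot_onormal W : onormal W -> exists i : pquot L, forall x y, i x = i y <-> W (x^-1 * y).
Proof.
move=> oW; have [t [q [qM qS qP pQ]]] := pro_p_quotient pp ppL oW.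
by exists (PQuot qM (lc_of_quotient oW qP) pQ).
Qed.

Lemma pquot_sep (l l' : L) : (forall i : pquot L, i l = i l') -> l = l'.
Proof.
move=> h; suff e : l^-1 * l' = 1 by rewrite -(mulKVg l l') e mulg1.
apply: (onormal_separates ppL.1) => W oW.
by have [i iP] := pquot_onormal oW; apply/iP.
Qed.

Lemma pquot_pair (i1 i2 : pquot L) : exists (i3 : pquot L) (h1 : fcar (pq_t i3) -> fcar (pq_t i1))
  (h2 : fcar (pq_t i3) -> fcar (pq_t i2)),
  [/\ {morph h1 : x y / x * y}, {morph h2 : x y / x * y},
      (forall l, h1 (i3 l) = i1 l) & (forall l, h2 (i3 l) = i2 l)].
Proof.
have [W [oW hW]] := lc_pair (@pq_lc _ i1) (@pq_lc _ i2).
have [i3 h3] := pquot_onormal oW.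
have [t [q [qM qS qP pQ]]] := pro_p_quotient pp ppL oW; have /choice [r rK] := qS.
have e l : (i1 (r (q l)), i2 (r (q l))) = (i1 l, i2 l).
  have Wl : W ((r (q l))^-1 * l) by apply/qP; rewrite rK.
  by rewrite -(hW _ _ Wl) mulKVg.
exists (PQuot qM (lc_of_quotient oW qP) pQ), (i1 \o r), (i2 \o r); split=> [x y|x y|l|l] /=.
- by have [x' <-] := qS x; have [y' <-] := qS y; rewrite -qM; move: (e (x' * y')) (e x') (e y') => [-> _] [-> _] [-> _]; exact: pq_M.
- by have [x' <-] := qS x; have [y' <-] := qS y; rewrite -qM; move: (e (x' * y')) (e x') (e y') => [_ ->] [_ ->] [_ ->]; exact: pq_M.
- by case: (e l).
- by case: (e l).
Qed.

(** For each finite quotient of L some word has the prescribed image. The quotients are directed and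
    L is compact, so one element serves them all. *)
Lemma presented_value (u : presented) : exists l, forall i : pquot L, i l = coord u (pquot_idx i).
Proof.
have [cL _ _] := ppL.1.
have [i0 _] := pquot_onormal (onormalT L).
pose ew w : L := \prod_(s <- w) (if s.1 then f s.2 else (f s.2)^-1).
have ewE (i : pquot L) w : i (ew w) = weval (pquot_idx i) w.
  rewrite /ew (big_morph _ (@pq_M _ i) (morph1_grp (@pq_M _ i))) /weval; apply: eq_bigr => -[b s] _ /=.
  by case: b => //; rewrite (morphV_grp (@pq_M _ i)).
have [i|i|i1 i2|l hl] := @compact_directed L (pquot L) (fun i => i @^-1` [set coord u (pquot_idx i)]) i0 cL.
- exact: lc_preimage_closed (@pq_lc _ i).
- have [w hw] := coordP u [:: pquot_idx i]; exists (ew w).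
  by rewrite /= ewE hw // inE.
- have [i3 [h1 [h2 [h1M h2M e1 e2]]]] := pquot_pair i1 i2; exists i3 => l /= hl; split => /=.
    by rewrite -e1 hl; exact: (@coord_morph u (pquot_idx i3) (pquot_idx i1) h1 h1M (fun s => e1 (f s))).
  by rewrite -e2 hl; exact: (@coord_morph u (pquot_idx i3) (pquot_idx i2) h2 h2M (fun s => e2 (f s))).
by exists l => i; exact: hl.
Qed.

Lemma presented_universal : exists! g : presented -> L, is_top_hom g /\ forall s, g (pgen s) = f s.
Proof.
have /choice [g gP] := presented_value; exists g; split.
  split; last by move=> s; apply: pquot_sep => i; rewrite gP.
  split; first by move=> u v; apply: pquot_sep => i; rewrite pq_M !gP.
  move=> u B nB; have [_ hL _] := ppL.1.
  have nB1 : nbhs (1 : L) [set l | B (g u * l)].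
    by apply: (@mull_cts _ (g u) 1); rewrite mulg1.
  have [W [oW WB]] := onormal_exists ppL.1 nB1; have [i iP] := pquot_onormal oW.
  apply: filterS (coord_lcs (pquot_idx i) u) => v /= e.
  by rewrite -(mulKVg (g u) (g v)); apply: WB; apply/iP; rewrite !gP.
move=> g' [[g'M g'c] g's]; apply/funext => u; apply: pquot_sep => i; rewrite gP.
have [j1 hj1] : exists j, forall v, coord v j = 1 -> i (g' v) = 1.
  apply: presented_kernel; have [W [oW hW]] := @pq_lc _ i.
  have : nbhs (1 : presented) (g' @^-1` W) by apply: g'c; rewrite morph1_grp //; exact: onormal_nbhs.
  apply: filterS => v /= Wv; rewrite -[g' v]mul1g hW //; exact: morph1_grp (@pq_M _ i).
have [w hw] := coordP u [:: j1; pquot_idx i].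
rewrite hw ?inE ?eqxx ?orbT //.
pose v : presented := \prod_(s <- w) (if s.1 then pgen s.2 else (pgen s.2)^-1).
have vE j : coord v j = weval j w.
  rewrite /v (big_morph _ (@coordM j) (erefl _ : coord 1 j = 1)); apply: eq_bigr => -[b s] _ /=.
  by case: b => //; rewrite (morphV_grp (@coordM j)).
have : i (g' (v^-1 * u)) = 1.
  by apply: hj1; rewrite coordM (morphV_grp (@coordM j1)) vE hw ?mulVg // inE eqxx.
rewrite g'M pq_M => e; apply/esym; apply: (mulgI (i (g' v^-1))); rewrite e.
have igM : {morph (i \o g') : a b / a * b} by move=> a b /=; rewrite g'M pq_M.
have -> : weval (pquot_idx i) w = (i \o g') v.
  rewrite /v (big_morph _ igM (morph1_grp igM)) /weval; apply: eq_bigr => -[b s] _.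
  by case: b; rewrite ?(morphV_grp igM) /= g's.
by rewrite -[i (g' v^-1)]/((i \o g') v^-1) -igM mulVg (morph1_grp igM).
Qed.

End Universal.
End Presented.

(** * Semidirect products and HNN-extensions *)

Lemma lcs_profinite (X : topologicalType) : compact [set: X] ->
  (forall x y : X, x <> y -> exists (T : Type) (g : X -> T), lcs g /\ g x <> g y) ->
  profinite_space X.
Proof.
move=> cX sep; split=> //.
  move=> x y h; apply: contrapT => /sep [T [g [lg ne]]].
  by have [z [/= e1 e2]] := h _ _ (lg x) (lg y); apply: ne; rewrite -e1 -e2.
apply: zero_dimension_totally_disconnected => x y /eqP /sep [T [g [lg ne]]].
exists (g @^-1` [set g x]); split=> //; last by move=> /= e; apply: ne.
by split; [exact: lcs_open|exact: lcs_closed].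
Qed.

Lemma profinite_lcs (X : topologicalType) (x y : X) : profinite_space X -> x <> y ->
  exists (T : Type) (g : X -> T), lcs g /\ g x <> g y.
Proof.
move=> pX /eqP xy; have [U [[oU cU] Ux nUy]] := profinite_zero_dimensional pX xy.
exists Prop, U; split; last by move=> e; apply: nUy; rewrite -e.
move=> z; have [Uz|nUz] := pselect (U z).
  apply: (@filterS _ (nbhs z) _ U); last exact: open_nbhs_nbhs.
  by move=> w Uw /=; apply/propext.
apply: (@filterS _ (nbhs z) _ (~` U)); first by move=> w nUw /=; apply/propext.
by apply: open_nbhs_nbhs; split=> //; exact: closed_openC.
Qed.

Lemma closed_subset_profinite (X : topologicalType) (A : set X) :
  profinite_space X -> closed A -> profinite_space (set_type A).
Proof.
move=> pX cA; apply: lcs_profinite; first by apply: set_type_compact => //; case: pX.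
move=> x y ne; have ne' : val x <> val y by move=> /val_inj.
have [T [g [lg h]]] := profinite_lcs pX ne'; exists T, (g \o val); split=> //.
by move=> z; exact: (lcs_precomp (@val_continuous X A) lg).
Qed.

Lemma compact_bijection (X Z : topologicalType) (f : X -> Z) (g : Z -> X) :
  compact [set: X] -> hausdorff_space Z -> continuous f -> cancel f g -> cancel g f ->
  continuous g.
Proof.
move=> cX hZ cf fg gf; apply/continuousP => U oU.
rewrite -(setCK (g @^-1` U)); apply: closed_openC.
have -> : ~` (g @^-1` U) = f @` (~` U).
  apply/seteqP; split=> [z nU|_ [x nU <-]]; first by exists (g z).
  by move=> /=; rewrite fg.
apply: compact_closed => //; apply: continuous_compact; first exact: continuous_subspaceT.
by apply: (subclosed_compact _ cX) => //; exact: open_closedC.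
Qed.

Lemma pgroup_of_exponents (p : nat) (Q : finGroupType) : prime p ->
  (forall z : Q, exists k, z ^+ (p ^ k) = 1) -> p.-group [set: Q]%SET.
Proof.
move=> pp h; apply/pgroupP => r rp rQ.
have [z _ oz] := Cauchy rp rQ; have [k zk] := h z.
have : #[z] %| p ^ k by rewrite order_dvdn zk.
by rewrite oz Euclid_dvdX // => /andP [rdp _]; rewrite inE /= -dvdn_prime2.
Qed.

Lemma lc_exponent (p : nat) (F : topGroupType) (Q : finGroupType) (q : F -> Q) : prime p ->
  pro_p_group p F -> {morph q : x y / x * y} -> lc q ->
  forall x, exists k, q x ^+ (p ^ k) = 1.
Proof.
move=> pp ppF qM lq x; have oW := lc_hom_kernel qM lq.
have [t [q' [q'M _ q'P pt]]] := pro_p_quotient pp ppF oW.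
have mX (Q' : finGroupType) (g : F -> Q') : {morph g : x y / x * y} -> forall n, g (x ^+ n) = g x ^+ n.
  by move=> gM; elim=> [|n IHn]; rewrite ?expg0 ?(morph1_grp gM) // !expgS gM IHn.
have /p_natP [k hk] : p.-nat #[q' x] by apply: (mem_p_elt pt); exact: finset.in_setT.
exists k; rewrite -mX //; have : q' 1 = q' (x ^+ (p ^ k)).
  by rewrite mX // -hk expg_order (morph1_grp q'M).
by move=> /q'P; rewrite invg1 mul1g.
Qed.

Lemma finite_group_model (p : nat) (H : topGroupType) : prime p -> finite_p_group p H ->
  pro_p_group p H /\ exists (t : ftable) (e : fcar t -> H),
    [/\ {morph e : x y / x * y}, injective e, (forall h, exists a, e a = h) &
        p.-group [set: fcar t]%SET].
Proof.
move=> pp [oH [n cH]].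
have fH : finite_set [set: H] by apply/finite_setP; exists (p ^ n)%N.
have cpH : compact [set: H] := finite_compact fH.
have oA (A : set H) : open A.
  have -> : A = \bigcup_(a in A) [set a] by apply/seteqP; split=> [x Ax|x [a Aa ->]]; [exists x|].
  by apply: bigcup_open => a _; exact: oH.
have nW : is_normal_subgroup [set 1 : H].
  split; first split=> //=.
  - by move=> x y /= -> ->; rewrite mulg1.
  - by move=> x /= ->; rewrite invg1.
  - by move=> g x /= ->; rewrite mulg1 mulgV.
have [t [q [qM qS qP _]]] := finite_quotient nW (finite_left_cosets cpH (conj nW (oA _))).
have qI : injective q by move=> x y /qP /= e; rewrite -(mulKVg x y) e mulg1.
have /choice [e eK] := qS.
have eM : {morph e : x y / x * y} by move=> x y; apply: qI; rewrite qM !eK.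
have cH' : ([set: H] #= `I_#|{: fcar t}|)%card.
  apply/card_set_bijP; exists (fun h => nat_of_ord (enum_rank (q h))); split.
  - by move=> h _; exact: ltn_ord.
  - by move=> x y _ _ h; apply: qI; apply: enum_rank_inj; exact: val_inj.
  - by move=> k /= kt; exists (e (enum_val (Ordinal kt))) => //; rewrite eK enum_valK.
have pt : p.-group [set: fcar t]%SET.
  have : (`I_(p ^ n) #= `I_#|{: fcar t}|)%card by apply: card_eq_trans cH'; rewrite card_eq_sym.
  by rewrite /pgroup cardsT => /card_eq_II <-; rewrite pnatX pnat_id.
split; last first.
  exists t, e; split=> //; first by move=> x y /(congr1 q); rewrite !eK.
  by move=> h; exists (q h); apply: qI; rewrite eK.
split.
  apply: lcs_profinite => // x y xy; exists H, id; split=> // z.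
  by apply: (@filterS _ (nbhs z) _ [set z]) => //; exact: open_nbhs_nbhs.
move=> U [sU _] _; apply: (index_p_power sU qM pt) => x q1.
have -> : x = 1 by apply: qI; rewrite q1 (morph1_grp qM).
by case: sU.
Qed.

Section Semidirect.
Variables (F H G : topGroupType) (iF : F -> G) (iH : H -> G).
Hypothesis sdG : is_semidirect iF iH.

Let iFM : {morph iF : x y / x * y}. Proof. by case: sdG => -[]. Qed.
Let iHM : {morph iH : x y / x * y}. Proof. by case: sdG => _ []. Qed.
Let iFc : continuous iF. Proof. by case: sdG => -[]. Qed.
Let iHc : continuous iH. Proof. by case: sdG => _ []. Qed.

Lemma semidirect_section : exists (sF : G -> F) (sH : G -> H),
  [/\ continuous sF, continuous sH, forall f h, sF (iF f * iH h) = f,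
      forall f h, sH (iF f * iH h) = h & forall g, g = iF (sF g) * iH (sH g)].
Proof.
have [_ _ _ [s [cs sK Ks]]] := sdG; exists (fst \o s), (snd \o s); split=> [g|g|f h|f h|g] /=.
- by apply: continuous_comp; [exact: cs|exact: cvg_fst].
- by apply: continuous_comp; [exact: cs|exact: cvg_snd].
- by have := sK (f, h) => /= ->.
- by have := sK (f, h) => /= ->.
- by rewrite [LHS](esym (Ks g)).
Qed.

Lemma semidirect_inj : injective iF.
Proof.
have [sF [sH [_ _ h _ _]]] := semidirect_section.
by move=> x y e; rewrite -(h x 1) -(h y 1) e.
Qed.

Lemma conj_inP g f : iF (conj_in iF g f) = g * iF f * g^-1.
Proof.
have [_ _ [_ nF] _] := sdG.
have [|f' _ hf'] := nF g (iF f); first by exists f.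
exact: (xgetPex f (ex_intro (fun f' => iF f' = g * iF f * g^-1) f' hf')).
Qed.

Lemma conj_in_morph g : {morph conj_in iF g : x y / x * y}.
Proof.
move=> x y; apply: semidirect_inj; rewrite iFM !conj_inP iFM.
by rewrite -!mulgA mulKg.
Qed.

Lemma conj_in_mul g g' f : conj_in iF (g * g') f = conj_in iF g (conj_in iF g' f).
Proof. by apply: semidirect_inj; rewrite !conj_inP invgM !mulgA. Qed.

Lemma conj_in_one f : conj_in iF 1 f = f.
Proof. by apply: semidirect_inj; rewrite conj_inP mul1g invg1 mulg1. Qed.

Lemma conj_in_continuous g : continuous (conj_in iF g).
Proof.
have [sF [sH [sFc _ h _ _]]] := semidirect_section.
have -> : conj_in iF g = sF \o (fun f => g * iF f * g^-1).
  by apply/funext => f /=; rewrite -conj_inP -[iF _]mulg1 -(morph1_grp iHM) h.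
move=> f; apply: continuous_comp; last exact: sFc.
apply: (@continuous_comp _ _ _ (fun f => g * iF f) (fun x => x * g^-1)); last exact: mulr_cts.
by apply: (@continuous_comp _ _ _ iF (fun x => g * x)); [exact: iFc|exact: mull_cts].
Qed.

(** In a finite quotient every element has p-power order: the power of g with exponent |H| lies in
    F. *)
Lemma semidirect_pro_p (p : nat) : prime p -> pro_p_group p F -> pro_p_group p H ->
  finite_p_group p H -> pro_p_group p G.
Proof.
move=> pp ppF ppH fH; have [sF [sH [sFc sHc sFE sHE Gs]]] := semidirect_section.
have [cF _ _] := ppF.1; have [cH _ _] := ppH.1.
have cG : compact [set: G].
  have -> : [set: G] = (fun fh : F * H => iF fh.1 * iH fh.2) @` [set: F * H].
    by apply/seteqP; split=> // g _; exists (sF g, sH g).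
  apply: continuous_compact; last by rewrite -setXTT; exact: compact_setX.
  apply: continuous_subspaceT => fh; apply: mulg_cts => z.
    by apply: continuous_comp; [exact: cvg_fst|exact: iFc].
  by apply: continuous_comp; [exact: cvg_snd|exact: iHc].
have pG : profinite_space G.
  apply: lcs_profinite => // g g' ne.
  have [nF|eF] := pselect (sF g <> sF g').
    have [T [u [lu hu]]] := profinite_lcs ppF.1 nF; exists T, (u \o sF); split=> //.
    by move=> z; exact: (lcs_precomp sFc lu).
  have {}eF : sF g = sF g' by exact: contrapT.
  have nH : sH g <> sH g' by move=> e; apply: ne; rewrite (Gs g) (Gs g') e eF.
  have [T [u [lu hu]]] := profinite_lcs ppH.1 nH; exists T, (u \o sH); split=> //.
  by move=> z; exact: (lcs_precomp sHc lu).
split=> // U nU oU.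
have [t [q [qM qS qP hc]]] := finite_quotient nU (finite_left_cosets cG (conj nU oU)).
suff pt : p.-group [set: fcar t]%SET.
  by apply: (index_p_power nU.1 qM pt) => x q1; rewrite -[x]mul1g -invg1; apply/qP; rewrite q1 morph1_grp.
apply: pgroup_of_exponents => // z; have [g <-] := qS z.
have [_ [t' [e [eM eI eS pt']]]] := finite_group_model pp fH.
have /p_natP [n hn] : p.-nat #|[set: fcar t']%SET| by exact: pt'.
have gX k : exists f, g ^+ k = iF f * iH (sH g ^+ k).
  elim: k => [|k [f hf]]; first by exists 1; rewrite !expg0 (morph1_grp iFM) (morph1_grp iHM) mulg1.
  exists (sF g * conj_in iF (iH (sH g)) f); rewrite !expgS hf iFM conj_inP iHM.
  by rewrite {1}(Gs g) !mulgA mulgKV.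
have [f hf] := gX (p ^ n)%N.
have Hn (h : H) : h ^+ (p ^ n) = 1.
  have [a <-] := eS h; have eX k : e a ^+ k = e (a ^+ k).
    by elim: k => [|k IHk]; rewrite ?expg0 ?(morph1_grp eM) // !expgS eM IHk.
  by rewrite eX -hn (@expg_cardG _ [set: fcar t']%G) ?(morph1_grp eM) // finset.in_setT.
rewrite Hn (morph1_grp iHM) mulg1 in hf.
have qFM : {morph q \o iF : x y / x * y} by move=> x y /=; rewrite iFM qM.
have lqF : lc (q \o iF).
  have lq : lc q := lc_of_quotient (conj nU oU) qP.
  by have [W [oW hW]] := lc_precomp iFM iFc lq; exists W.
have [k hk] := lc_exponent pp ppF qFM lqF f.
have qX m : q (g ^+ m) = q g ^+ m.
  by elim: m => [|m IHm]; rewrite ?expg0 ?(morph1_grp qM) // !expgS qM IHm.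
by exists (n + k)%N; rewrite expnD expgM -qX hf.
Qed.

End Semidirect.

Lemma abelianization_kernel_min (F : topGroupType) (N : set F) :
  is_normal_subgroup N -> closed N -> (forall x y, N [~ x, y]) -> (abelianization_kernel F : set F) `<=` N.
Proof.
move=> nN cN h; rewrite [X in _ `<=` X](closure_id N).1 //; apply: closure_subset => z hz.
by apply: hz; split; [exact: nN.1|move=> _ [[x y] _ <-]].
Qed.

(** The last three clauses say that x is a free pro-p basis converging to 1, tested on finite
    p-groups L. *)
Lemma equivariant_basis (p : nat) (F H G : topGroupType) (iF : F -> G) (iH : H -> G)
    (Ga : finGroupType) (e : Ga -> H) :
  prime p -> finite_p_group p H -> free_pro_p_group p F -> is_semidirect iF iH ->
  permutation_module p (@ab_conj F H G iF iH) ->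
  {morph e : a b / a * b} -> p.-group [set: Ga]%SET ->
  exists (Y : eqType) (yact : Ga -> Y -> Y) (x : Y -> F),
  [/\ (forall y, yact 1 y = y) /\ (forall a b y, yact (a * b) y = yact a (yact b y)),
      forall a y, conj_in iF (iH (e a)) (x y) = x (yact a y),
      forall U, onormal U -> exists ys : seq Y, forall y, y \notin ys -> U (x y),
      forall (L : finGroupType) (g g' : F -> L), p.-group [set: L]%SET ->
        {morph g : x y / x * y} -> {morph g' : x y / x * y} -> lc g -> lc g' ->
        (forall y, g (x y) = g' (x y)) -> forall f, g f = g' f &
      forall (L : finGroupType) (l : Y -> L) (ys : seq Y), p.-group [set: L]%SET ->
        (forall y, y \notin ys -> l y = 1) ->
        exists g : F -> L, [/\ {morph g : x y / x * y}, lc g & forall y, g (x y) = l y]].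
Proof.
move=> pp fH frF sdG [X [pt [act [theta [theta' [pX [thK thK'] [ctheta ctheta'] thM thA]]]]]] eM pGa.
have ppF : pro_p_group p F by case: frF => ? [? [? [_ []]]].
have iHM : {morph iH : x y / x * y} by case: sdG => _ [].
have liftF := @free_lift p F _ _ _ _ frF.
pose KN := abelianization_kernel F; pose K : set F := ns_set KN.
have nK : is_normal_subgroup K := ns_normal KN.
have cK : closed K by exact: closed_closure.
have Kcomm x y : K [~ x, y].
  apply: subset_closure => A [sA]; apply; by exists (x, y).
pose pi : F -> abelianization F := piq KN.
have piM x y : pi (x * y) = pi x * pi y by rewrite [RHS]piqM.
pose Tm f := theta (pi f).
have TmD f g : Tm (f * g) = (Tm f + Tm g)%R by rewrite /Tm piM thM.
have Tm_cts : continuous Tm.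
  by move=> f; apply: (@continuous_comp _ _ _ pi theta); [exact: piq_continuous|exact: ctheta].
have Tm_surj c : exists f, Tm f = c.
  by have := thK' c; elim/piq_ind: (theta' c) => f <-; exists f.
have Tm_K f : Tm f = 0%R -> K f.
  have th1 : theta 1 = 0%R by apply: (addrI (theta 1)); rewrite -thM mulg1 addr0.
  move=> h; have e1 : pi f = pi 1 by apply: (can_inj thK); rewrite -/(Tm f) h -th1.
  by have /piqP := esym e1; rewrite invg1 mul1g.
have K_Tm f g : K (f^-1 * g) -> Tm f = Tm g by move=> /piqP h; rewrite /Tm /pi h.
have Tm_ker (psi : F -> 'Z_p) : addhom psi -> lc psi -> forall f, Tm f = 0%R -> psi f = 0%R.
  move=> hM hl f /Tm_K; apply: (@abelianization_kernel_min F [set f | psi f = 0%R]) => /=.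
  - split; first split=> /=.
    + exact: addhom1.
    + by move=> u v /= hu hv; rewrite hM hu hv addr0.
    + by move=> u /= hu; rewrite addhomV // hu oppr0.
    + by move=> g u /= hu; rewrite !hM hu addr0 addhomV // subrr.
  - exact: (@lc_preimage_closed _ _ _ [set 0%R] hl).
  - move=> u v; rewrite /= /commg /conjg !hM !addhomV // !addrA addrC !addrA.
    by rewrite [(_ - _ - _)%R]addrAC subrr add0r addNr.
pose actF a f := conj_in iF (iH (e a)) f.
have actFM a : {morph actF a : x y / x * y} := conj_in_morph sdG (iH (e a)).
have actFc a : continuous (actF a) := @conj_in_continuous F H G iF iH sdG (iH (e a)).
have actF1 f : actF 1 f = f by rewrite /actF (morph1_grp eM) (morph1_grp iHM) (conj_in_one sdG).
have actFA a b f : actF (a * b) f = actF a (actF b f) by rewrite /actF eM iHM (conj_in_mul sdG).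
have actFV a f : actF a f^-1 = (actF a f)^-1 := morphV_grp (actFM a) f.
have actFK a : K `<=` (actF a) @^-1` K.
  apply: abelianization_kernel_min.
  - split; first split=> /=.
    + by rewrite (morph1_grp (actFM a)); exact: (nsub1 nK).
    + by move=> u v hu hv /=; rewrite actFM; exact: (nsubM nK hu hv).
    + by move=> u hu /=; rewrite actFV; exact: (nsubV nK hu).
    + by move=> g u hu /=; rewrite !actFM actFV; exact: (nsubJ _ nK hu).
  - by apply: preimage_closed => // f _; exact: actFc.
  - move=> u v /=; rewrite /commg /conjg !actFM !actFV; exact: Kcomm.
have Tm_act a f : Tm (actF a f) = zpx_act act (e a) (Tm f).
  rewrite -thA /ab_conj -/KN -/(pi _) -/(actF a _) -/(Tm _); apply: K_Tm.
  rewrite -actFV -actFM; apply: actFK; apply/piqP; exact: esym (reprqK (pi f)).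
have [Y [chi [chi0 [yact [[chiM chi_lc] chi_red [ci cs] [yact1 yactA] chi_act]]]]] :=
  character_basis pp ppF TmD Tm_cts Tm_surj Tm_ker pGa eM Tm_act.
have chi0_lc y : lc (chi0 y).
  by rewrite (_ : chi0 y = @redp p 0 \o chi 0 y); [exact: lc_comp|apply/funext => z /=; rewrite chi_red].
have chi0_M := chi0M pp chiM chi_red.
have chi0_act a y f : chi0 (yact a y) (actF a f) = chi0 y f.
  by rewrite -!(chi_red 0) chi_act.
have [|x [x_act x_dual x_cvg]] := equivariant_section ppF chi0_M chi0_lc actFM actFc actF1 actFA
    yact1 yactA chi0_act.
  move=> A y0 /forall_inP fy0.
  have [|f [hf hd]] := @fixed_dual p F Y pp ppF liftF chi chi0 chiM chi_lc chi_red ci cs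
     Ga actF yact pGa actFM actFc actF1 actFA yact1 yactA chi_act A y0.
    by move=> a aA; apply/eqP; exact: fy0.
  by exists f; split=> // y /forall_inP fy; apply: hd => a aA; apply/eqP; exact: fy.
have hinj := hom_inj pp cs pGa yact1 yactA chi0_act x_act x_dual.
have hsurj := hom_surj pp chi0_M chi0_lc pGa yact1 yactA chi0_act x_act x_dual x_cvg.
exists Y, yact, x; split=> //.
- by move=> L g g'; exact: (basis_uniq pp hinj).
- by move=> L l ys; exact: (basis_exists pp liftF x_cvg hsurj).
Qed.

(** * Models of the free pro-p groups and free pro-p products *)

Section FreePointed.
Variables (p : nat) (X : topologicalType) (pt : X).
Hypothesis pp : prime p.

(* pt pt = pt amounts to pt = 1. *)
Definition pt_rel (a b c : X) := [/\ a = pt, b = pt & c = pt].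

Definition free_pointed : topGroupType := presented p pt_rel.

Lemma free_pointedP : is_free_pro_p_on p pt (@pgen p X pt_rel : X -> free_pointed).
Proof.
split; [exact: presented_pro_p|exact: pgen_continuous| |].
  by apply: (mulgI (@pgen p X pt_rel pt)); rewrite mulg1 (@pgen_rel _ _ _ pt pt pt).
move=> L f ppL cf f1; apply: presented_universal => // a b c [-> -> ->].
by rewrite f1 mulg1.
Qed.

End FreePointed.

Section FreeProduct.
Variables (p : nat) (I : finType) (Fs : I -> topGroupType) (K : topGroupType).
Hypothesis pp : prime p.

Definition factor (o : option I) : topGroupType := if o is Some i then Fs i else K.

Definition factor_sum : topologicalType := {o : option I & factor o}.

Definition factor_rel (a b c : factor_sum) := exists (o : option I) (u v : factor o),
  [/\ a = existT _ o u, b = existT _ o v & c = existT _ o (u * v)].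

Definition free_product : topGroupType := presented p factor_rel.

Definition in_factor (o : option I) (u : factor o) : free_product :=
  pgen p factor_rel (existT (fun o => factor o) o u).

Lemma in_factor_hom o : is_top_hom (@in_factor o).
Proof.
split; first by move=> u v; apply/esym; apply: pgen_rel; exists o, u, v.
move=> u; apply: (@continuous_comp _ _ _ (existT (fun o => factor o) o)); last exact: pgen_continuous.
exact: existT_continuous.
Qed.

Lemma free_productP : is_free_pro_p_product p
  (fun i (u : Fs i) => @in_factor (Some i) u) (fun k : K => @in_factor None k).
Proof.
split; [exact: presented_pro_p|by move=> i; exact: (in_factor_hom (Some i))|exact: (in_factor_hom None)|].
move=> L f k ppL hf hk.
pose g0 (o : option I) : factor o -> L := if o is Some i then f i else k.
have g0M o : {morph g0 o : u v / u * v} by case: o => [i|] /=; [case: (hf i)|case: hk].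
have cg : continuous (fun s : factor_sum => g0 (projT1 s) (projT2 s)).
  have := @sigT_continuous _ _ L g0.
  by apply=> -[i|]; [case: (hf i)|case: hk].
have [|g [[gh gs] gu]] := presented_universal pp ppL cg (Rel := factor_rel).
  by move=> a b c [o [u [v [-> -> ->]]]] /=; rewrite g0M.
exists g; split.
  by split=> // [i u|u]; [exact: (gs (existT _ (Some i) u))|exact: (gs (existT _ None u))].
move=> g' [g'h g'F g'K]; apply: gu; split=> // -[[i|] u]; [exact: g'F|exact: g'K].
Qed.

End FreeProduct.

(** * Representatives of conjugacy classes and of orbits *)

Section ConjugacyReps.
Variable Ga : finGroupType.
Implicit Types A B : {group Ga}.

Definition conj_rep A : {group Ga} :=
  odflt A [pick B : {group Ga} | [exists g, B :==: A :^ g]].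

Lemma conj_repP A : exists g, conj_rep A :=: A :^ g.
Proof.
rewrite /conj_rep; case: pickP => [B /existsP [g /eqP h]|_]; first by exists g.
by exists 1; rewrite conjsg1.
Qed.

Lemma conj_rep_eq A B g : B :=: A :^ g -> conj_rep B = conj_rep A.
Proof.
move=> h; rewrite /conj_rep.
have e : (fun C : {group Ga} => [exists g, C :==: B :^ g]) =1 (fun C : {group Ga} => [exists g, C :==: A :^ g]).
  move=> C; apply/existsP/existsP => -[k /eqP hk].
    by exists (g * k); rewrite hk h conjsgM.
  by exists (g^-1 * k); rewrite hk conjsgM h conjsgK.
rewrite (eq_pick e); case: pickP => // /(_ A) /existsP []; exists 1; by rewrite conjsg1.
Qed.

End ConjugacyReps.

Section OrbitReps.
Variables (Ga : finGroupType) (Y : eqType) (yact : Ga -> Y -> Y).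
Hypothesis yact1 : forall y, yact 1 y = y.
Hypothesis yactA : forall a b y, yact (a * b) y = yact a (yact b y).

Definition St y : {group Ga} := stab_group yact1 yactA [set: Ga]%G y.

Lemma StP a y : (a \in St y) = (yact a y == y).
Proof. by rewrite inE finset.in_setT. Qed.

Lemma St_act a y : St (yact a y) :=: St y :^ a^-1.
Proof.
apply/setP => b; rewrite mem_conjg invgK !StP -[in RHS](inj_eq (gact_inj yact1 yactA (g:=a))).
by rewrite -!yactA /conjg mulKVg.
Qed.

(** The stabilizers along an orbit fill a conjugacy class, so some point of the orbit has the chosen
    representative as stabilizer. Orbits with conjugate stabilizers thus share one associated
    subgroup, as pairwise non-conjugacy demands. *)
Lemma orbit_reps : exists ry : Y -> Y, [/\ forall y, exists a, y = yact a (ry y),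
  forall a y, ry (yact a y) = ry y & forall y, conj_rep (St (ry y)) = St (ry y)].
Proof.
have [[yd _]|nY] := pselect ([set: Y] !=set0); last first.
  by exists id; split=> [y|a y|y]; case: nY; exists y.
have /choice [f fP] : forall S : set Y, exists v, S !=set0 -> S v.
  by move=> S; have [[v Sv]|nS] := pselect (S !=set0); [exists v|exists yd].
pose O y := [set v | (exists a, v = yact a y) /\ conj_rep (St v) = St v].
have OA a y : O (yact a y) = O y.
  apply/seteqP; split=> v [[b ->] h]; split=> //; first by exists (b * a); rewrite yactA.
  by exists (b * a^-1); rewrite -yactA mulgKV.
have fO y : O y (f (O y)).
  apply: fP; have [g hg] := conj_repP (St y); exists (yact g^-1 y); split; first by exists g^-1.
  have h : St (yact g^-1 y) :=: St y :^ g by rewrite St_act invgK.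
  by apply/val_inj => /=; rewrite (conj_rep_eq h) hg h.
exists (fun y => f (O y)); split=> [y|a y|y].
- by have [[a ha] _] := fO y; exists a^-1; rewrite ha -yactA mulVg yact1.
- by rewrite OA.
- by have [] := fO y.
Qed.

End OrbitReps.

(** Away from 1 only finitely many values of x remain. *)
Lemma closed_convergent_range (F : topGroupType) (Y : eqType) (x : Y -> F) (B : set Y) :
  profinite_space F ->
  (forall U, onormal U -> exists ys : seq Y, forall y, y \notin ys -> U (x y)) ->
  closed [set f | f = 1 \/ exists y, B y /\ f = x y].
Proof.
move=> pF x_cvg f clf; have [|f1] := pselect (f = 1); first by left.
have [W [oW nWf]] : exists W, onormal W /\ ~ W f.
  by apply: contrapT => h; apply: f1; apply: (onormal_separates pF) => W oW; apply: contrapT => nW; apply: h; exists W.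
have [ys hys] := x_cvg W oW; have nW := oW.1; have [_ hF _] := pF.
have clB : closure [set g | exists y, [/\ B y, y \in ys & g = x y]] f.
  move=> C nC; have [g [[g1|[y [By ey]]] [Cg Wg]]] := clf _ (filterI nC (onormal_nbhsx f oW)).
    by case: nWf; rewrite -[f]invgK; apply: nsubV => //; move: Wg; rewrite /= g1 mulg1.
  exists g; split=> //; exists y; split=> //; apply: contrapT => /negP /hys Wy.
  by apply: nWf; rewrite -[f]invgK; apply: nsubV => //; rewrite -[f^-1](mulgK g) ; apply: nsubM => //; apply: nsubV; rewrite // ey.
have cB : closed [set g | exists y, [/\ B y, y \in ys & g = x y]].
  elim: (ys) => [|y s IHs].
    by rewrite (_ : [set g | _] = set0); [exact: closed0|apply/seteqP; split=> // g [y []]].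
  have [By|nBy] := pselect (B y).
    rewrite (_ : [set g | _] = [set x y] `|` [set g | exists y, [/\ B y, y \in s & g = x y]]).
      by apply: closedU => //; apply: accessible_closed_set1; exact: hausdorff_accessible.
    apply/seteqP; split=> [g [z [Bz]]|g [->|[z [Bz zs ->]]]].
    - by rewrite inE => /orP [/eqP -> ->|zs ->]; [left|right; exists z].
    - by exists y; rewrite mem_head.
    - by exists z; rewrite inE zs orbT.
  rewrite (_ : [set g | _] = [set g | exists y, [/\ B y, y \in s & g = x y]]) //.
  apply/seteqP; split=> [g [z [Bz]]|g [z [Bz zs ->]]]; last by exists z; rewrite inE zs orbT.
  by rewrite inE => /orP [/eqP e|zs ->]; [case: nBy; rewrite -e|exists z].
by have [y [By _ ey]] := cB f clB; right; exists y.
Qed.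

(** * The semidirect product as an HNN-extension *)

Section Assembly.
Variables (p : nat) (F H G : topGroupType) (iF : F -> G) (iH : H -> G).
Hypotheses (pp : prime p) (fH : finite_p_group p H).
Hypotheses (ppF : pro_p_group p F) (ppH : pro_p_group p H) (sdG : is_semidirect iF iH).
Variables (Ga : finGroupType) (e : Ga -> H).
Hypotheses (eM : {morph e : a b / a * b}) (eI : injective e) (eS : forall h, exists a, e a = h).
Variables (Y : eqType) (yact : Ga -> Y -> Y) (x : Y -> F).
Hypothesis yact1 : forall y, yact 1 y = y.
Hypothesis yactA : forall a b y, yact (a * b) y = yact a (yact b y).
Hypothesis x_act : forall a y, conj_in iF (iH (e a)) (x y) = x (yact a y).
Hypothesis x_cvg : forall U, onormal U -> exists ys : seq Y, forall y, y \notin ys -> U (x y).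
Hypothesis b_uniq : forall (L : finGroupType) (g g' : F -> L), p.-group [set: L]%SET ->
  {morph g : x y / x * y} -> {morph g' : x y / x * y} -> lc g -> lc g' ->
  (forall y, g (x y) = g' (x y)) -> forall f, g f = g' f.
Hypothesis b_exists : forall (L : finGroupType) (l : Y -> L) (ys : seq Y), p.-group [set: L]%SET ->
  (forall y, y \notin ys -> l y = 1) ->
  exists g : F -> L, [/\ {morph g : x y / x * y}, lc g & forall y, g (x y) = l y].
Variable ry : Y -> Y.
Hypothesis ryO : forall y, exists a, y = yact a (ry y).
Hypothesis ryA : forall a y, ry (yact a y) = ry y.
Hypothesis ryS : forall y, conj_rep (St yact1 yactA (ry y)) = St yact1 yactA (ry y).

Local Notation St := (St yact1 yactA).

Let iFM : {morph iF : x y / x * y}. Proof. by case: sdG => -[]. Qed.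
Let iHM : {morph iH : x y / x * y}. Proof. by case: sdG => _ []. Qed.
Let iFc : continuous iF. Proof. by case: sdG => -[]. Qed.
Let iHc : continuous iH. Proof. by case: sdG => _ []. Qed.

Let ryK y : ry (ry y) = ry y.
Proof. by have [a ha] := ryO y; rewrite [in RHS]ha ryA. Qed.

Definition hI : finType := {A : {group Ga} | conj_rep A == A}.
Definition hA (i : hI) : set H := e @` [set a | a \in val i].
(** The stable letters with associated subgroup i, taken as a subspace of F with base point 1. If i
    is not the stabilizer of a representative, only the base point is left. *)
Definition hX (i : hI) : set F := [set f | f = 1 \/ exists y, (ry y = y /\ St y = val i) /\ f = x y].
Definition hpt (i : hI) : set_type (hX i) := exist _ 1 (mem_set (or_introl (erefl : 1 = 1 :> F))).

Lemma hA_subgroup i : is_subgroup (hA i).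
Proof.
split; first by exists 1; [exact: group1|exact: morph1_grp].
  by move=> _ _ [a aA <-] [b bA <-]; exists (a * b); [exact: groupM|exact: eM].
by move=> _ [a aA <-]; exists a^-1; [rewrite /= groupV|exact: morphV_grp].
Qed.

Lemma hA_closed i : is_subgroup (hA i) /\ closed (hA i).
Proof.
split; first exact: hA_subgroup.
rewrite -(setCK (hA i)); apply: open_closedC.
have -> : ~` hA i = \bigcup_(a in ~` hA i) [set a].
  by apply/seteqP; split=> [h nh|h [a na ->]] //; exists h.
by apply: bigcup_open => a _; case: fH.
Qed.

Lemma hA_nonconj (i j : hI) (k : H) : i <> j -> hA j <> [set k * a * k^-1 | a in hA i].
Proof.
have [g <-] := eS k; move=> ij h; apply: ij.
have ev a : e a^-1 = (e a)^-1 := morphV_grp eM a.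
have e1 : val j :=: val i :^ g^-1.
  apply/setP => b; rewrite mem_conjg invgK; apply/idP/idP => hb.
    have : hA j (e b) by exists b.
    rewrite h => -[_ [a ai <-]]; rewrite -ev -!eM => /eI <-.
    by rewrite /conjg !mulgA mulVg mul1g mulgKV.
  have : [set e g * a * (e g)^-1 | a in hA i] (e b).
    exists (e (b ^ g)); first by exists (b ^ g).
    by rewrite -ev -!eM /conjg mulKVg mulgK.
  by rewrite -h => -[b' bj /eI <-].
apply/val_inj; have /eqP <- := valP i; have /eqP <- := valP j.
by rewrite (conj_rep_eq e1).
Qed.

Lemma hX_closed i : closed (hX i).
Proof. exact: (@closed_convergent_range F Y x [set y | ry y = y /\ St y = val i] ppF.1 x_cvg). Qed.

Lemma hX_profinite i : profinite_space (set_type (hX i)).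
Proof. by apply: closed_subset_profinite; [case: ppF|exact: hX_closed]. Qed.

Lemma hphi_continuous i :
  {within hA i `*` [set: set_type (hX i)], continuous (fun ax : H * set_type (hX i) => ax.1)}.
Proof. by apply: continuous_subspaceT => z; exact: cvg_fst. Qed.

Definition assembly_data : HNN_data H :=
  @HNNData H hI hA (fun i => set_type (hX i)) hpt (fun i a _ => a) hA_closed hA_nonconj
    hX_profinite hphi_continuous (fun _ _ _ _ _ _ => erefl) (fun _ _ _ _ _ _ h => h)
    (fun _ _ _ => erefl).

Local Notation D := assembly_data.

Let Fs (i : hI) : topGroupType := free_pointed p (hpt i).
Let io (i : hI) : set_type (hX i) -> Fs i := @pgen p (set_type (hX i)) (pt_rel (hpt i)).
Let freeP i : is_free_pro_p_on p (hpt i) (@io i) := free_pointedP (hpt i) pp.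
Let P : topGroupType := free_product p Fs H.
Let inF (i : hI) (u : Fs i) : P := @in_factor p hI Fs H (Some i) u.
Let inK (k : H) : P := @in_factor p hI Fs H None k.
Let prodP : is_free_pro_p_product p (@inF) inK := free_productP Fs H pp.
Let ppP : pro_p_group p P. Proof. by case: prodP. Qed.
Let N : normalSubgroup P := @hnn_kernel H D Fs io P inF inK.
Let ppG : pro_p_group p G := semidirect_pro_p sdG pp ppF ppH fH.

Let inKM : {morph inK : a b / a * b}. Proof. by case: prodP => _ _ []. Qed.
Let inKc : continuous inK. Proof. by case: prodP => _ _ []. Qed.
Let inFM i : {morph @inF i : a b / a * b}. Proof. by case: prodP => _ /(_ i) []. Qed.
Let inFc i : continuous (@inF i). Proof. by case: prodP => _ /(_ i) []. Qed.

Lemma hX_fixed i (z : set_type (hX i)) a : a \in val i -> iH (e a) * iF (val z) = iF (val z) * iH (e a).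
Proof.
move=> ai; suff h : conj_in iF (iH (e a)) (val z) = val z.
  by rewrite -[in RHS]h (conj_inP sdG) mulgKV.
case: (set_mem (valP z)) => [->|[y [[_ Sy] ->]]]; first exact: morph1_grp (conj_in_morph sdG _).
by rewrite x_act; congr x; apply/eqP; rewrite -(StP yact1 yactA) Sy.
Qed.

Lemma base_map : exists Phi : P -> G, [/\ is_top_hom Phi, forall k, Phi (inK k) = iH k &
  forall i (z : set_type (hX i)), Phi (inF (io z)) = iF (val z)].
Proof.
have fex i : exists f : Fs i -> G, is_top_hom f /\ forall z, f (io z) = iF (val z).
  have [_ _ _ univ] := freeP i.
  have [|||f [[fh fE] _]] := univ G (fun z => iF (val z)) => //; last by exists f.
    move=> z; apply: (@continuous_comp _ _ _ (val : set_type (hX i) -> F) iF); last exact: iFc.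
    exact: val_continuous.
  by rewrite /= (morph1_grp iFM).
pose f i := projT1 (cid (fex i)); have fP i := projT2 (cid (fex i)).
have [_ _ _ univ] := prodP.
have [||Phi [[Ph PF PK] _]] := univ G f iH ppG.
- by move=> i; case: (fP i).
- by split.
by exists Phi; split=> // i z; have [_ h] := fP i; rewrite PF; exact: h.
Qed.

Section BaseMap.
Variable Phi : P -> G.
Hypotheses (Phom : is_top_hom Phi) (PhiK : forall k, Phi (inK k) = iH k).
Hypothesis PhiF : forall i (z : set_type (hX i)), Phi (inF (io z)) = iF (val z).

Let PM : {morph Phi : a b / a * b} := Phom.1.
Let Pc : continuous Phi := Phom.2.

Lemma N_relator i (z : set_type (hX i)) a : a \in val i ->
  (N : set P) ((inK (e a))^-1 * (inF (io z) * inK (e a) * (inF (io z))^-1)).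
Proof. by move=> ai M [_ _]; apply; exists i, (e a), z; split=> //; exists a. Qed.

Lemma Phi_relator i (z : set_type (hX i)) a : a \in val i ->
  Phi ((inK (e a))^-1 * (inF (io z) * inK (e a) * (inF (io z))^-1)) = 1.
Proof.
move=> ai; rewrite !PM !(morphV_grp PM) !PhiK !PhiF.
by rewrite -(hX_fixed z ai) mulgK mulVg.
Qed.

Lemma N_kernel u : (N : set P) u -> Phi u = 1.
Proof.
move=> hu; apply: (hu [set u | Phi u = 1]); split => /=.
- split; first split=> /=.
  + exact: morph1_grp PM.
  + by move=> a b /= ha hb; rewrite PM ha hb mulg1.
  + by move=> a /= ha; rewrite (morphV_grp PM) ha invg1.
  + by move=> g a /= ha; rewrite !PM ha (morphV_grp PM) mulg1 mulgV.
- rewrite -/(Phi @^-1` [set 1]); apply: preimage_closed => [g _|]; first exact: Pc.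
  by apply: accessible_closed_set1; apply: hausdorff_accessible; case: ppG.1.
- by move=> _ [i [_ [z [[a ai <-] ->]]]]; exact: (Phi_relator z ai).
Qed.

Let ir_subproof y : conj_rep (St (ry y)) == St (ry y). Proof. by rewrite ryS. Qed.
Let ir (y : Y) : hI := exist _ (St (ry y)) (ir_subproof y).
Let zr_subproof y : hX (ir y) (x (ry y)).
Proof. by right; exists (ry y); split=> //; split=> //; exact: ryK. Qed.
Let zr (y : Y) : set_type (hX (ir y)) := exist _ (x (ry y)) (mem_set (zr_subproof y)).

Let sF := projT1 (cid (semidirect_section sdG)).
Let sH := projT1 (cid (projT2 (cid (semidirect_section sdG)))).
Let sP : [/\ continuous sF, continuous sH, forall f h, sF (iF f * iH h) = f,
  forall f h, sH (iF f * iH h) = h & forall g, g = iF (sF g) * iH (sH g)].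
Proof. exact: (projT2 (cid (projT2 (cid (semidirect_section sdG))))). Qed.

Let conj_x a y : iF (x (yact a y)) = iH (e a) * iF (x y) * (iH (e a))^-1.
Proof. by rewrite -x_act (conj_inP sdG). Qed.

(** The preimage in F of the image is a closed subgroup containing all x y. Were it not dense, its
    image in a finite p-quotient would lie in a maximal subgroup, which is normal; the quotient by
    that subgroup is trivial on x, hence trivial by [b_uniq]. *)
Lemma Phi_surj g : exists u, Phi u = g.
Proof.
have [cP _ _] := ppP.1; have [_ hG _] := ppG.1.
pose E : set F := iF @^-1` (range Phi).
have cE : closed E.
  apply: preimage_closed => [f _|]; first exact: iFc.
  apply: compact_closed => //; apply: continuous_compact => //; exact: continuous_subspaceT.
have E1 : E 1 by exists 1 => //; rewrite (morph1_grp PM) (morph1_grp iFM).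
have EM f f' : E f -> E f' -> E (f * f').
  by move=> [u _ hu] [u' _ hu']; exists (u * u') => //; rewrite PM hu hu' iFM.
have Ex y : E (x y).
  have [a ha] := ryO y; exists (inK (e a) * inF (io (zr y)) * (inK (e a))^-1) => //.
  by rewrite !PM (morphV_grp PM) PhiK PhiF [in RHS]ha conj_x.
have Edense W : onormal W -> forall f, exists2 f', E f' & W (f^-1 * f').
  move=> oW f; have [t [q [qM qS qP pt]]] := pro_p_quotient pp ppF oW.
  pose B : {set fcar t} := [set b | `[< exists2 f', E f' & q f' = b >]]%SET.
  have BP b : reflect (exists2 f', E f' & q f' = b) (b \in B) by rewrite inE; exact: asboolP.
  have gB : group_set B.
    apply/group_setP; split; first by apply/BP; exists 1; rewrite // (morph1_grp qM).
    by move=> _ _ /BP [f1 h1 <-] /BP [f2 h2 <-]; apply/BP; exists (f1 * f2); [exact: EM|exact: qM].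
  have sBT : Group gB \subset [set: fcar t]%G by exact: finset.subsetT.
  suff BT : B = [set: fcar t]%SET.
    have : q f \in B by rewrite BT finset.in_setT.
    by move=> /BP [f' Ef' e']; exists f' => //; apply/qP.
  have [//|[M maxM BM]] := maximal_exists sBT.
  have nM : M <| [set: fcar t]%G by apply: (p_maximal_normal _ maxM); exact: pt.
  have NM b : b \in 'N(M) by case/andP: nM => _ /fintype.subsetP; apply; exact: finset.in_setT.
  have eT : [set: coset_of M]%SET = ([set: fcar t]%G / M).
    apply/setP => b; rewrite finset.in_setT; apply/esym; have [c Nc ->] := cosetP b.
    by apply: mem_quotient; exact: finset.in_setT.
  have pM : p.-group [set: coset_of M]%SET by rewrite eT; exact: quotient_pgroup.
  have all1 f' : coset M (q f') = 1.
    apply: (@b_uniq _ (fun f => coset M (q f)) (fun=> 1) pM).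
    - by move=> f1 f2; rewrite qM morphM.
    - by move=> f1 f2; rewrite mulg1.
    - exact: (lc_comp (coset M) (lc_of_quotient oW qP)).
    - exact: lc_cst.
    - move=> y; apply: coset_id; apply: (fintype.subsetP BM); apply/BP; by exists (x y).
  have /andP [_ /negP] := maxgroupp maxM; case.
  apply/fintype.subsetP => b _; have [f' <-] := qS b; exact: coset_idr (NM _) (all1 f').
have EF f : E f.
  apply: cE => C nC.
  have nC1 : nbhs (1 : F) [set w | C (f * w)] by apply: (@mull_cts _ f 1); rewrite mulg1.
  have [W [oW WC]] := onormal_exists ppF.1 nC1; have [f' Ef' Wf'] := Edense W oW f.
  by exists f'; split=> //; have := WC _ Wf'; rewrite /= mulKVg.
have [_ _ _ _ sE] := sP; rewrite (sE g).
by have [u _ hu] := EF (sF g); exists (u * inK (sH g)); rewrite PM hu PhiK.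
Qed.

Lemma hpt_nbhs i (D : set (set_type (hX i))) : nbhs (hpt i) D ->
  exists W : set F, onormal W /\ forall z, W (val z) -> D z.
Proof.
rewrite nbhsE => -[U [oU U1] UD]; have [V oV VU] := oU.
have nV : nbhs (1 : F) V by apply: open_nbhs_nbhs; split=> //; move: U1; rewrite -VU.
have [W [oW WV]] := onormal_exists ppF.1 nV; exists W; split=> // z Wz.
by apply: UD; rewrite -VU; exact: WV.
Qed.

Section Separate.
Variables (Q : finGroupType) (pi : P -> Q).
Hypotheses (pQ : p.-group [set: Q]%SET) (piM : {morph pi : u v / u * v}) (pil : lc pi).
Hypothesis piN : forall u, (N : set P) u -> pi u = 1.

Let pK a := pi (inK (e a)).
Let pKM : {morph pK : a b / a * b}. Proof. by move=> a b; rewrite /pK eM inKM piM. Qed.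
Let c0 y := pi (inF (io (zr y))).

Let c0_comm y a : a \in St (ry y) -> pK a * c0 y = c0 y * pK a.
Proof.
move=> aS; have := piN (N_relator (zr y) (aS : a \in val (ir y))).
rewrite !piM !(morphV_grp piM) -/(pK a) -/(c0 y) => h.
by have := congr1 (fun b => pK a * b * c0 y) h; rewrite mulg1 mulKVg mulgKV.
Qed.

(** The images of the stable letters extend along orbits by conjugation, consistently because the
    relators make them commute with the stabilizers. They are trivial almost everywhere by
    continuity of pi at the finitely many base points. *)
Lemma generator_values : exists l : Y -> Q, [/\ forall a y, l (yact a y) = pK a * l y * (pK a)^-1,
  forall y, ry y = y -> l y = c0 y & exists ys : seq Y, forall y, y \notin ys -> l y = 1].
Proof.
have /choice [ga gaP] := ryO.
pose l y := pK (ga y) * c0 (ry y) * (pK (ga y))^-1.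
have lE b y : y = yact b (ry y) -> l y = pK b * c0 (ry y) * (pK b)^-1.
  move=> hb; pose s := b^-1 * ga y.
  have sS : s \in St (ry (ry y)) by rewrite StP ryK /s yactA -gaP {1}hb -yactA mulVg yact1.
  rewrite /l; have -> : ga y = b * s by rewrite /s mulKVg.
  by rewrite pKM invMg -(mulgA (pK b)) (c0_comm sS) !mulgA mulgK.
exists l; split=> [a y|y yr|].
- have h : yact a y = yact (a * ga y) (ry (yact a y)) by rewrite ryA yactA -gaP.
  by rewrite (lE _ _ h) ryA /l pKM invMg !mulgA.
- have h : y = yact 1 (ry y) by rewrite yact1 yr.
  by rewrite (lE _ _ h) (morph1_grp pKM) mul1g invg1 mulg1 yr.
have /choice [W WP] : forall i : hI, exists W : set F, onormal W /\
    forall z : set_type (hX i), W (val z) -> pi (inF (io z)) = 1.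
  move=> i; apply: (@hpt_nbhs i [set z | pi (inF (io z)) = 1]).
  have cio : continuous (@io i) by case: (freeP i).
  have l1 : lcs (fun z : set_type (hX i) => pi (inF (io z))).
    have lF : lcs (fun u : Fs i => pi (inF u)).
      by move=> u; exact: (lcs_precomp (@inFc i) (cts_lcs (lc_continuous pil))).
    by move=> z; exact: (lcs_precomp cio lF).
  have e1 : pi (inF (io (hpt i))) = 1.
    have [_ _ -> _] := freeP i; by rewrite (morph1_grp (@inFM i)) (morph1_grp piM).
  by have := l1 (hpt i); rewrite e1.
have /choice [yi yiP] : forall i : hI, exists ys : seq Y, forall y, y \notin ys -> W i (x y).
  by move=> i; apply: x_cvg; have [] := WP i.
exists [seq yact a v | a <- enum {: Ga}, v <- flatten [seq yi i | i <- enum {: hI}]].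
move=> y ny; rewrite /l; suff -> : c0 (ry y) = 1 by rewrite mulg1 mulgV.
have [_ h] := WP (ir (ry y)); apply: h; apply: yiP => /=; rewrite ryK; apply: contra ny => hy.
apply/allpairsP; exists (ga y, ry y); split=> //=; first by rewrite mem_enum.
by apply/flatten_mapP; exists (ir (ry y)) => //; rewrite mem_enum.
Qed.

(** pi factors through Phi as [rho], which is built on F from the values of [generator_values] and
    on H from pi. That [rho] is multiplicative amounts to equivariance of [rF], which [b_uniq]
    checks on x; the factorization holds by uniqueness in the universal properties. *)
Lemma separate u : Phi u = 1 -> pi u = 1.
Proof.
have [l [lA lr [ys l1]]] := generator_values.
have [rF [rFM lrF rFx]] := b_exists pQ l1.
have cjM a : {morph conj_in iF (iH (e a)) : f f' / f * f'} := conj_in_morph sdG _.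
have cjc a : continuous (conj_in iF (iH (e a))) := @conj_in_continuous _ _ _ _ _ sdG _.
have rFA a f : rF (conj_in iF (iH (e a)) f) = pK a * rF f * (pK a)^-1.
  apply: (@b_uniq Q (fun f => rF (conj_in iF (iH (e a)) f)) (fun f => pK a * rF f * (pK a)^-1) pQ).
  - by move=> f1 f2; rewrite cjM rFM.
  - by move=> f1 f2; rewrite rFM !mulgA mulgKV.
  - by have [W [oW hW]] := lc_precomp (cjM a) (cjc a) lrF; exists W.
  - exact: (lc_comp (fun b => pK a * b * (pK a)^-1) lrF).
  - by move=> y; rewrite x_act !rFx lA.
have [sFc sHc sFE sHE sE] := sP.
pose rho g := rF (sF g) * pi (inK (sH g)).
have rhoM : {morph rho : g g' / g * g'}.
  move=> g g'; have [a ha] := eS (sH g).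
  have h : g * g' = iF (sF g * conj_in iF (iH (e a)) (sF g')) * iH (sH g * sH g').
    rewrite {1}(sE g) {1}(sE g') iFM (conj_inP sdG) iHM ha !mulgA; congr (_ * _).
    by rewrite mulgKV.
  rewrite /rho h sFE sHE rFM rFA inKM piM -ha -/(pK a) !mulgA; congr (_ * _).
  by rewrite mulgKV.
have rhoK k : rho (iH k) = pi (inK k).
  by rewrite /rho -[iH k]mul1g -(morph1_grp iFM) sFE sHE (morph1_grp rFM) mul1g.
have rhoF f : rho (iF f) = rF f.
  by rewrite /rho -[iF f]mulg1 -(morph1_grp iHM) sFE sHE (morph1_grp inKM) (morph1_grp piM) mulg1.
have rhoc : continuous (rho : G -> dgrp Q).
  apply: lcs_cts; apply: (lcs_op (fun a b => a * b)).
    by move=> g; exact: (lcs_precomp sFc (cts_lcs (lc_continuous lrF))).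
  move=> g; apply: (lcs_precomp (g := fun k => pi (inK k)) sHc) => k.
  exact: (lcs_precomp inKc (cts_lcs (lc_continuous pil))).
have ppQ : pro_p_group p (dgrp Q) := dgrp_pro_p pQ.
have pic : continuous (pi : P -> dgrp Q) := lc_continuous pil.
have pih : @is_top_hom P (dgrp Q) pi by [].
have rPh : @is_top_hom P (dgrp Q) (rho \o Phi).
  by split=> [a b|a]; [rewrite /= PM rhoM|apply: continuous_comp; [exact: Pc|exact: rhoc]].
(* A letter over i has to be compared with [zr y], which lives over an index only provably equal to
   i. *)
have hdep i i' (z : set_type (hX i)) (z' : set_type (hX i')) : i = i' -> val z = val z' ->
    pi (inF (io z)) = pi (inF (io z')).
  by move=> ii'; move: z'; rewrite -ii' => z' /val_inj ->.
have io_eq i (z : set_type (hX i)) : rho (Phi (inF (io z))) = pi (inF (io z)).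
  rewrite PhiF rhoF; case: (set_mem (valP z)) => [z1|[y [[yr Sy] zy]]].
    have -> : z = hpt i by apply: val_inj.
    have [_ _ -> _] := freeP i.
    by rewrite (morph1_grp (@inFM i)) (morph1_grp piM) /= (morph1_grp rFM).
  rewrite zy rFx lr //; apply: hdep; last by rewrite zy /= yr.
  by apply: val_inj => /=; rewrite yr Sy.
have F_eq i (w : Fs i) : rho (Phi (inF w)) = pi (inF w).
  have [_ cio io1 univ] := freeP i.
  have hF : is_top_hom (@inF i) by case: prodP.
  have [||g [_ gu]] := univ (dgrp Q) (fun z => pi (inF (io z))) ppQ.
  - move=> z; apply: (@continuous_comp _ _ _ (@io i) (fun w => pi (inF w) : dgrp Q)); first exact: cio.
    by apply: (@continuous_comp _ _ _ (@inF i) (pi : P -> dgrp Q)); [exact: inFc|exact: pic].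
  - by rewrite io1 (morph1_grp (@inFM i)) (morph1_grp piM).
  have e1 : g = (fun w : Fs i => rho (Phi (inF w)) : dgrp Q).
    apply: gu; split; last exact: io_eq.
    split=> [a b|a]; first by rewrite inFM PM rhoM.
    apply: (@continuous_comp _ _ _ (@inF i) (rho \o Phi : P -> dgrp Q)); [exact: inFc|exact: rPh.2].
  have e2 : g = (fun w : Fs i => pi (inF w) : dgrp Q).
    apply: gu; split=> //; split=> [a b|a]; first by rewrite inFM piM.
    by apply: (@continuous_comp _ _ _ (@inF i) (pi : P -> dgrp Q)); [exact: inFc|exact: pic].
  by rewrite -[LHS]/((fun w : Fs i => rho (Phi (inF w)) : dgrp Q) w) -e1 e2.
have [_ _ _ univ] := prodP.
have [||g [_ gu]] := univ (dgrp Q) (fun i w => pi (inF w)) (fun k => pi (inK k)) ppQ.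
- move=> i; split=> [a b|a]; first by rewrite inFM piM.
  by apply: (@continuous_comp _ _ _ (@inF i) (pi : P -> dgrp Q)); [exact: inFc|exact: pic].
- split=> [a b|a]; first by rewrite inKM piM.
  by apply: (@continuous_comp _ _ _ inK (pi : P -> dgrp Q)); [exact: inKc|exact: pic].
have e1 : g = pi by apply: gu.
have e2 : g = rho \o Phi.
  by apply: gu; split=> // k; rewrite /= PhiK rhoK.
move=> hu; rewrite -[LHS]/((pi : P -> dgrp Q) u) -e1 e2 /= hu; exact: morph1_grp rhoM.
Qed.

End Separate.

(** N is closed, so an element u outside it stays outside N W for some open normal W; [separate] is
    applied to the finite p-quotient by N W. *)
Lemma Phi_inj u : Phi u = 1 -> (N : set P) u.
Proof.
move=> hu; apply: contrapT => nNu; have nN := ns_normal N.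
have cN : closed (N : set P).
  by apply: closed_bigI => M [].
have nb : nbhs (1 : P) [set w | ~ (N : set P) (u * w)].
  have nb' : nbhs (u * 1) (~` (N : set P)).
    by apply: open_nbhs_nbhs; split; [exact: closed_openC|rewrite mulg1].
  exact: (@mull_cts P u 1 _ nb').
have [W [oW hW]] := onormal_exists ppP.1 nb; have nW := oW.1.
pose V : set P := [set v | exists2 n, (N : set P) n & W (n^-1 * v)].
have nV : is_normal_subgroup V.
  split; first split.
  - by exists 1; [exact: nsub1|rewrite mulVg; exact: nsub1].
  - move=> a b [n hn Wa] [m hm Wb]; exists (n * m); first exact: (nsubM nN hn hm).
    exact: (nsub_mul nW Wa Wb).
  - by move=> a [n hn Wa]; exists n^-1; [exact: (nsubV nN hn)|exact: (nsub_inv nW Wa)].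
  - move=> g a [n hn Wa]; exists (g * n * g^-1); first exact: (nsubJ g nN hn).
    by apply: nsub_mul => //; rewrite ?mulVg; [apply: nsub_mul; rewrite // mulVg; exact: nsub1|exact: nsub1].
have oV : onormal V.
  split=> //; apply: subgroup_nbhs_open; first exact: nV.1.
  apply: filterS (onormal_nbhs oW) => w Ww; exists 1; first exact: nsub1.
  by rewrite invg1 mul1g.
have [t [q [qM qS qP pt]]] := pro_p_quotient pp ppP oV.
have qN v : (N : set P) v -> q v = 1.
  move=> hv; rewrite -(morph1_grp qM); apply/esym/qP; exists v; first by [].
  by rewrite invg1 mul1g mulVg; exact: nsub1.
have := separate pt qM (lc_of_quotient oV qP) qN hu.
rewrite -(morph1_grp qM) => /esym/qP; rewrite invg1 mul1g => -[n hn /(nsubV nW)].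
by rewrite invgM invgK => /hW; rewrite /= mulKVg.
Qed.

Lemma Phi_iso : exists theta : quotg N -> G, is_top_iso theta /\ forall u, theta (piq N u) = Phi u.
Proof.
have [cP _ _] := ppP.1; have [_ hG _] := ppG.1.
have /choice [theta thE] : forall w : quotg N, exists g, forall u, piq N u = w -> Phi u = g.
  elim/piq_ind => u; exists (Phi u) => v /piqP /N_kernel.
  by rewrite PM (morphV_grp PM) => h; rewrite -(mulKVg (Phi v) (Phi u)) h mulg1.
have {}thE u : theta (piq N u) = Phi u by apply/esym/thE.
have thM : {morph theta : w w' / w * w'}.
  by elim/piq_ind => u; elim/piq_ind => v; rewrite [piq N u * piq N v]piqM !thE PM.
have thc : continuous theta.
  apply/continuousP => B oB.
  have -> : theta @^-1` B = piq N @` (Phi @^-1` B).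
    apply/seteqP; split=> [|_ [u Bu <-]]; last by rewrite /= thE.
    by elim/piq_ind => u; rewrite /= thE => Bu; exists u.
  by apply: piq_open; apply: open_comp => // u _; exact: Pc.
have thI : injective theta.
  elim/piq_ind => u; elim/piq_ind => v; rewrite !thE => uv; apply/piqP; apply: Phi_inj.
  by rewrite PM (morphV_grp PM) uv mulVg.
have /choice [g gK] : forall l, exists w, theta w = l.
  by move=> l; have [u <-] := Phi_surj l; exists (piq N u).
have thK : cancel theta g by move=> w; apply: thI.
have cQ : compact [set: quotg N].
  have -> : [set: quotg N] = piq N @` [set: P].
    by apply/seteqP; split=> // w _; elim/piq_ind: w => u; exists u.
  by apply: continuous_compact => //; apply: continuous_subspaceT; exact: piq_continuous.
exists theta; split=> //; split; first by [].
by exists g; split=> //; exact: (compact_bijection cQ hG thc thK gK).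
Qed.

End BaseMap.

Lemma assembly_HNN : is_HNN p assembly_data iH.
Proof.
have [Phi [Phom PhiK PhiF]] := base_map.
have [theta [isoth thE]] := Phi_iso Phom PhiK PhiF.
by exists Fs, io, P, inF, inK, theta; split=> // k; rewrite thE PhiK.
Qed.

End Assembly.

Theorem theorem1p2 (p : nat) (F H G : topGroupType)
    (iF : F -> G) (iH : H -> G) :
  prime p ->
  finite_p_group p H ->
  free_pro_p_group p F ->
  is_semidirect iF iH ->
  permutation_module p (@ab_conj F H G iF iH) ->
  HNN_extension_with_base p iH.
Proof.
move=> pp fH frF sdG pM.
have ppF : pro_p_group p F by case: frF => ? [? [? [_ []]]].
have [ppH [t [e [eM eI eS pt]]]] := finite_group_model pp fH.
have [Y [yact [x [[yact1 yactA] x_act x_cvg b_uniq b_exists]]]] :=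
  equivariant_basis pp fH frF sdG pM eM pt.
have [ry [ryO ryA ryS]] := orbit_reps yact1 yactA.
split=> //; eexists.
exact: (assembly_HNN pp fH ppF ppH sdG eM eI eS x_act x_cvg b_uniq b_exists ryO ryA ryS).
Qed.
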